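(* Let $s\in(0,1)$, $\gamma\in(0,1]$, $\mu>0$, $\mathsf f\in L^2(0,T;\mathbb H^{-s}(\Omega))$, $\mathsf u_0\in L^2(\Omega)$, $\mathsf u_d\in L^2(Q)$, and $\mathsf a,\mathsf b\in L^2(Q)$ with $\mathsf a\le\mathsf b$ a.e. in $Q$. Then the optimal control problem: minimize $$J(\mathsf u,\mathsf z)=\frac12\int_0^T\Big(\|\mathsf u-\mathsf u_d\|_{L^2(\Omega)}^2+\mu\|\mathsf z\|_{L^2(\Omega)}^2\Big)\,dt$$ over $\mathsf z\in\mathsf Z_{\mathrm{ad}}$ and $\mathsf u\in\mathbb W$ subject to the state equation $$\partial_t^\gamma\mathsf u+\mathcal L^s\mathsf u=\mathsf f+\mathsf z\ \text{ in }\Omega\times(0,T),\qquad \mathsf u(0)=\mathsf u_0\ \text{ in }\Omega,$$ has a unique solution $(\bar{\mathsf u}(\bar{\mathsf z}),\bar{\mathsf z})\in\mathbb W\times\mathsf Z_{\mathrm{ad}}$.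
   Context: $\Omega\subset\mathbb R^n$ ($n\ge1$) is open, bounded and connected with polyhedral boundary, $T>0$, $Q=\Omega\times(0,T)$. $\mathcal Lw=-\mathrm{div}(A\nabla w)+cw$ with homogeneous Dirichlet boundary condition on $\partial\Omega$, where $0\le c\in L^\infty(\Omega)$ and $A\in C^{0,1}(\Omega,GL(n,\mathbb R))$ is symmetric and positive definite (the associated bilinear form is bounded and coercive). $\{(\lambda_k,\varphi_k)\}_{k\in\mathbb N}$ are the eigenpairs of $\mathcal L$, $\{\varphi_k\}$ an orthonormal basis of $L^2(\Omega)$, and $\mathcal L^sw=\sum_k\lambda_k^sw_k\varphi_k$ with $w_k=\int_\Omega w\varphi_k$; it extends to an isomorphism $\mathbb H^s(\Omega)\to\mathbb H^{-s}(\Omega)$, where $\mathbb H^s(\Omega)=[L^2(\Omega),H_0^1(\Omega)]_s$ and $\mathbb H^{-s}(\Omega)$ is its dual. For $\gamma\in(0,1)$, $\partial_t^\gamma$ is the left Caputo derivative, formally $\partial_t^\gamma\mathsf u(t)=\frac1{\Gamma(1-\gamma)}\int_0^t\frac{\partial_r\mathsf u(r)}{(t-r)^\gamma}\,dr$ (understood as $\frac{d}{dt}I_t^{1-\gamma}(\mathsf u-\mathsf u(0))$ for less regular functions, $(I_t^{\sigma}g)(t)=\frac1{\Gamma(\sigma)}\int_0^t(t-\xi)^{\sigma-1}g(\xi)\,d\xi$); for $\gamma=1$ it is $\partial_t$. $\mathbb W=\{w\in L^\infty(0,T;L^2(\Omega))\cap L^2(0,T;\mathbb H^s(\Omega)):\partial_t^\gamma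 w\in L^2(0,T;\mathbb H^{-s}(\Omega))\}$. $\mathsf Z_{\mathrm{ad}}=\{\mathsf w\in L^2(Q):\mathsf a\le\mathsf w\le\mathsf b\text{ a.e. in }Q\}$. For every $\mathsf z\in L^2(0,T;\mathbb H^{-s}(\Omega))$ the state equation has a unique solution in $\mathbb W$, which lies in $C([0,T];L^2(\Omega))$. *)

(* Defs.v *)
From HB Require Import structures.
From mathcomp Require Import all_boot all_order all_algebra.
From mathcomp Require Import all_classical all_reals all_analysis.

Set Implicit Arguments.
Unset Strict Implicit.
Unset Printing Implicit Defensive.

Import Order.TTheory GRing.Theory Num.Theory.
Import numFieldNormedType.Exports.

Local Open Scope classical_set_scope.
Local Open Scope ring_scope.

Definition measure_rV_display : measure_display.
Proof. exact: (measure_tuple_display default_measure_display). Qed.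

Section measurable_rV.
Variables (R : realType) (n : nat).

Let coor : 'I_n -> 'rV[R]_n -> measurableTypeR R := fun i x => x ord0 i.

Let rV_set0 : g_sigma_preimage coor set0.
Proof. exact: sigma_algebra0. Qed.

Let rV_setC A : g_sigma_preimage coor A -> g_sigma_preimage coor (~` A).
Proof. exact: sigma_algebraC. Qed.

Let rV_bigcup (F : _^nat) : (forall i, g_sigma_preimage coor (F i)) ->
  g_sigma_preimage coor (\bigcup_i (F i)).
Proof. exact: sigma_algebra_bigcup. Qed.

(* The n-fold product of the Borel sigma-algebra of R, i.e., the Borel
   sigma-algebra of R^n. *)
HB.instance Definition _ := @isMeasurable.Build measure_rV_display
  ('rV[R]_n) (g_sigma_preimage coor) rV_set0 rV_setC rV_bigcup.

Lemma measurable_coor (i : 'I_n) :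
  measurable_fun [set: 'rV[R]_n] (fun x : 'rV[R]_n => x ord0 i : measurableTypeR R).
Proof.
move=> _ Y mY; rewrite setTI; apply: sub_sigma_algebra => /=.
rewrite -bigcup_seq/=; exists i => /=; first by rewrite mem_index_enum.
by exists Y => //; rewrite setTI.
Qed.

End measurable_rV.

Lemma measurable_fun_rVP (R : realType) n d (T : measurableType d)
    (f : T -> 'rV[R]_n) :
  (forall i, measurable_fun [set: T] (fun x => f x ord0 i : measurableTypeR R)) ->
  measurable_fun [set: T] f.
Proof.
move=> mf.
pose coor (i : 'I_n) (x : 'rV[R]_n) : measurableTypeR R := x ord0 i.
have : g_sigma_preimage (fun i => coor i \o f) `<=` measurable.
  apply: smallest_sub; first exact: sigma_algebra_measurable.
  case: n f mf @coor => [|m] f mf coor; first by rewrite big_ord0.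
  rewrite -bigcup_mkord_ord; apply: bigcup_sub => i Ii.
  by move=> A [B mB <-]; exact: mf.
by rewrite g_sigma_preimage_comp => prefS _ A mA; apply: prefS; exists A.
Qed.

Section lebesgue_rV.
Variable R : realType.

Definition rV_cons n (p : measurableTypeR R * 'rV[R]_n) : 'rV[R]_n.+1 :=
  \row_i oapp (fun j => p.2 ord0 j) p.1 (unlift ord0 i).

Definition rV_uncons n (x : 'rV[R]_n.+1) : measurableTypeR R * 'rV[R]_n :=
  (x ord0 ord0, \row_j x ord0 (lift ord0 j)).

Lemma rV_consK n : cancel (@rV_cons n) (@rV_uncons n).
Proof.
move=> [x v]; rewrite /rV_uncons /rV_cons mxE unlift_none /=; congr pair.
by apply/rowP => j; rewrite !mxE liftK.
Qed.

Lemma measurable_rV_cons n : measurable_fun [set: _] (@rV_cons n).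
Proof.
apply: measurable_fun_rVP => i.
under eq_fun do rewrite mxE.
case: unliftP => [j _|_] /=; last exact: measurable_fst.
exact: (measurableT_comp (@measurable_coor R n j) measurable_snd).
Qed.

Lemma measurable_rV_uncons n : measurable_fun [set: _] (@rV_uncons n).
Proof.
apply: measurable_fun_pair; first exact: measurable_coor.
apply: measurable_fun_rVP => j.
under eq_fun do rewrite mxE.
exact: measurable_coor.
Qed.

Section step.
Variables (nu : {sigma_finite_measure set (measurableTypeR R) -> \bar R}).
Variables (n : nat) (mu : {sigma_finite_measure set 'rV[R]_n -> \bar R}).
Local Open Scope ereal_scope.

Definition measure_rV_cons : set 'rV[R]_n.+1 -> \bar R :=
  pushforward (nu \x mu) (@rV_cons n).

Let cons0 : measure_rV_cons set0 = 0.
Proof. by rewrite /measure_rV_cons /pushforward preimage_set0 measure0. Qed.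

Let cons_ge0 A : 0 <= measure_rV_cons A.
Proof. by rewrite /measure_rV_cons /pushforward; exact: measure_ge0. Qed.

Let cons_sigma_additive : semi_sigma_additive measure_rV_cons.
Proof.
move=> F mF tF mUF; rewrite /measure_rV_cons /pushforward preimage_bigcup.
have mc := @measurable_rV_cons n.
apply: measure_semi_sigma_additive.
- by move=> k; rewrite -[X in measurable X]setTI; exact: mc.
- apply/trivIsetP => /= i j _ _ ij; rewrite -preimage_setI.
  by move/trivIsetP : tF => /(_ _ _ _ _ ij) ->//; rewrite preimage_set0.
- by rewrite -preimage_bigcup -[X in measurable X]setTI; exact: mc.
Qed.

HB.instance Definition _ := isMeasure.Build _ _ _
  measure_rV_cons cons0 cons_ge0 cons_sigma_additive.

Let cons_sigma_finite : sigma_finite [set: 'rV[R]_n.+1] measure_rV_cons.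
Proof.
have /sigma_finiteP[F [FT ndF Foo]] := sigma_finiteT nu.
have /sigma_finiteP[G [GT ndG Goo]] := sigma_finiteT mu.
exists (fun k => @rV_uncons n @^-1` (F k `*` G k)).
  rewrite -preimage_bigcup (_ : \bigcup_k (F k `*` G k) = setT) ?preimage_setT//.
  rewrite -subTset => -[x y] _.
  have [i _ Fx] : (\bigcup_k F k) x by rewrite -FT.
  have [j _ Gy] : (\bigcup_k G k) y by rewrite -GT.
  exists (maxn i j) => //; split => /=.
  - by move: x Fx; exact/subsetPset/ndF/leq_maxl.
  - by move: y Gy; exact/subsetPset/ndG/leq_maxr.
move=> k; have [mF Fk] := Foo k; have [mG Gk] := Goo k; split.
  rewrite -[X in measurable X]setTI; apply: measurable_rV_uncons => //.
  exact: measurableX.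
rewrite /measure_rV_cons /pushforward -comp_preimage.
rewrite (_ : _ @^-1` _ = F k `*` G k); last first.
  by apply/funext => p; rewrite /preimage/= -[in RHS](rV_consK p).
by rewrite product_measure1E// lte_mul_pinfty// ge0_fin_numE.
Qed.

HB.instance Definition _ := Measure_isSigmaFinite.Build _ _ _
  measure_rV_cons cons_sigma_finite.

End step.

(* Iterated product of the Lebesgue measure of R. *)
Fixpoint lebesgue_rV n : {sigma_finite_measure set 'rV[R]_n -> \bar R} :=
  match n with
  | 0%N => \d_(0 : 'rV[R]_0)
  | m.+1 => measure_rV_cons (@lebesgue_measure R) (lebesgue_rV m)
  end.

End lebesgue_rV.

Section basic_spaces.
Context {R : realType}.

Definition L2 d (X : measurableType d) (mu : set X -> \bar R) (D : set X)
    (f : X -> R) : Prop :=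
  measurable_fun D f /\ (\int[mu]_(x in D) ((f x) ^+ 2)%:E < +oo)%E.

(* Iterated directional derivatives; in finite dimension, f is C^oo iff they
   all exist and are continuous. *)
Definition iter_deriv (V : normedModType R) (vs : seq V) (f : V -> R) : V -> R :=
  foldr (fun v g x => 'D_v g x) f vs.

Definition smooth (V : normedModType R) (f : V -> R) : Prop :=
  forall vs : seq V,
    continuous (iter_deriv vs f) /\
    forall x v, derivable (iter_deriv vs f) x v.

Definition test_function (V : normedModType R) (D : set V) (f : V -> R) : Prop :=
  [/\ smooth f, compact (closure [set x | f x != 0])
    & closure [set x | f x != 0] `<=` D].

Definition weak_derivative (T : R) (h g : R -> R) : Prop :=
  forall psi : R -> R, test_function `]0, T[ psi ->
    \int[lebesgue_measure]_(t in `]0, T[) (h t * 'D_1 psi t) =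
    - \int[lebesgue_measure]_(t in `]0, T[) (g t * psi t).

Definition Gamma (a : R) : R :=
  \int[lebesgue_measure]_(t in `]0, +oo[) (t `^ (a - 1) * expR (- t)).

(* Riemann-Liouville integral I_t^a g *)
Definition frac_integral (a : R) (g : R -> R) (t : R) : R :=
  (Gamma a)^-1 *
  \int[lebesgue_measure]_(x in `]0, t[) ((t - x) `^ (a - 1) * g x).

End basic_spaces.

(* Bochner spaces on (0, T). A normed space is presented by a carrier X inside an ambient lmodType V
   of representatives, and a seminorm N on X. *)

Section bochner.
Context {R : realType} {V : lmodType R}.
Variables (T : R) (X : set V) (N : V -> R).

Definition simple_function (f : R -> V) : Prop :=
  exists (m : nat) (E : 'I_m -> set R) (x : 'I_m -> V),
    [/\ forall i, measurable (E i), forall i, X (x i)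
      & forall t, f t = \sum_(i < m) \1_(E i) t *: x i].

Definition strongly_measurable (f : R -> V) : Prop :=
  exists2 f_ : nat -> R -> V, (forall k, simple_function (f_ k)) &
    \forall t \ae lebesgue_measure, t \in `]0, T[ ->
      X (f t) /\ (fun k => N (f_ k t - f t)) @ \oo --> (0 : R).

Definition bochner_L2 (f : R -> V) : Prop :=
  strongly_measurable f /\
  (\int[lebesgue_measure]_(t in `]0%R, T[) (N (f t) ^+ 2)%:E < +oo)%E.

Definition bochner_Loo (f : R -> V) : Prop :=
  strongly_measurable f /\
  exists M : R, \forall t \ae lebesgue_measure, t \in `]0, T[ -> N (f t) <= M.

End bochner.

Section omega.
Context {R : realType} {n : nat}.
Variable Omega : set 'rV[R]_n.

Local Notation point := 'rV[R]_n.
Local Notation mu := (lebesgue_rV R n).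

Definition L2O : set (point -> R) := L2 mu Omega.

Definition ip (v w : point -> R) : R := \int[mu]_(x in Omega) (v x * w x).

Definition nL2 (w : point -> R) : R := Num.sqrt (ip w w).

Definition partial (i : 'I_n) (f : point -> R) (x : point) : R :=
  'D_(delta_mx ord0 i) f x.

(* w is in H_0^1(Omega), the closure of C_c^oo(Omega) for the H^1 norm, and
   G is its weak gradient, i.e., the L^2 limit of the gradients. *)
Definition H10 (w : point -> R) (G : 'I_n -> point -> R) : Prop :=
  [/\ L2O w, forall i, L2O (G i)
    & exists2 psi : nat -> point -> R,
        forall k, test_function Omega (psi k)
      & (fun k => nL2 (psi k - w)) @ \oo --> (0 : R) /\
        forall i, (fun k => nL2 (partial i (psi k) - G i)) @ \oo --> (0 : R)].

Definition nH1 (w : point -> R) (G : 'I_n -> point -> R) : R :=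
  Num.sqrt (nL2 w ^+ 2 + \sum_(i < n) nL2 (G i) ^+ 2).

(* K-functional of the couple (L^2(Omega), H_0^1(Omega)), over the
   decompositions w = (w - w1) + w1 *)
Definition Kfun (t : R) (w : point -> R) : R :=
  inf [set k | exists (w1 : point -> R) (G1 : 'I_n -> point -> R),
    H10 w1 G1 /\ k = Num.sqrt (nL2 (w - w1) ^+ 2 + t ^+ 2 * nH1 w1 G1 ^+ 2)].

(* Square of the norm of the interpolation space [L^2, H_0^1]_(s, 2). *)
Definition nHs2 (s : R) (w : point -> R) : \bar R :=
  (\int[lebesgue_measure]_(t in `]0%R, +oo[)
     ((t `^ (- s) * Kfun t w) ^+ 2 / t)%:E)%E.

Definition Hs (s : R) : set (point -> R) :=
  [set w | L2O w /\ (nHs2 s w < +oo)%E].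

Definition nHs (s : R) (w : point -> R) : R := Num.sqrt (fine (nHs2 s w)).

(* The dual of H^s(Omega): linear functionals, of which only the values on
   H^s(Omega) matter. *)
Definition Hms (s : R) : set ((point -> R) -> R) :=
  [set l | (forall (a : R) v w, Hs s v -> Hs s w ->
              l (a *: v + w) = a * l v + l w) /\
           exists C : R, forall v, Hs s v -> `|l v| <= C * nHs s v].

Definition nHms (s : R) (l : (point -> R) -> R) : R :=
  sup [set `|l v| | v in [set v | Hs s v /\ nHs s v <= 1]].

End omega.

Section domain.
Context {R : realType} {n : nat}.

Definition polytope m (p : 'I_m -> 'rV[R]_n) : set 'rV[R]_n :=
  [set x | exists a : 'I_m -> R,
    [/\ forall i, 0 <= a i, \sum_(i < m) a i = 1
      & x = \sum_(i < m) a i *: p i]].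

(* (n-1)-dimensional convex polytope *)
Definition facet (F : set 'rV[R]_n) : Prop :=
  exists m (p : 'I_m.+1 -> 'rV[R]_n),
    \rank (\matrix_(i < m.+1) (p i - p ord0)) = n.-1 /\ F = polytope p.

Definition polyhedral_boundary (Omega : set 'rV[R]_n) : Prop :=
  exists N (F : 'I_N -> set 'rV[R]_n),
    (forall j, facet (F j)) /\
    closure Omega `\` Omega° = [set x | exists j, F j x].

End domain.

(* Weak formulation of L w = - div (A grad w) + c w. *)

Section elliptic.
Context {R : realType} {n : nat}.
Variable Omega : set 'rV[R]_n.
Variables (A : 'rV[R]_n -> 'M[R]_n) (c : 'rV[R]_n -> R).

Local Notation point := 'rV[R]_n.
Local Notation mu := (lebesgue_rV R n).

(* G and H stand for the weak gradients of w and v. *)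
Definition bilinear_form (w : point -> R) (G : 'I_n -> point -> R)
    (v : point -> R) (H : 'I_n -> point -> R) : R :=
  \int[mu]_(x in Omega)
    (\sum_(i < n) \sum_(j < n) A x i j * G j x * H i x + c x * w x * v x).

Definition admissible_coefficients : Prop :=
  [/\ [lipschitz A x | x in Omega],
      forall x, Omega x ->
        [/\ A x \in unitmx, (A x)^T = A x
          & forall xi : 'rV[R]_n, xi != 0 -> 0 < (xi *m A x *m xi^T) ord0 ord0],
      measurable_fun Omega c /\
        (exists M : R, \forall x \ae mu, Omega x -> 0 <= c x <= M),
      exists C : R, forall w G v H, H10 Omega w G -> H10 Omega v H ->
        `|bilinear_form w G v H| <= C * nH1 Omega w G * nH1 Omega v H
    & exists2 alpha : R, 0 < alpha & forall w G, H10 Omega w G ->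
        alpha * nH1 Omega w G ^+ 2 <= bilinear_form w G w G].

(* The (lambda k, phi k) are the eigenpairs of L with homogeneous Dirichlet
   condition, and phi is an orthonormal basis of L^2(Omega). *)
Definition eigenbasis (lambda : nat -> R) (phi : nat -> point -> R) : Prop :=
  [/\ forall k, exists2 G, H10 Omega (phi k) G &
        forall v H, H10 Omega v H ->
          bilinear_form (phi k) G v H = lambda k * ip Omega (phi k) v,
      forall j k, ip Omega (phi j) (phi k) = (j == k)%:R
    & forall w, L2O Omega w ->
        (fun N => nL2 Omega (w - \sum_(k < N) ip Omega w (phi k) *: phi k))
          @ \oo --> (0 : R)].

(* The functional L^s w : H^s -> R, for w in H^s: the duality pairing of
   \sum_k lambda_k^s w_k phi_k with v. *)
Definition frac_op (lambda : nat -> R) (phi : nat -> point -> R) (s : R)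
    (w v : point -> R) : R :=
  limn (series (fun k => lambda k `^ s * ip Omega w (phi k) * ip Omega v (phi k))).

End elliptic.

Section control.
Context {R : realType} {n : nat}.
Variables (Omega : set 'rV[R]_n) (T s gamma : R).
Variables (lambda : nat -> R) (phi : nat -> 'rV[R]_n -> R).

Local Notation point := 'rV[R]_n.
Local Notation mu := (lebesgue_rV R n).
Local Notation leb := (@lebesgue_measure R).
Local Notation dual := ((point -> R) -> R).

(* Q, with the time variable first *)
Definition cylinder : set (measurableTypeR R * point) := `]0, T[%classic `*` Omega.

Definition L2Q (z : R -> point -> R) : Prop :=
  L2 (leb \x mu)%E cylinder (fun p => z p.1 p.2).

Definition L2_Hms : (R -> dual) -> Prop :=
  bochner_L2 T (Hms Omega s) (nHms Omega s).

(* u(0) = w0: u(t) tends to w0 in L^2(Omega) as t -> 0, up to a null set of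
   times (if u has a representative in C([0, T]; L^2(Omega)), w0 is its value
   at 0). *)
Definition initial_value (u : R -> point -> R) (w0 : point -> R) : Prop :=
  L2O Omega w0 /\
  forall e : R, 0 < e -> exists2 d : R, 0 < d &
    \forall t \ae leb, t \in `]0, Num.min d T[ -> nL2 Omega (u t - w0) <= e.

(* g is the left Caputo derivative of u (d/dt I^(1-gamma) (u - u(0)) if
   gamma < 1, du/dt if gamma = 1) as a distribution on (0, T) with values in
   H^-s(Omega). *)
Definition caputo (u : R -> point -> R) (g : R -> dual) : Prop :=
  if gamma == 1 then
    forall v, Hs Omega s v ->
      weak_derivative T (fun t => ip Omega (u t) v) (fun t => g t v)
  else
    exists2 w0, initial_value u w0 & forall v, Hs Omega s v ->
      weak_derivative T
        (frac_integral (1 - gamma) (fun t => ip Omega (u t - w0) v))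
        (fun t => g t v).

Definition spaceW (u : R -> point -> R) : Prop :=
  [/\ bochner_Loo T (L2O Omega) (nL2 Omega) u,
      bochner_L2 T (Hs Omega s) (nHs Omega s) u
    & exists2 g, L2_Hms g & caputo u g].

Definition Zad (a b z : R -> point -> R) : Prop :=
  L2Q z /\
  \forall p \ae (leb \x mu)%E, cylinder p -> a p.1 p.2 <= z p.1 p.2 <= b p.1 p.2.

(* The state equation, an identity in L^2(0, T; H^-s(Omega)); the control z is
   embedded there through the L^2(Omega) pairing. *)
Definition state_equation (f : R -> dual) (u0 : point -> R)
    (u z : R -> point -> R) : Prop :=
  initial_value u u0 /\
  exists g, [/\ L2_Hms g, caputo u g &
    \forall t \ae leb, t \in `]0, T[ -> forall v, Hs Omega s v ->
      g t v + frac_op Omega lambda phi s (u t) v = f t v + ip Omega (z t) v].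

Definition cost (m : R) (ud u z : R -> point -> R) : \bar R :=
  ((2^-1)%:E * \int[leb]_(t in `]0%R, T[)
     (nL2 Omega (u t - ud t)%R ^+ 2 + m * nL2 Omega (z t) ^+ 2)%:E)%E.

Definition feasible f u0 a b (u z : R -> point -> R) : Prop :=
  [/\ spaceW u, Zad a b z & state_equation f u0 u z].

Definition optimal (m : R) ud f u0 a b (u z : R -> point -> R) : Prop :=
  feasible f u0 a b u z /\
  forall u' z', feasible f u0 a b u' z' ->
    (cost m ud u z <= cost m ud u' z')%E.

(* equality in L^2(Q) *)
Definition eqQ (z z' : R -> point -> R) : Prop :=
  \forall p \ae (leb \x mu)%E, cylinder p -> z p.1 p.2 = z' p.1 p.2.

(* equality as functions of time with values in L^2(Omega) *)
Definition eqW (u u' : R -> point -> R) : Prop :=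
  \forall t \ae leb, t \in `]0, T[ ->
    \forall x \ae mu, Omega x -> u t x = u' t x.

End control.

(* Main.v *)
Require Import Defs.
From mathcomp Require Import all_boot all_order all_algebra.
From mathcomp Require Import all_classical all_reals all_analysis.
From mathcomp Require Import measurable_realfun.
From mathcomp Require Import ring lra.

Import Order.TTheory GRing.Theory Num.Theory.
Import numFieldNormedType.Exports.

Set Implicit Arguments.
Unset Strict Implicit.
Unset Printing Implicit Defensive.

Local Open Scope classical_set_scope.
Local Open Scope ring_scope.

(** The state depends affinely on the control, and the control enters the cost
    through [m] times the squared norm of L^2(Q). The reduced cost is therefore
    strongly convex: the cost of the midpoint of two admissible controls [z] and
    [z'] is at most the mean of their costs minus a multiple of [|z - z'|^2]
    ([cost_value_midpoint]). Hence minimizing sequences are Cauchy and minimizers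
    unique. The limit of a minimizing sequence is admissible because the
    constraints are pointwise, and it is a minimizer if the reduced cost is lower
    semicontinuous ([minimizer_exists], [minimizer_unique]).

    What has to be proved is thus that the state is unique, affine in the control
    and continuous in it, in a sense strong enough for lower semicontinuity. All
    this is read off the coefficients [y_j(t) = <u(t), phi_j>]. Testing the state
    equation with [phi_j] gives the scalar fractional equation
    [D^gamma y_j + lambda_j^s y_j = f_j + z_j], [y_j(0) = <u0, phi_j>]
    ([state_modes]). The derivative is understood in the sense of distributions;
    the du Bois-Reymond lemma integrates it, and inverting Abel's integral
    equation ([abel_inversion]) leads to the Volterra form
    [y_j = y_j(0) + c k * g_j] and [g_j + lambda_j^s y_j = f_j + z_j], where [k] is
    the kernel [t^(gamma - 1)] ([scalar_caputo_rep]). In the difference of two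
    solutions the data [f] and [u0] cancel, and an estimate in L^2 with an
    exponential weight bounds the difference of the modes by that of the controls
    ([volterra_estimate]). The constant depends on [j], but this is harmless: by
    Parseval's identity the misfit is the supremum of its truncations to finitely
    many modes ([misfit_le]), each of which is continuous in the control.

    Functions of time with values in L^2 or H^-s are strongly measurable, which
    makes their scalar coefficients equal almost everywhere to Borel functions
    ([strongly_measurable_version]); the integral does not distinguish the two,
    even for functions that are not measurable ([ae_eq_integral_nonmeas]). *)

(** * Integrals of functions that need not be measurable *)

Section nonmeasurable_integrals.
Import HBNNSimple.
Context d (X : measurableType d) (R : realType).
Variable mu : {measure set X -> \bar R}.
Local Open Scope ereal_scope.

(** The integral of a nonnegative function is a supremum over the simple
    functions below it, and this supremum is monotone whether or not the
    function is measurable. Functions such as [t |-> nL2 (u t)] are only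
    known to agree almost everywhere with a Borel function, so this is the
    form of monotonicity that applies to them. *)
Lemma ge0_le_integral_nonmeas (D : set X) (f g : X -> \bar R) :
  (forall x, D x -> 0 <= f x) -> (forall x, D x -> f x <= g x) ->
  \int[mu]_(x in D) f x <= \int[mu]_(x in D) g x.
Proof.
move=> f0 fg; rewrite !ge0_integralE//; last first.
  by move=> x Dx; exact: le_trans (f0 _ Dx) (fg _ Dx).
apply: le_ereal_sup => _ [h hf <-]; exists h => // x.
apply: le_trans (hf x) _; rewrite !patchE; case: ifPn => // xD.
by apply: fg; rewrite inE in xD.
Qed.

(** Simple functions below [f] do not feel the null set [N], hence neither
    does their supremum. *)
Lemma ge0_negligible_integral_nonmeas (D N : set X) (f : X -> \bar R) :
  measurable N -> measurable D -> (forall x, D x -> 0 <= f x) ->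
  mu N = 0 -> \int[mu]_(x in D) f x = \int[mu]_(x in D `\` N) f x.
Proof.
move=> mN mD f0 N0; apply/eqP; rewrite eq_le; apply/andP; split; last first.
  rewrite integral_mkcond [leRHS]integral_mkcond.
  apply: ge0_le_integral_nonmeas => x _; rewrite !patchE.
    by case: ifPn => //; rewrite inE => -[Dx _]; exact: f0.
  case: ifPn => [|_]; first by rewrite inE => -[Dx _]; rewrite mem_set.
  by case: ifPn => //; rewrite inE; exact: f0.
rewrite [leLHS]ge0_integralE//; apply: ge_ereal_sup => _ [h hf <-].
rewrite -integralT_nnsfun (ge0_negligible_integral mN)//; last 2 first.
- by apply/measurable_EFinP.
- by move=> x _; rewrite lee_fin.
rewrite integral_mkcond [leRHS]integral_mkcond.
apply: ge0_le_integral_nonmeas => x _; rewrite !patchE.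
  by case: ifPn => // _; rewrite lee_fin.
case: ifPn => [|_]; last first.
  by case: ifPn => //; rewrite inE => -[Dx _]; exact: f0.
rewrite inE => -[_ Nx]; have := hf x; rewrite patchE.
case: ifPn => xD; first by rewrite mem_set//; rewrite inE in xD.
by rewrite memNset// => -[Dx _]; rewrite notin_setE in xD.
Qed.

Lemma ge0_ae_le_integral_nonmeas (D : set X) (f g : X -> \bar R) :
  measurable D -> (forall x, D x -> 0 <= f x) -> (forall x, D x -> 0 <= g x) ->
  (\forall x \ae mu, D x -> f x <= g x) ->
  \int[mu]_(x in D) f x <= \int[mu]_(x in D) g x.
Proof.
move=> mD f0 g0 [N [mN N0 subN]].
rewrite (ge0_negligible_integral_nonmeas mN)// [leRHS](ge0_negligible_integral_nonmeas mN)//.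
apply: ge0_le_integral_nonmeas => x [Dx Nx]; first exact: f0.
by apply: contrapT => fg; apply: Nx; apply: subN => /= /(_ Dx).
Qed.

Lemma ge0_ae_eq_integral_nonmeas (D : set X) (f g : X -> \bar R) :
  measurable D -> (forall x, D x -> 0 <= f x) -> (forall x, D x -> 0 <= g x) ->
  (\forall x \ae mu, D x -> f x = g x) ->
  \int[mu]_(x in D) f x = \int[mu]_(x in D) g x.
Proof.
move=> mD f0 g0 fg; apply/eqP; rewrite eq_le; apply/andP; split;
  apply: ge0_ae_le_integral_nonmeas => //;
  by apply: filterS fg => x + Dx => /(_ Dx) ->.
Qed.

(** This allows the replacement of an arbitrary function by a Borel version
    under the integral sign. *)
Lemma ae_eq_integral_nonmeas (D : set X) (f g : X -> \bar R) :
  measurable D -> (\forall x \ae mu, D x -> f x = g x) ->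
  \int[mu]_(x in D) f x = \int[mu]_(x in D) g x.
Proof.
move=> mD fg; rewrite integralE [RHS]integralE; congr (_ - _);
  apply: ge0_ae_eq_integral_nonmeas => //;
  by apply: filterS fg => x + Dx => /(_ Dx); rewrite ?funeposE ?funenegE => ->.
Qed.

End nonmeasurable_integrals.

(** The upper limit of a sequence of measurable functions is measurable and
    agrees with the limit wherever the latter exists. *)
Lemma measurable_fun_cvg_version d (X : measurableType d) (R : realType)
    (D : set X) (f : nat -> X -> R) :
  (forall k, measurable_fun D (f k)) ->
  exists2 g : X -> R, measurable_fun D g &
    forall x l, (fun k => f k x) @ \oo --> (l : R) -> g x = l.
Proof.
move=> mf; exists (fun x => fine (limn_esup (fun k => (f k x)%:E))).
  apply: measurableT_comp => //.
  by apply: measurable_fun_limn_esup => k; exact/measurable_EFinP.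
move=> x l fl.
have fl' : (f k x)%:E @[k --> \oo] --> l%:E.
  by apply/fine_cvgP; split => //; near=> k.
by rewrite is_cvg_limn_esupE; [rewrite (cvg_lim _ fl')|apply/cvg_ex; exists l%:E].
Unshelve. all: end_near. Qed.

(** * Square integrable functions *)

Section L2_space.
Context d (X : measurableType d) (R : realType).
Variable mu : {measure set X -> \bar R}.
Variable D : set X.
Hypothesis mD : measurable D.

Let integrable_sqr (f : X -> R) : L2 mu D f ->
  mu.-integrable D (EFin \o (fun x => f x ^+ 2)).
Proof.
move=> [mf foo]; apply/integrableP; split.
  by apply/measurable_EFinP; exact: measurable_funX.
apply: le_lt_trans foo; rewrite le_eqVlt; apply/orP; left; apply/eqP.
by apply: eq_integral => x _ /=; rewrite ger0_norm// sqr_ge0.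
Qed.

Lemma L2_integrableM (f g : X -> R) : L2 mu D f -> L2 mu D g ->
  mu.-integrable D (EFin \o (fun x => f x * g x)).
Proof.
move=> Lf Lg; have [mf _] := Lf; have [mg _] := Lg.
have := integrableD mD (integrable_sqr Lf) (integrable_sqr Lg).
apply: le_integrable => //; first by apply/measurable_EFinP; exact: measurable_funM.
move=> x Dx /=; rewrite lee_fin [leRHS]ger0_norm ?addr_ge0 ?sqr_ge0//.
by rewrite normrM -(real_normK (num_real (f x))) -(real_normK (num_real (g x))); nra.
Qed.

Lemma L2Z (a : R) (f : X -> R) : L2 mu D f -> L2 mu D (a *: f).
Proof.
move=> Lf; have [mf _] := Lf; split; first exact: measurable_funM.
have := integrableZl mD (a ^+ 2) (integrable_sqr Lf).
move=> /integrableP[_]; apply: le_lt_trans.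
apply: ge0_le_integral_nonmeas => x _; first by rewrite lee_fin sqr_ge0.
by rewrite /= lee_fin exprMn ler_norm.
Qed.

Lemma L2D (f g : X -> R) : L2 mu D f -> L2 mu D g -> L2 mu D (f + g).
Proof.
move=> Lf Lg; have [mf _] := Lf; have [mg _] := Lg.
split; first exact: measurable_funD.
have /(integrableZl mD 2) := integrableD mD (integrable_sqr Lf) (integrable_sqr Lg).
move=> /integrableP[_]; apply: le_lt_trans.
apply: ge0_le_integral_nonmeas => x _; first by rewrite lee_fin sqr_ge0.
rewrite /= lee_fin; apply: le_trans (ler_norm _).
by rewrite -[(f + g) x]/(f x + g x); have := sqr_ge0 (f x - g x); nra.
Qed.

Lemma L2B (f g : X -> R) : L2 mu D f -> L2 mu D g -> L2 mu D (f - g).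
Proof. by move=> Lf Lg; rewrite -scaleN1r; apply: L2D => //; exact: L2Z. Qed.

Lemma L2_0 : L2 mu D 0.
Proof.
split; first exact: measurable_cst.
by rewrite integral0_eq ?ltry// => x _; rewrite expr0n.
Qed.

Lemma L2_sum (I : Type) (r : seq I) (P : pred I) (f : I -> X -> R) :
  (forall i, P i -> L2 mu D (f i)) -> L2 mu D (\sum_(i <- r | P i) f i).
Proof. by move=> Lf; apply: big_ind => //; [exact: L2_0|exact: L2D]. Qed.

Definition L2ip (f g : X -> R) : R := \int[mu]_(x in D) (f x * g x).

Lemma L2ipC f g : L2ip f g = L2ip g f.
Proof. by apply: eq_Rintegral => x _; rewrite mulrC. Qed.

Lemma L2ipDl f g h : L2 mu D f -> L2 mu D g -> L2 mu D h ->
  L2ip (f + g) h = L2ip f h + L2ip g h.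
Proof.
move=> Lf Lg Lh; rewrite -RintegralD//; [|exact: L2_integrableM..].
by apply: eq_Rintegral => x _; rewrite -mulrDl.
Qed.

Lemma L2ipZl a f h : L2 mu D f -> L2 mu D h -> L2ip (a *: f) h = a * L2ip f h.
Proof.
move=> Lf Lh; rewrite -RintegralZl//; [|exact: L2_integrableM].
by apply: eq_Rintegral => x _; rewrite mulrA.
Qed.

Lemma L2ipBl f g h : L2 mu D f -> L2 mu D g -> L2 mu D h ->
  L2ip (f - g) h = L2ip f h - L2ip g h.
Proof.
move=> Lf Lg Lh; rewrite -scaleN1r L2ipDl//; last exact: L2Z.
by rewrite L2ipZl// mulN1r.
Qed.

Lemma L2ip_ge0 f : 0 <= L2ip f f.
Proof. by apply: Rintegral_ge0 => x _; rewrite -expr2 sqr_ge0. Qed.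

Lemma L2ip_sqr f : L2 mu D f ->
  (\int[mu]_(x in D) ((f x) ^+ 2)%:E)%E = (L2ip f f)%:E.
Proof.
move=> Lf; rewrite fineK//; last exact: integrable_fin_num (L2_integrableM Lf Lf).
Qed.

Lemma L2ip_suml (I : Type) (r : seq I) (f : I -> X -> R) h :
  (forall i, L2 mu D (f i)) -> L2 mu D h ->
  L2ip (\sum_(i <- r) f i) h = \sum_(i <- r) L2ip (f i) h.
Proof.
move=> Lf Lh; elim: r => [|i r ih].
  by rewrite !big_nil /L2ip /Rintegral integral0_eq// => x _; rewrite mul0r.
by rewrite !big_cons L2ipDl// ?ih//; exact: L2_sum.
Qed.

Lemma L2ip_sqrB f g : L2 mu D f -> L2 mu D g ->
  L2ip (f - g) (f - g) = L2ip f f - 2 * L2ip f g + L2ip g g.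
Proof.
move=> Lf Lg; have Lfg := L2B Lf Lg.
rewrite L2ipBl// L2ipC (L2ipC g) !L2ipBl// (L2ipC g f); ring.
Qed.

Lemma L2ip_sqrZ a f : L2 mu D f -> L2ip (a *: f) (a *: f) = a ^+ 2 * L2ip f f.
Proof.
move=> Lf; have Laf := L2Z a Lf.
by rewrite (L2ipZl _ Lf Laf) (L2ipC f) (L2ipZl _ Lf Lf) mulrA.
Qed.

Lemma L2ip_sqrB_le f g : L2 mu D f -> L2 mu D g ->
  L2ip (f - g) (f - g) <= 2 * L2ip f f + 2 * L2ip g g.
Proof.
move=> Lf Lg; have LNg := L2Z (-1) Lg; have := L2ip_ge0 (f - (-1) *: g).
rewrite (L2ip_sqrB Lf LNg) (L2ip_sqrB Lf Lg) (L2ip_sqrZ _ Lg).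
by rewrite (L2ipC f (_ *: _)) (L2ipZl _ Lg Lf) (L2ipC g f); lra.
Qed.

(** The quadratic polynomial [a |-> |f - a g|^2] is nonnegative; its value
    at [a = <f,g>/|g|^2] gives the inequality when [g] is not null. *)
Lemma L2_cauchy_schwarz f g : L2 mu D f -> L2 mu D g ->
  L2ip f g ^+ 2 <= L2ip f f * L2ip g g.
Proof.
move=> Lf Lg.
have key (a : R) : 0 <= L2ip f f - 2 * a * L2ip f g + a ^+ 2 * L2ip g g.
  have := L2ip_ge0 (f - a *: g); rewrite L2ip_sqrB//; last exact: L2Z.
  rewrite (L2ipC f) !L2ipZl//; last exact: L2Z.
  by rewrite (L2ipC g (a *: g)) !L2ipZl// (L2ipC g f); nra.
have := L2ip_ge0 g; rewrite le_eqVlt => /predU1P[g0|g0].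
  have fg0 : L2ip f g = 0.
    apply: contrapT => /eqP fg0.
    have := key ((L2ip f f + 1) / (2 * L2ip f g)); rewrite -g0 mulr0 addr0.
    rewrite (_ : 2 * _ * _ = L2ip f f + 1); first by nra.
    by field.
  by rewrite fg0 -g0 expr0n mulr0.
have := key (L2ip f g / L2ip g g).
rewrite (_ : _ + _ = L2ip f f - L2ip f g ^+ 2 / L2ip g g); last first.
  by field; rewrite gt_eqF.
by rewrite subr_ge0 ler_pdivrMr.
Qed.

End L2_space.

(** The Riesz-Fischer argument for a rapidly Cauchy sequence: since [4^k
    |z_(k+1) - z_k|^2] has a summable integral, the series of these squares
    is finite almost everywhere, which makes the increments [z_(k+1) - z_k]
    geometrically small at almost every point. The distance to the limit
    then follows from Fatou's lemma. *)
Lemma L2_fast_cauchy_limit d (X : measurableType d) (R : realType)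
    (mu : {measure set X -> \bar R}) (D : set X) (z : nat -> X -> R) :
  measurable D -> (forall k, L2 mu D (z k)) ->
  (forall k l, (k <= l)%N ->
    (\int[mu]_(x in D) ((z l x - z k x) ^+ 2)%:E <= ((16 ^+ k)^-1)%:E)%E) ->
  exists w : X -> R, [/\ L2 mu D w,
    \forall x \ae mu, D x -> (fun k => z k x) @ \oo --> w x &
    forall k, (\int[mu]_(x in D) ((w x - z k x) ^+ 2)%:E <= ((16 ^+ k)^-1)%:E)%E].
Proof.
move=> mD Lz zC; have mz k : measurable_fun D (z k) by case: (Lz k).
(* The weight 4 ^ k leaves an integrable sum and makes the increments of
   order 2 ^ - k. *)
pose S x := (\sum_(k <oo) (4 ^+ k * (z k.+1 x - z k x) ^+ 2)%:E)%E.
have t0 k x : (0 <= (4 ^+ k * (z k.+1 x - z k x) ^+ 2)%:E)%E.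
  by rewrite lee_fin mulr_ge0 ?sqr_ge0// exprn_ge0.
have S0 x : (0 <= S x)%E by apply: nneseries_ge0 => k _ _; exact: t0.
have mt k : measurable_fun D (fun x => (4 ^+ k * (z k.+1 x - z k x) ^+ 2)%:E).
  apply/measurable_EFinP; apply: measurable_funM => //.
  by apply: measurable_funX; exact: measurable_funB.
have mS : measurable_fun D S by apply: ge0_emeasurable_sum => // k x _ _; exact: t0.
have iS : (\int[mu]_(x in D) S x < +oo)%E.
  rewrite integral_nneseries//.
  apply: le_lt_trans (_ : (2%:E < +oo)%E); last exact: ltry.
  apply: le_trans (epsilon_trick0 xpredT (ler0n R 2)).
  apply: lee_nneseries => [k _ _|k _]; first exact: integral_ge0.
  under eq_integral do rewrite EFinM.
  rewrite ge0_integralZl//; last 2 first.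
  - apply/measurable_EFinP; apply: measurable_funX; exact: measurable_funB.
  - by move=> x _; rewrite lee_fin sqr_ge0.
  apply: (@le_trans _ _ ((4 ^+ k)%:E * ((16 ^+ k)^-1)%:E)%E).
    by apply: lee_pmul => //; rewrite ?lee_fin ?exprn_ge0//;
      [apply: integral_ge0 => x _; rewrite lee_fin sqr_ge0|exact: zC].
  rewrite -EFinM lee_fin (_ : 16 = 4 * 4 :> R); last by ring.
  rewrite exprMn invfM mulrA divff ?expf_neq0// mul1r natrX exprS invfM mulrA divff// mul1r.
  rewrite lef_pV2 ?posrE ?exprn_gt0//; apply: lerXn2r => //; rewrite ?nnegrE//.
  by rewrite ler_nat.
have Sfin : \forall x \ae mu, D x -> S x \is a fin_num.
  apply: (integrable_ae mD); apply/integrableP; split => //.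
  by under eq_integral do rewrite gee0_abs//.
have zcvg : \forall x \ae mu, D x -> cvgn (fun k => z k x).
  apply: filterS Sfin => x /[apply] Sx.
  have tS k : 4 ^+ k * (z k.+1 x - z k x) ^+ 2 <= fine (S x).
    rewrite -lee_fin fineK//.
    rewrite /S; apply: le_trans (nneseries_lim_ge k.+1 _) => //.
    by rewrite big_nat_recr//= leeDr// sume_ge0.
  pose C := 1 + fine (S x).
  have SC : fine (S x) <= C ^+ 2.
    by have := fine_ge0 (S0 x); rewrite /C; set r := fine _; nra.
  have C0 : 0 <= C by rewrite addr_ge0// fine_ge0.
  have dC k : `|z k.+1 x - z k x| <= geometric C 2^-1 k.
    rewrite /geometric/= exprVn ler_pdivlMr ?exprn_gt0//.
    rewrite -(@ler_pXn2r _ 2)// ?nnegrE ?mulr_ge0 ?exprn_ge0//.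
    rewrite exprMn real_normK ?num_real// -exprM mulnC exprM mulrC.
    by rewrite (_ : 2 ^+ 2 = 4 :> R) ?(le_trans (tS k))//; ring.
  have : cvgn (series (fun k => z k.+1 x - z k x)).
    apply: normed_cvg; apply: series_le_cvg (dC) _ => //.
    - by move=> k; rewrite /geometric/= mulr_ge0// exprn_ge0// invr_ge0.
    - by apply: is_cvg_geometric_series; rewrite ger0_norm ?invr_ge0// invf_lt1// ltr1n.
  move=> /cvg_ex[l hl]; apply/cvg_ex; exists (l + z 0%N x).
  have : (series (fun k => z k.+1 x - z k x) k + z 0%N x) @[k --> \oo] --> l + z 0%N x.
    by apply: cvgD hl _; exact: cvg_cst.
  apply: cvg_trans; apply: near_eq_cvg; near=> k.
  by rewrite /series/= telescope_sumr// subrK.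
have [w mw wz] := measurable_fun_cvg_version mz.
have zw : \forall x \ae mu, D x -> (fun k => z k x) @ \oo --> w x.
  by apply: filterS zcvg => x /[apply] zx; rewrite (wz x _ zx).
have est k : (\int[mu]_(x in D) ((w x - z k x) ^+ 2)%:E <= ((16 ^+ k)^-1)%:E)%E.
  pose g l x := ((z (l + k)%N x - z k x) ^+ 2)%:E.
  have mg l : measurable_fun D (g l).
    by apply/measurable_EFinP; apply: measurable_funX; exact: measurable_funB.
  have g0 l x : D x -> (0 <= g l x)%E by rewrite lee_fin sqr_ge0.
  apply: (@le_trans _ _ (\int[mu]_(x in D) limn_einf (g^~ x))%E).
    rewrite le_eqVlt; apply/orP; left; apply/eqP; apply: ae_eq_integral_nonmeas => //.
    apply: filterS zw => x /[apply] zx; rewrite /g.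
    have gx : ((z (l + k)%N x - z k x) ^+ 2)%:E @[l --> \oo] --> ((w x - z k x) ^+ 2)%:E.
      apply/fine_cvgP; split; first by near=> l.
      rewrite /comp/=; rewrite expr2.
      under eq_fun do rewrite expr2.
      have : z (l + k)%N x - z k x @[l --> \oo] --> w x - z k x.
        apply: cvgB; last exact: cvg_cst.
        by rewrite (cvg_shiftn k (fun l => z l x)).
      by move=> h; exact: (cvgM h h).
    rewrite is_cvg_limn_einfE; last by apply/cvg_ex; eexists; exact: gx.
    by rewrite (cvg_lim _ gx).
  apply: le_trans (fatou mu mD mg g0) _.
  rewrite limn_einf_lim; apply: lime_le; first exact: is_cvg_einfs.
  apply: nearW => l; apply: le_trans (ereal_inf_lbound _) _; last first.
    exact: (zC k (l + k)%N (leq_addl _ _)).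
  by exists l => /=.
exists w; split => //.
rewrite (_ : w = (w - z 0%N) + z 0%N); last by rewrite subrK.
apply: L2D => //; split; first exact: measurable_funB.
by apply: le_lt_trans (est 0%N) _; rewrite ltry.
Unshelve. all: end_near. Qed.

(** * Open sets are Borel *)

Section open_measurable_rV.
Context {R : realType} {n : nat}.

Let ratbox (p : 'rV[rat]_n * nat) : set 'rV[R]_n :=
  [set x | forall i, `|x ord0 i - ratr (p.1 ord0 i)| < p.2.+1%:R^-1].

Let measurable_ratbox p : measurable (ratbox p).
Proof.
rewrite (_ : ratbox p = \bigcap_(i in [set: 'I_n])
    [set x | `|x ord0 i - ratr (p.1 ord0 i)| < p.2.+1%:R^-1]); last first.
  by apply/seteqP; split => x /= h => [i _|i]; exact: h.
apply: fin_bigcap_measurable => // i _.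
have := @measurable_coor R n i measurableT _
  (measurable_ball (ratr (p.1 ord0 i) : R) p.2.+1%:R^-1).
rewrite setTI; congr (measurable _); apply/funext => x.
by rewrite /preimage /ball/= distrC.
Qed.

(** An open set is the countable union of the cubes with rational centre and
    side that it contains. *)
Lemma open_measurable_rV (U : set 'rV[R]_n) : open U -> measurable U.
Proof.
move=> oU.
rewrite (_ : U = \bigcup_p (if `[< ratbox p `<=` U >] then ratbox p else set0)); last first.
  apply/seteqP; split => [x Ux|x [p _]]; last by case: asboolP => // pU px; exact: pU.
  have /nbhs_ballP[e /= e0 eU] : nbhs x U by exact: open_nbhs_nbhs.
  have [k ke] : exists k : nat, k.+1%:R^-1 < e / 2.
    have := @cvg_harmonic R => /cvgrPdist_lt/(_ (e / 2)).
    rewrite divr_gt0// => /(_ isT)[N _ /(_ N (leqnn _))] /=.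
    by rewrite sub0r normrN ger0_norm ?harmonic_ge0//; exists N.
  have q_ i : exists q : rat, `|x ord0 i - ratr q| < k.+1%:R^-1.
    have xx : x ord0 i - k.+1%:R^-1 < x ord0 i + k.+1%:R^-1.
      by rewrite ltrD2l gtrN// invr_gt0.
    have [q] := rat_in_itvoo xx.
    rewrite in_itv/= => /andP[q1 q2]; exists q.
    by rewrite ltr_distlC q1 q2.
  have [q qx] := choice q_.
  exists (\row_i q i, k) => //; case: asboolP => [_ i|]; first by rewrite mxE.
  case=> y yb; apply: eU.
  suff h i j : ball (x i j) e (y i j) by split => // i j; exact: h.
  rewrite /ball/= (ord1 i).
  apply: (@le_lt_trans _ _ (k.+1%:R^-1 + k.+1%:R^-1)); last by rewrite [ltRHS]splitr ltrD.
  have := yb j; rewrite mxE => yj; have := qx j => xj.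
  rewrite (_ : _ - _ = (x ord0 j - ratr (q j)) - (y ord0 j - ratr (q j))); last by ring.
  by apply: le_trans (ler_normB _ _) _; apply: lerD; exact: ltW.
apply: countable_bigcupT_measurable => [|p]; first exact: countableP.
case: asboolP => // _.
Qed.

End open_measurable_rV.

Section almost_everywhere_combinators.
Context d (X : measurableType d) (R : realType).
Variable mu : {measure set X -> \bar R}.
Implicit Types P Q S : X -> Prop.

Lemma ae_imply P Q : (forall x, P x -> Q x) ->
  (\forall x \ae mu, P x) -> \forall x \ae mu, Q x.
Proof. by move=> PQ; apply: filterS. Qed.

Lemma ae_imply2 P Q S : (forall x, P x -> Q x -> S x) ->
  (\forall x \ae mu, P x) -> (\forall x \ae mu, Q x) -> \forall x \ae mu, S x.
Proof. by move=> PQ; apply: filterS2. Qed.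

Lemma ae_imply3 P Q S W : (forall x, P x -> Q x -> S x -> W x) ->
  (\forall x \ae mu, P x) -> (\forall x \ae mu, Q x) -> (\forall x \ae mu, S x) ->
  \forall x \ae mu, W x.
Proof. by move=> PQ; apply: filterS3. Qed.

End almost_everywhere_combinators.

(** * Smooth bumps on the line *)

Section smooth_functions.
Context {R : realType}.
Implicit Types f g : R -> R.

(** [f] is [n] times derivable at every point. In dimension one, holding for
    all [n] is the same as smoothness ([smoothP]), but this form can be
    proved by induction on [n]. *)
Fixpoint times_derivable (n : nat) f : Prop :=
  if n is m.+1 then
    exists2 g : R -> R, (forall x : R, is_derive x 1 f (g x)) & times_derivable m g
  else True.

Lemma times_derivableW n f : times_derivable n.+1 f -> times_derivable n f.
Proof.
elim: n f => [//|n ih] f [g fg ng]; exists g => //; exact: ih.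
Qed.

Lemma times_derivableD n f g :
  times_derivable n f -> times_derivable n g -> times_derivable n (f + g).
Proof.
elim: n f g => [//|n ih] f g [f' ff' nf] [g' gg' ng].
by exists (f' + g') => [x|]; [exact: is_deriveD|exact: ih].
Qed.

Lemma times_derivableZ n (c : R) f :
  times_derivable n f -> times_derivable n (c *: f).
Proof.
elim: n f => [//|n ih] f [f' ff' nf].
by exists (c *: f') => [x|]; [exact: is_deriveZ|exact: ih].
Qed.

Lemma times_derivableM n f g :
  times_derivable n f -> times_derivable n g -> times_derivable n (f * g).
Proof.
elim: n f g => [//|n ih] f g nf ng.
have [f' ff' nf'] := nf; have [g' gg' ng'] := ng.
exists (f * g' + g * f') => [x|]; first exact: is_deriveM.
by apply: times_derivableD; apply: ih => //; exact: times_derivableW.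
Qed.

Lemma times_derivable_affine n (c d : R) f :
  times_derivable n f -> times_derivable n (fun x => f (c * x + d)).
Proof.
elim: n f => [//|n ih] f [f' ff' nf].
exists (c *: (fun x => f' (c * x + d))) => [x|]; last exact/times_derivableZ/ih.
have h : is_derive x 1 (fun y => c * y + d) c.
  have -> : (fun y => c * y + d) = (c *: id) + cst d by [].
  by apply: is_derive_eq; rewrite addr0 [c *: 1]mulr1.
by have := @is_derive1_comp R f _ x _ _ (ff' (c * x + d)) h; rewrite mulrC.
Qed.

(** On the line a derivative in direction [v] is [v] times the derivative in
    direction [1], so iterated directional derivatives are multiples of
    ordinary ones. *)
Lemma times_derivable_iter (vs : seq R) m f :
  times_derivable (size vs + m) f -> times_derivable m (iter_deriv vs f).
Proof.
elim: vs m => [//|v vs ih] m; rewrite [size _]/= addSnnS => /ih[g fg gm] /=.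
rewrite (_ : (fun x => _) = v *: g); first exact: times_derivableZ.
apply/funext => x; have [dx Dx] := fg x.
have dfx : differentiable (iter_deriv vs f) x by apply/derivable1_diffP.
rewrite deriveE// -[v in LHS]mulr1 -[v * 1]/(v *: (1 : R)) linearZ/=.
by rewrite -deriveE// Dx.
Qed.

Lemma smoothP f : (forall n, times_derivable n f) -> smooth f.
Proof.
move=> fn vs; have [g hg _] : times_derivable 1 (iter_deriv vs f).
  exact: times_derivable_iter.
have der1 x : derivable (iter_deriv vs f) x 1 by case: (hg x).
split=> [x|x v].
  by apply: differentiable_continuous; apply/derivable1_diffP.
by apply: diff_derivable; apply/derivable1_diffP.
Qed.

(** The functions [x^-k exp (-1/x)] on the half line. The usual flat
    function is the case [k = 0]; the whole family is needed because it is
    closed under differentiation, up to linear combinations. *)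
Definition flat (k : nat) (x : R) : R :=
  if 0 < x then x^-1 ^+ k * expR (- x^-1) else 0.

Lemma flat_ge0 k x : 0 <= flat k x.
Proof.
by rewrite /flat; case: ifPn => // x0; rewrite mulr_ge0 ?expR_ge0// exprn_ge0// invr_ge0 ltW.
Qed.

Let flat_le k (x : R) : 0 < x -> flat k x <= k.+1`!%:R * x.
Proof.
move=> x0; rewrite /flat x0.
have y0 : 0 < x^-1 by rewrite invr_gt0.
have := @expR_ge1Dxn R x^-1 k (ltW y0).
rewrite expRN => h.
rewrite ler_pdivrMr ?expR_gt0//.
apply: (@le_trans _ _ (k.+1`!%:R * x * (x^-1 ^+ k.+1 / k.+1`!%:R))).
  rewrite le_eqVlt; apply/orP; left; apply/eqP; rewrite exprS.
  have : (k.+1`!%:R : R) != 0 by rewrite pnatr_eq0 -lt0n fact_gt0.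
  by move: (k.+1`!%:R : R) => F F0; field; rewrite F0 gt_eqF.
rewrite ler_wpM2l ?mulr_ge0// ?ltW//.
by apply: lt_le_trans h; rewrite ltrDr.
Qed.

(** At the origin the difference quotient of [flat k] is [flat k.+1], which
    tends to [0] because the exponential beats every power. *)
Lemma flat_derive k (x : R) :
  is_derive x (1 : R) (flat k) (flat k.+2 x - k%:R * flat k.+1 x).
Proof.
have [x0|x0|->] := ltgtP x 0.
- apply: (@near_eq_is_derive _ _ _ (cst 0)).
    near=> y; rewrite /flat ltNge ltW//.
    by near: y; exact: lt_nbhsl.
  rewrite /flat !ltNge !(ltW x0)/= mulr0 subr0; exact: is_derive_cst.
- apply: (@near_eq_is_derive _ R R (fun y : R => y^-1 ^+ k * expR (- y^-1))).
    near=> y; rewrite /flat ifT//.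
    by near: y; exact: lt_nbhsr.
  have di : is_derive x 1 (fun y : R => y^-1) (- x ^- 2).
    have := @is_deriveV _ (@id R) x 1 1 (lt0r_neq0 x0) (is_derive_id _ _).
    by move=> h; apply: is_derive_eq h _; rewrite [LHS]mulr1.
  have -> : (fun y => y^-1 ^+ k * expR (- y^-1)) =
    (fun y : R => y^-1) ^+ k * (expR \o (- (fun y => y^-1))).
    by apply/funext => y /=; rewrite fctE exprfctE.
  have de : is_derive x 1 (expR \o (- (fun y => y^-1))) (expR (- x^-1) * x ^- 2).
    have dn := is_deriveN di; rewrite opprK in dn.
    by have := @is_derive1_comp R expR (- (fun y => y^-1)) x _ _ (is_derive_expR (- x^-1)) dn.
  apply: (is_derive_eq (is_deriveM (is_deriveX k di) de)).
  rewrite /flat x0 /= !exprfctE /GRing.scale/=.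
  case: k => [|k] /=; first by rewrite expr0; field; rewrite gt_eqF.
  rewrite !exprS; set E := expR _; set X := _ ^+ k.
  by field; rewrite gt_eqF.
- have cv : h^-1 *: (flat k (h *: 1 + 0) - flat k 0) @[h --> 0^'] --> (0 : R).
    apply/cvgrPdist_le => e e0.
    near=> h; rewrite sub0r normrN [h *: 1]mulr1 addr0.
    have -> : flat k 0 = 0 by rewrite /flat ltxx.
    rewrite subr0.
    have [h0|h0] := ltP 0 h; last first.
      by rewrite /flat ltNge h0/= scaler0 normr0 ltW.
    rewrite (_ : h^-1 *: flat k h = flat k.+1 h); last first.
      by rewrite /flat h0 exprS -mulrA.
    rewrite ger0_norm ?flat_ge0//; apply: le_trans (flat_le _ h0) _.
    rewrite mulrC -ler_pdivlMr ?ltr0n ?fact_gt0//.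
    rewrite -[h]gtr0_norm//.
    near: h; apply: dnbhs0_le; rewrite divr_gt0// ltr0n fact_gt0//.
  rewrite /flat ltxx mulr0 subr0 -/(flat k).
  split; first by apply/cvg_ex; exists 0; exact: cv.
  exact/cvg_lim.
Unshelve. all: end_near. Qed.

Lemma flat_times_derivable n k : times_derivable n (flat k).
Proof.
elim: n k => [//|n ih] k; exists (fun x => flat k.+2 x - k%:R * flat k.+1 x).
  exact: flat_derive.
rewrite (_ : (fun x => _) = flat k.+2 + (- k%:R) *: flat k.+1); last first.
  by apply/funext => y; rewrite -mulNr.
by apply: times_derivableD => //; exact: times_derivableZ.
Qed.

Lemma times_derivable_continuous f : times_derivable 1 f -> continuous f.
Proof.
move=> [g fg _] x; apply: differentiable_continuous; apply/derivable1_diffP.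
by case: (fg x).
Qed.

(** The factor [N] does not move the support [(a, b)]: it only makes the
    bump converge pointwise to the indicator function of [(a, b)] as [N]
    grows. *)
Definition bump (N a b : R) (x : R) : R :=
  flat 0 (N * (x - a)) * flat 0 (N * (b - x)).

Lemma flat0_le1 x : flat 0 x <= 1.
Proof.
rewrite /flat; case: ifPn => // x0; rewrite expr0 mul1r -expR0 ler_expR.
by rewrite oppr_le0 invr_ge0 ltW.
Qed.

Lemma bump_ge0 N a b x : 0 <= bump N a b x.
Proof. by rewrite mulr_ge0 ?flat_ge0. Qed.

Lemma bump_le1 N a b x : bump N a b x <= 1.
Proof. by rewrite mulr_ile1 ?flat_ge0 ?flat0_le1. Qed.

Lemma bump_out N a b x : 0 < N -> ~~ (a < x < b) -> bump N a b x = 0.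
Proof.
move=> N0; rewrite negb_and /bump /flat !pmulr_rgt0// !subr_gt0.
by move=> /orP[] /negbTE ->; rewrite ?mulr0 ?mul0r.
Qed.

Lemma bump_gt0 N a b x : 0 < N -> a < x < b -> 0 < bump N a b x.
Proof.
move=> N0 /andP[ax xb]; rewrite /bump.
by rewrite mulr_gt0// /flat pmulr_rgt0// subr_gt0 (ax, xb) expr0 mul1r expR_gt0.
Qed.

Lemma bump_times_derivable n N a b : times_derivable n (bump N a b).
Proof.
apply: times_derivableM.
  rewrite (_ : (fun x => _) = (fun x => flat 0 (N * x + - (N * a)))).
    by apply: times_derivable_affine; exact: flat_times_derivable.
  by apply/funext => x; rewrite mulrBr.
rewrite (_ : (fun x => _) = (fun x => flat 0 (- N * x + N * b))).
  by apply: times_derivable_affine; exact: flat_times_derivable.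
by apply/funext => x; rewrite mulrBr addrC mulNr.
Qed.

Lemma bump_continuous N a b : continuous (bump N a b).
Proof. exact/times_derivable_continuous/bump_times_derivable. Qed.

Lemma bump_cvg a b x : a < x < b ->
  (fun k : nat => bump k.+1%:R a b x) @ \oo --> (1 : R).
Proof.
move=> /andP[ax xb].
have key y : 0 < y -> (fun k : nat => flat 0 (k.+1%:R * y)) @ \oo --> (1 : R).
  move=> y0; rewrite (_ : (fun k => _) = (fun k => expR (- (y^-1 * harmonic k)))).
    rewrite -[X in _ --> X]expR0; apply: continuous_cvg; first exact: continuous_expR.
    rewrite -oppr0 -(mulr0 y^-1); apply: cvgN; apply: cvgM; first exact: cvg_cst.
    exact: cvg_harmonic.
  apply/funext => k; rewrite /flat mulr_gt0// expr0 mul1r invfM; congr expR.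
  by rewrite mulrC.
rewrite -[X in _ --> X](mulr1 1); apply: cvgM; apply: key; by rewrite subr_gt0.
Qed.

End smooth_functions.

(** * Test functions as primitives of bumps *)

Section primitive.
Context {R : realType}.
Local Notation leb := (@lebesgue_measure R).

Lemma integrable_supported (a b : R) (th : R -> R) : continuous th ->
  (forall x, ~~ (a < x < b) -> th x = 0) ->
  leb.-integrable [set: R] (EFin \o th).
Proof.
move=> ct t0.
have -> : EFin \o th = (EFin \o th) \_ `[a, b].
  apply/funext => x; rewrite patchE; case: ifPn => //= xab.
  rewrite t0//; apply: contra xab => /andP[ax xb].
  by rewrite inE/= in_itv/= !ltW.
apply: (integrable_mkcond _ _).1 => //; apply: continuous_compact_integrable.
  exact: segment_compact.
exact: continuous_subspaceT.
Qed.

Definition primitive (th : R -> R) (x : R) : R := \int[leb]_(t in `]-oo, x]) th t.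

Lemma primitive_derive (th : R -> R) x : continuous th ->
  leb.-integrable [set: R] (EFin \o th) ->
  is_derive x (1 : R) (primitive th) (th x).
Proof.
move=> ct it.
have [] := @continuous_FTC1 R th -oo%O x (x + 1) _ _ _ (ct x).
- by rewrite ltrDl.
- by apply: integrableS it.
- by rewrite ltNyr.
move=> d D; split; first exact: d.
by rewrite -derive1E; exact: D.
Qed.

(** A primitive of a function supported in [[a, b]] is constant on both
    sides of [[a, b]]; it has compact support exactly when these constants
    vanish, i.e., when the integral is zero. *)
Lemma primitive_test_function (a b T : R) (th : R -> R) :
  0 < a -> b < T -> (forall n, times_derivable n th) ->
  (forall x, ~~ (a < x < b) -> th x = 0) -> \int[leb]_x th x = 0 ->
  test_function `]0, T[ (primitive th).
Proof.
move=> a0 bT nth t0 i0.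
have ct : continuous th by apply: times_derivable_continuous; exact: nth.
have it := integrable_supported ct t0.
have p0 x : ~~ (a <= x <= b) -> primitive th x = 0.
  rewrite negb_and -!ltNge => /orP[xa|bx].
    rewrite /primitive /Rintegral integral0_eq// => y /=; rewrite in_itv/= => yx.
    by rewrite t0// negb_and -leNgt (le_trans yx (ltW xa)).
  rewrite -i0 /primitive Rintegral_mkcond; apply: eq_Rintegral => y _.
  rewrite patchE; case: ifPn => //; rewrite notin_setE/= in_itv/= => /negP.
  by rewrite -ltNge => xy; rewrite t0// negb_and -!leNgt (ltW (lt_trans bx xy)) orbT.
have cl : closure [set x | primitive th x != 0] `<=` `[a, b].
  have cab : closed (`[a, b] : set R) by exact: interval_closed.
  rewrite ((closure_id _).1 cab); apply: closureS => y /=.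
  by apply: contraNP => /negP; rewrite in_itv/= => /p0/eqP.
split.
- apply: smoothP => -[//|n]; exists th => // x; exact: primitive_derive.
- apply: (subclosed_compact _ (@segment_compact _ a b) cl).
  exact: closed_closure.
- apply: subset_trans cl _ => x /=; rewrite !in_itv/= => /andP[ax xb].
  by rewrite (lt_le_trans a0)//= (le_lt_trans xb).
Qed.

End primitive.

(** * Weak derivatives on an interval *)

Section lebesgue_line.
Context {R : realType}.
Local Notation leb := (@lebesgue_measure R).

Lemma integrable_bounded_mul d (X : measurableType d) (mu : {measure set X -> \bar R})
    (D : set X) (f th : X -> R) (M : R) : measurable D ->
  measurable_fun D th -> (forall x, D x -> `|th x| <= M) ->
  mu.-integrable D (EFin \o f) -> mu.-integrable D (EFin \o (fun x => f x * th x)).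
Proof.
move=> mD mth thM fi.
have mf : measurable_fun D f by apply/measurable_EFinP; exact: measurable_int fi.
apply: le_integrable (integrableZl mD M fi) => //.
  by apply/measurable_EFinP; exact: measurable_funM.
move=> x Dx; rewrite /= lee_fin !normrM mulrC ler_wpM2r//.
by apply: le_trans (thM x Dx) _; exact: ler_norm.
Qed.

(** The running integral of [H] is constant on [(0, T)], so its derivative,
    which is [H] almost everywhere by Lebesgue's differentiation theorem,
    vanishes. *)
Lemma ae_eq0_of_integral_itv (T : R) (H : R -> R) :
  leb.-integrable `]0, T[ (EFin \o H) ->
  (forall a b, 0 < a -> a < b -> b < T -> \int[leb]_(x in `]a, b[) H x = 0) ->
  \forall t \ae leb, t \in `]0, T[ -> H t = 0.
Proof.
move=> iH H0; pose Hp := H \_ `]0, T[.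
have iHp : leb.-integrable [set: R] (EFin \o Hp).
  by rewrite /Hp -restrict_EFin; apply: (integrable_mkcond _ _).1.
have h1 y : leb.-integrable `]-oo, y] (EFin \o Hp) by apply: integrableS iHp.
have h2 : locally_integrable [set: R] Hp by apply: open_integrable_locally iHp; exact: openT.
have := FTC1Ny h1 h2.
set F := fun x : R => _.
have key t y : 0 < t -> t < y -> y < T -> F y = F t.
  move=> t0 ty yT; apply/eqP; rewrite -subr_eq0; apply/eqP.
  rewrite /F (Rintegral_itvB (h1 y)) ?bnd_simp ?(ltW ty)//.
  rewrite -Rintegral_itv_bndo_bndc; last first.
    exact: integrableS iHp.
  rewrite -[RHS](H0 t y)//; apply: eq_Rintegral => x; rewrite inE/= in_itv/= => /andP[tx xy].
  by rewrite /Hp patchE mem_set//= in_itv/= (lt_trans t0)//= (lt_trans xy).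
apply: ae_imply => t [_ Ft].
rewrite in_itv/= => /andP[t0 tT].
have -> : H t = Hp t by rewrite /Hp patchE mem_set//= in_itv/= t0.
rewrite -Ft derive1E.
suff [_ ->//] : is_derive (t : R) (1 : R) F 0.
apply: (@near_eq_is_derive _ R R (cst (F t))).
near=> y.
have y0 : 0 < y by near: y; exact: lt_nbhsr.
have yT : y < T by near: y; exact: lt_nbhsl.
have [yt|ty|->//] := ltgtP y t; first by rewrite (key y t).
by rewrite (key t y).
Unshelve. all: end_near. Qed.

Lemma integrable_cst_itv (a b c : R) : leb.-integrable `]a, b[ (EFin \o cst c).
Proof.
have := integrableZl measurableT c (integrable_indic_itv a b false true : leb.-integrable _ _).
move=> ic; have : leb.-integrable `]a, b[ (fun x => (c%:E * (\1_(`]a, b[ : set R) x)%:E)%E).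
  exact: integrableS ic.
by apply: eq_integrable => // x xab /=; rewrite indicE xab mule1.
Qed.

(** Fubini's theorem on the triangle [x < t]: an integration by parts that
    requires no regularity of the factors. *)
Lemma triangle_Fubini (p q : R -> R) :
  leb.-integrable [set: R] (EFin \o p) -> leb.-integrable [set: R] (EFin \o q) ->
  leb.-integrable [set: R] (EFin \o (fun t => p t * \int[leb]_(x in `]-oo, t[) q x)) /\
  \int[leb]_t (p t * \int[leb]_(x in `]-oo, t[) q x) =
  \int[leb]_x (q x * \int[leb]_(t in `]x, +oo[) p t).
Proof.
move=> ip iq.
have mp : measurable_fun [set: R] p by apply/measurable_EFinP; exact: measurable_int ip.
have mq : measurable_fun [set: R] q by apply/measurable_EFinP; exact: measurable_int iq.
pose E (z : R * R) : \bar R := (if (z.2 < z.1)%R then p z.1 * q z.2 else 0)%:E.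
have mE : measurable_fun [set: measurableTypeR R * measurableTypeR R] E.
  apply/measurable_EFinP; apply: measurable_fun_ifT => //.
    exact: measurable_fun_ltr.
  by apply: measurable_funM; exact: measurableT_comp.
have iE : (leb \x leb)%E.-integrable [set: measurableTypeR R * measurableTypeR R] E.
  apply/integrable12ltyP => //.
  apply: (@le_lt_trans _ _ (\int[leb]_t (`|p t|%:E * \int[leb]_x `|q x|%:E))%E).
    apply: ge0_le_integral_nonmeas => t _; first exact: integral_ge0.
    rewrite -ge0_integralZl//; last by apply/measurable_EFinP; exact: measurableT_comp.
    apply: ge0_le_integral_nonmeas => x _ //.
    rewrite /E /= -EFinM lee_fin; case: ifPn => _; first by rewrite normrM.
    by rewrite normr0 mulr_ge0.
  have /integrableP[_ qoo] := iq.
  have [_ poo] := integrableP _ _ _ ip.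
  rewrite ge0_integralZr//; last 2 first.
  - by apply/measurable_EFinP; exact: measurableT_comp.
  - exact: integral_ge0.
  by rewrite lte_mul_pinfty//; [exact: integral_ge0|rewrite ge0_fin_numE//; exact: integral_ge0].
have EFt t : (\int[leb]_x E (t, x) = (p t * \int[leb]_(x in `]-oo, t[) q x)%:E)%E.
  have iqt : leb.-integrable `]-oo, t[ (EFin \o q) by exact: integrableS iq.
  rewrite EFinM /Rintegral fineK; last exact: integrable_fin_num iqt.
  rewrite -integralZl// [RHS]integral_mkcond; apply: eq_integral => x _.
  by rewrite patchE mem_setE in_itv/= /E/=; case: ifPn.
have EGx x : (\int[leb]_t E (t, x) = (q x * \int[leb]_(t in `]x, +oo[) p t)%:E)%E.
  have ipx : leb.-integrable `]x, +oo[ (EFin \o p) by exact: integrableS ip.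
  rewrite EFinM /Rintegral fineK; last exact: integrable_fin_num ipx.
  rewrite -integralZl// [RHS]integral_mkcond; apply: eq_integral => t _.
  by rewrite patchE mem_setE in_itv/= andbT /E/= mulrC; case: ifPn.
split.
  have := integrable_fubini_F iE; apply: eq_integrable => // t _.
  by rewrite /fubini_F EFt.
have := Fubini iE; rewrite /Rintegral => h; congr fine.
under eq_integral do rewrite -EFt.
by rewrite h; apply: eq_integral => x _; rewrite EGx.
Qed.

Lemma Rintegral_gt0 (a b : R) (f : R -> R) : a < b ->
  leb.-integrable [set: R] (EFin \o f) -> (forall x, 0 <= f x) ->
  (forall x, a < x < b -> 0 < f x) -> 0 < \int[leb]_x f x.
Proof.
move=> ab fi f0 fp; rewrite lt0r Rintegral_ge0// andbT; apply/negP => /eqP i0.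
have fin := integrable_fin_num measurableT fi.
have {}i0 : (\int[leb]_x `|(f x)%:E| = 0)%E.
  under eq_integral do rewrite gee0_abs ?lee_fin ?f0//.
  by rewrite -[LHS]fineK// -[fine _]/(\int[leb]_x f x) i0.
have /(ae_eq_integral_abs _ measurableT (measurable_int _ fi)) ae := i0.
have : leb `]a, b[%classic = 0.
  apply/negligibleP => //; apply: negligibleS ae => x /=; rewrite in_itv/= => xab /(_ I)[].
  by move/eqP; rewrite gt_eqF// fp.
rewrite lebesgue_measure_itv/= lte_fin ab => -[] /eqP.
by rewrite subr_eq0 gt_eqF.
Qed.

(** Let [G] be the running integral of [g]. Testing the weak derivative with
    the primitive of a smooth bump [th] of mean zero, and exchanging the
    order of integration in the term with [g], shows that [h - G] is
    orthogonal to [th]. As every bump is a multiple of a fixed bump [b0]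
    plus a bump of mean zero, [h - G - c] is orthogonal to all bumps for a
    suitable [c]; letting the bumps increase to indicator functions, it has
    zero integral over every interval. *)
Lemma du_Bois_Reymond (T : R) (h g : R -> R) : 0 < T ->
  leb.-integrable `]0, T[ (EFin \o h) -> leb.-integrable `]0, T[ (EFin \o g) ->
  weak_derivative T h g ->
  exists c : R, \forall t \ae leb, t \in `]0, T[ ->
    h t = c + \int[leb]_(x in `]0, t[) g x.
Proof.
move=> T0 ih ig whg.
have mT : measurable (`]0, T[%classic : set (measurableTypeR R)) by exact: measurable_itv.
pose q := g \_ `]0, T[.
have iq : leb.-integrable [set: R] (EFin \o q).
  by rewrite /q -restrict_EFin; apply: (integrable_mkcond _ _).1.
pose G t : R := \int[leb]_(x in `]-oo, t[) q x.
have GE t : t \in `]0, T[ -> G t = \int[leb]_(x in `]0, t[) g x.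
  rewrite in_itv/= => /andP[t0 tT].
  rewrite /G Rintegral_mkcond [RHS]Rintegral_mkcond; apply: eq_Rintegral => x _.
  rewrite !patchE !mem_setE !in_itv/=.
  have [xt|] := ltP x t; last by rewrite andbF.
  by rewrite /q patchE mem_setE in_itv/= (lt_trans xt tT) !andbT.
have iG : leb.-integrable `]0, T[ (EFin \o G).
  have i1 : leb.-integrable [set: R] (EFin \o (\1_`]0, T[ : R -> R)).
    exact: integrable_indic_itv.
  have [i2 _] := triangle_Fubini i1 iq.
  have : leb.-integrable `]0, T[ (EFin \o
      (fun t => \1_(`]0, T[ : set R) t * \int[leb]_(x in `]-oo, t[) q x)).
    exact: integrableS i2.
  by apply: eq_integrable => // t tT /=; rewrite indicE tT mul1r.
have iH : leb.-integrable `]0, T[ (EFin \o (fun t => h t - G t)).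
  by have := integrableB mT ih iG.
have kill (a b : R) (th : R -> R) : 0 < a -> a < b -> b < T ->
    (forall n, times_derivable n th) ->
    (forall x, ~~ (a < x < b) -> th x = 0) ->
    (exists M : R, forall x, `|th x| <= M) -> \int[leb]_x th x = 0 ->
    \int[leb]_(t in `]0, T[) ((h t - G t) * th t) = 0.
  move=> a0 ab bT nth t0 [M thM] i0.
  have ct : continuous th by apply: times_derivable_continuous; exact: nth.
  have it := integrable_supported ct t0.
  have mt : measurable_fun `]0, T[ th.
    by apply: measurable_funTS; exact: continuous_measurable_fun.
  have th0 x : x \notin `]0, T[ -> th x = 0.
    move=> xT; apply: t0; apply: contra xT => /andP[ax xb].
    by rewrite in_itv/= (lt_trans a0 ax) (lt_trans xb bT).
  have Mh f : leb.-integrable `]0, T[ (EFin \o f) ->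
      leb.-integrable `]0, T[ (EFin \o (fun x => f x * th x)).
    exact: (integrable_bounded_mul mT mt (fun x _ => thM x)).
  have -> : \int[leb]_(t in `]0, T[) ((h t - G t) * th t) =
      \int[leb]_(t in `]0, T[) (h t * th t) - \int[leb]_(t in `]0, T[) (G t * th t).
    rewrite -RintegralB//; [|exact: Mh..].
    by apply: eq_Rintegral => t _; rewrite mulrBl.
  have tf := primitive_test_function a0 bT nth t0 i0.
  have := whg _ tf.
  have -> : \int[leb]_(t in `]0, T[) (h t * 'D_1 (primitive th) t) =
      \int[leb]_(t in `]0, T[) (h t * th t).
    apply: eq_Rintegral => t _; congr (_ * _).
    by have [_ ->] := primitive_derive t ct it.
  move=> ->; apply/eqP; rewrite subr_eq0; apply/eqP.
  have [_ tri] := triangle_Fubini it iq.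
  have -> : \int[leb]_(t in `]0, T[) (G t * th t) = \int[leb]_t (th t * G t).
    rewrite Rintegral_mkcond; apply: eq_Rintegral => t _.
    rewrite patchE mem_setE; case: ifPn => tT; first by rewrite mulrC.
    by rewrite th0// mul0r.
  rewrite [RHS]tri.
  have pE x : \int[leb]_(t in `]x, +oo[) th t = - primitive th x.
    rewrite /primitive; apply/eqP; rewrite -addr_eq0; apply/eqP.
    have := @Rintegral_itvB R th -oo%O +oo%O x; rewrite set_itvNyy i0 sub0r => /(_ it).
    by rewrite !bnd_simp => <-//; rewrite addNr.
  under [RHS]eq_Rintegral do rewrite pE.
  have prM x : `|primitive th x| <= \int[leb]_t `|th t|.
    have itx : leb.-integrable `]-oo, x] (EFin \o th) by apply: integrableS it.
    apply: le_trans (le_normr_Rintegral _ itx) _ => //.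
    have iat := integrable_norm it.
    apply: fine_le.
    - by apply: integrable_fin_num => //; exact: integrable_norm.
    - exact: integrable_fin_num.
    - apply: ge0_subset_integral => //; exact: measurable_int iat.
  have mpr : measurable_fun `]0, T[ (primitive th).
    apply: measurable_funTS; apply: continuous_measurable_fun => x.
    apply: differentiable_continuous; apply/derivable1_diffP.
    by have [] := primitive_derive x ct it.
  have igp := integrable_bounded_mul mT mpr (fun x _ => prM x) ig.
  rewrite -mulN1r -RintegralZl//.
  rewrite Rintegral_mkcond; apply: eq_Rintegral => x _.
  rewrite /q !patchE mem_setE; case: ifPn => xT; last by rewrite mul0r.
  by rewrite mulN1r mulrN.
(* The reference bump, by which the mean of the others is corrected. *)
pose b0 : R -> R := bump 1 (T / 4) (T / 2).
have T40 : 0 < T / 4 by rewrite divr_gt0.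
have T42 : T / 4 < T / 2 by lra.
have T2 : T / 2 < T by lra.
have b0out x : ~~ (T / 4 < x < T / 2) -> b0 x = 0 by exact: bump_out.
have ib0 := integrable_supported (@bump_continuous R 1 (T / 4) (T / 2)) b0out.
have Ib0 : 0 < \int[leb]_x b0 x.
  apply: (Rintegral_gt0 T42) => // x; first exact: bump_ge0.
  exact: bump_gt0.
pose c := (\int[leb]_(t in `]0, T[) ((h t - G t) * b0 t)) / \int[leb]_x b0 x.
exists c.
have mbump N a b : measurable_fun (`]0, T[%classic : set (measurableTypeR R)) (bump N a b : R -> R).
  by apply: measurable_funTS; apply: continuous_measurable_fun; exact: bump_continuous.
have bump1 N a b x : `|bump N a b x : R| <= 1 by rewrite ger0_norm ?bump_ge0 ?bump_le1.
have iHc : leb.-integrable `]0, T[ (EFin \o (fun t => h t - G t - c)).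
  have ic : leb.-integrable `]0, T[ (EFin \o cst c).
    exact: integrable_cst_itv.
  by have := integrableB mT iH ic.
have vanish a b (k : nat) : 0 < a -> a < b -> b < T ->
    \int[leb]_(t in `]0, T[) ((h t - G t - c) * bump k.+1%:R a b t) = 0.
  move=> a0 ab bT; set be := bump _ _ _.
  pose ka := (\int[leb]_x be x) / \int[leb]_x b0 x.
  have beout x : ~~ (a < x < b) -> be x = 0 by exact: bump_out.
  have ibe := integrable_supported (@bump_continuous R k.+1%:R a b) beout.
  have key : \int[leb]_(t in `]0, T[) ((h t - G t) * (be t - ka * b0 t)) = 0.
    apply: (kill (Num.min a (T / 4)) (Num.max b (T / 2))).
    - by rewrite lt_min a0.
    - by rewrite lt_max !gt_min ab.
    - by rewrite gt_max bT.
    - move=> n.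
      rewrite (_ : (fun x => _) = be + (- ka) *: b0); last first.
        by apply/funext => x; rewrite -mulNr.
      by apply: times_derivableD; [|apply: times_derivableZ]; exact: bump_times_derivable.
    - move=> x; rewrite gt_min lt_max negb_and !negb_or => h'.
      have [xa xb] : ~~ (a < x < b) /\ ~~ (T / 4 < x < T / 2).
        by rewrite !negb_and; case/orP: h' => /andP[-> ->]; rewrite ?orbT.
      by rewrite beout// b0out// mulr0 subr0.
    - exists (1 + `|ka|) => x; apply: le_trans (ler_normB _ _) _.
      apply: lerD; first exact: bump1.
      by rewrite normrM ler_piMr//; exact: bump1.
    - rewrite RintegralB//; last by have := integrableZl measurableT ka ib0.
      rewrite RintegralZl// /ka -mulrA mulVf ?gt_eqF// mulr1 subrr//.
  have Hbe := integrable_bounded_mul mT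
    (mbump k.+1%:R a b) (fun x _ => bump1 k.+1%:R a b x) iH.
  have Hb0 := integrable_bounded_mul mT
    (mbump 1 (T / 4) (T / 2)) (fun x _ => bump1 1 (T / 4) (T / 2) x) iH.
  have : \int[leb]_(t in `]0, T[) ((h t - G t) * be t) =
      ka * \int[leb]_(t in `]0, T[) ((h t - G t) * b0 t).
    apply/eqP; rewrite -subr_eq0 -RintegralZl//.
    have -> : \int[leb]_(t in `]0, T[) ((h t - G t) * be t) -
       \int[leb]_(t in `]0, T[) (ka * ((h t - G t) * b0 t)) =
       \int[leb]_(t in `]0, T[) ((h t - G t) * (be t - ka * b0 t)).
      rewrite -RintegralB//; last by have := integrableZl mT ka Hb0.
      by apply: eq_Rintegral => t _; ring.
    by rewrite key.
  have ibT : leb.-integrable `]0, T[ (EFin \o be) by exact: integrableS ibe.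
  have -> : ka * \int[leb]_(t in `]0, T[) ((h t - G t) * b0 t) = c * \int[leb]_x be x.
    by rewrite /ka /c mulrAC [RHS]mulrAC [in LHS](mulrC (\int[leb]_x be x)).
  have <- : \int[leb]_(t in `]0, T[) be t = \int[leb]_x be x.
    rewrite Rintegral_mkcond; apply: eq_Rintegral => x _; rewrite patchE mem_setE.
    case: ifPn => //; rewrite in_itv/= => xT; rewrite beout//.
    by apply: contra xT => /andP[ax xb]; rewrite (lt_trans a0 ax) (lt_trans xb bT).
  move=> e.
  have -> : \int[leb]_(t in `]0, T[) ((h t - G t - c) * be t) =
     \int[leb]_(t in `]0, T[) ((h t - G t) * be t) - \int[leb]_(t in `]0, T[) (c * be t).
    rewrite -RintegralB//; last by have := integrableZl mT c ibT.
    by apply: eq_Rintegral => t _; ring.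
  by rewrite e RintegralZl// subrr.
have : \forall t \ae leb, t \in `]0, T[ -> h t - G t - c = 0.
  apply: ae_eq0_of_integral_itv => // a b a0 ab bT.
  have mHc := measurable_int _ iHc.
  have ind : \int[leb]_(x in `]a, b[) (h x - G x - c) =
     \int[leb]_(x in `]0, T[) ((h x - G x - c) * \1_(`]a, b[ : set R) x).
    rewrite Rintegral_mkcond [RHS]Rintegral_mkcond; apply: eq_Rintegral => x _.
    rewrite !patchE indicE !mem_setE !in_itv/=.
    have [/andP[ax xb]|_] := boolP (a < x < b).
      by rewrite (lt_trans a0 ax) (lt_trans xb bT) mulr1.
    by rewrite mulr0 if_same.
  rewrite ind.
  pose f_ k x := ((h x - G x - c) * bump k.+1%:R a b x)%:E.
  pose f x := ((h x - G x - c) * \1_(`]a, b[ : set R) x)%:E.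
  have cv : (\int[leb]_(x in `]0%R, T[) f_ k x)%E @[k --> \oo] --> (\int[leb]_(x in `]0%R, T[) f x)%E.
    apply: (@dominated_cvg _ _ _ leb `]0, T[%classic mT f_ f (fun x => `|h x - G x - c|%:E)) => //.
    - by move=> k; apply/measurable_EFinP; apply: measurable_funM => //; exact/measurable_EFinP.
    - move=> x _; rewrite /f_ /f.
      apply/fine_cvgP; split; first by near=> k.
      apply: cvgM; first exact: cvg_cst.
      rewrite indicE mem_setE in_itv/=.
      have [axb|axb] := boolP (a < x < b); first exact: bump_cvg.
      rewrite (_ : (fun k => _) = cst 0); first exact: cvg_cst.
      by apply/funext => k; rewrite bump_out.
    - exact: integrable_norm iHc.
    - by move=> k x _; rewrite /f_ /= lee_fin normrM ler_piMr.
  have f_0 k : (\int[leb]_(x in `]0%R, T[) f_ k x = 0)%E.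
    have iff := integrable_bounded_mul mT (mbump k.+1%:R a b) (fun x _ => bump1 k.+1%:R a b x) iHc.
    have := vanish a b k a0 ab bT; rewrite /Rintegral => v0.
    by rewrite -[LHS]fineK ?v0//; exact: integrable_fin_num iff.
  rewrite /Rintegral -/f (_ : (\int[leb]_(x in `]0%R, T[) f x = 0)%E)//.
  rewrite -(cvg_lim _ cv)//; under eq_fun do rewrite f_0.
  by rewrite lim_cst.
apply: ae_imply => t e tT; rewrite -GE//.
by have := e tT; lra.
Unshelve. all: end_near. Qed.

End lebesgue_line.

(** * Convolution of nonnegative functions *)

Section change_of_variables.
Context {R : realType}.
Local Notation leb := (@lebesgue_measure R).
Local Open Scope ereal_scope.

Let aff (c d : R) (x : measurableTypeR R) : measurableTypeR R := (c * x + d)%R.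

Let measurable_aff c d : measurable_fun [set: measurableTypeR R] (aff c d).
Proof. by apply: measurable_funD => //; exact: measurable_funM. Qed.

(** Both sides are integrals against measures that agree on half-open
    intervals. *)
Lemma ge0_integral_affine (c d : R) (f : R -> \bar R) : (0 < c)%R ->
  measurable_fun [set: measurableTypeR R] f -> (forall x, 0 <= f x) ->
  c%:E * \int[leb]_x f (c * x + d)%R = \int[leb]_x f x.
Proof.
move=> c0 mf f0; pose k : {nonneg R} := NngNum (ltW c0).
have := @ge0_integral_pushforward _ _ _ _ R _ (measurable_aff c d) leb setT f
  measurableT mf (fun x _ => f0 x).
rewrite preimage_setT => /= <-.
rewrite -[c%:E]/(k%:num%:E).
rewrite -(ge0_integral_mscale _ (@measurableT _ (measurableTypeR R)) k mf (fun x _ => f0 x)).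
apply: eq_measure_integral => A mA _; apply/esym.
apply: lebesgue_measure_unique => // _ [[u v]] _ <-.
change (leb `]u, v]%classic = c%:E * leb (aff c d @^-1` `]u, v]%classic)).
have -> : aff c d @^-1` `]u, v] = `]((u - d) / c)%R, ((v - d) / c)%R]%classic.
  apply/seteqP; split => x /=; rewrite !in_itv/= /aff.
    by rewrite ltr_pdivrMr// ler_pdivlMr// ltrBlDr lerBrDr mulrC.
  by rewrite ltr_pdivrMr// ler_pdivlMr// ltrBlDr lerBrDr mulrC.
rewrite !lebesgue_measure_itv/= !lte_fin ltr_pM2r ?invr_gt0// ltrD2r.
case: ifPn => _; last by rewrite mule0.
by rewrite -!EFinB -EFinM; congr EFin; field; rewrite gt_eqF.
Qed.

Lemma ge0_integral_reflect (t : R) (f : R -> \bar R) :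
  measurable_fun [set: measurableTypeR R] f -> (forall x, 0 <= f x) ->
  \int[leb]_x f (t - x)%R = \int[leb]_x f x.
Proof.
move=> mf f0.
have mN : measurable_fun [set: measurableTypeR R] (-%R : _ -> measurableTypeR R).
  exact: oppr_measurable.
have mg : measurable_fun [set: measurableTypeR R] (fun x => f (1 * x + t)%R).
  by apply: measurableT_comp => //; exact: measurable_aff.
rewrite -[RHS](ge0_integral_affine t ltr01 mf f0) mul1e.
have := @ge0_integral_pushforward _ _ _ _ R _ mN leb setT (fun x => f (1 * x + t)%R)
  measurableT mg (fun x _ => f0 _).
rewrite preimage_setT /comp => h.
transitivity (\int[leb]_x f (1 * (- x) + t)%R).
  by apply: eq_integral => x _; rewrite mul1r addrC.
rewrite -[LHS]h; apply: eq_measure_integral => A mA _.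
exact: lebesgue_measureN.
Qed.

End change_of_variables.

Section nonnegative_convolution.
Context {R : realType}.
Local Notation leb := (@lebesgue_measure R).
Local Notation mfun f := (measurable_fun [set: measurableTypeR R] f).
Local Open Scope ereal_scope.
Implicit Types f g h : R -> \bar R.

(** Convolution with values in the extended reals: for nonnegative functions
    Tonelli's theorem then yields commutativity and associativity without
    any integrability condition. *)
Definition econv f g (t : R) : \bar R := \int[leb]_x (f (t - x)%R * g x).

Let mfun2 f g : mfun f -> mfun g ->
  measurable_fun [set: measurableTypeR R * measurableTypeR R]
    (fun z : R * R => f (z.1 - z.2)%R * g z.2).
Proof.
move=> mf mg; apply: emeasurable_funM; last exact: measurableT_comp.
by apply: (measurableT_comp mf); exact: measurable_funB.
Qed.

Let mshift f (t : R) : mfun f -> mfun (fun x => f (x - t)%R).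
Proof. by move=> mf; apply: (measurableT_comp mf); exact: measurable_funB. Qed.

Let mreflect f (t : R) : mfun f -> mfun (fun x => f (t - x)%R).
Proof. by move=> mf; apply: (measurableT_comp mf); exact: measurable_funB. Qed.

Lemma econv_ge0 f g t : (forall x, 0 <= f x) -> (forall x, 0 <= g x) -> 0 <= econv f g t.
Proof. by move=> f0 g0; apply: integral_ge0 => x _; rewrite mule_ge0. Qed.

Lemma measurable_econv f g : (forall x, 0 <= f x) -> (forall x, 0 <= g x) ->
  mfun f -> mfun g -> mfun (econv f g).
Proof.
move=> f0 g0 mf mg.
apply: (measurable_fun_fubini_tonelli_F (m2 := leb) (fun z : R * R => f (z.1 - z.2)%R * g z.2)).
  exact: mfun2.
by move=> x; rewrite mule_ge0.
Qed.

Lemma econvC f g : (forall x, 0 <= f x) -> (forall x, 0 <= g x) ->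
  mfun f -> mfun g -> econv f g = econv g f.
Proof.
move=> f0 g0 mf mg; apply/funext => t; rewrite /econv.
rewrite -(@ge0_integral_reflect R t (fun x => f (t - x)%R * g x)).
- by apply: eq_integral => x _; rewrite opprB addrC subrK muleC.
- by apply: emeasurable_funM => //; exact: mreflect.
- by move=> x; rewrite mule_ge0.
Qed.

Lemma econvA f g h : (forall x, 0 <= f x) -> (forall x, 0 <= g x) ->
  (forall x, 0 <= h x) -> mfun f -> mfun g -> mfun h ->
  econv f (econv g h) = econv (econv f g) h.
Proof.
move=> f0 g0 h0 mf mg mh; apply/funext => t.
pose F (z : measurableTypeR R * measurableTypeR R) : \bar R :=
  f (t - z.1)%R * (g (z.1 - z.2)%R * h z.2).
have mF : measurable_fun [set: measurableTypeR R * measurableTypeR R] F.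
  apply: emeasurable_funM; last exact: mfun2.
  by apply: (measurableT_comp mf); exact: measurable_funB.
have F0 z : 0 <= F z by rewrite !mule_ge0.
transitivity (\int[leb]_x \int[leb]_y F (x, y)).
  apply: eq_integral => x _; rewrite /econv -ge0_integralZl//.
  - by apply: emeasurable_funM => //; exact: mreflect.
  - by move=> y _; rewrite mule_ge0.
rewrite (fubini_tonelli F mF F0); apply: eq_integral => y _.
rewrite /F/=; under eq_integral do rewrite muleA.
rewrite ge0_integralZr; last 4 first.
- exact: measurableT.
- by apply: emeasurable_funM; [exact: mreflect|exact: mshift].
- by move=> x _; rewrite mule_ge0.
- exact: h0.
congr (_ * _); rewrite /econv.
rewrite -(@ge0_integral_affine R 1 y (fun x => f (t - x)%R * g (x - y)%R))//.
- rewrite mul1e; apply: eq_integral => x _.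
  by rewrite mul1r addrK; congr (f _ * _); ring.
- by apply: emeasurable_funM; [exact: mreflect|exact: mshift].
- by move=> x; rewrite mule_ge0.
Qed.

Lemma integral_econv f g : (forall x, 0 <= f x) -> (forall x, 0 <= g x) ->
  mfun f -> mfun g ->
  \int[leb]_t econv f g t = (\int[leb]_x f x) * (\int[leb]_x g x).
Proof.
move=> f0 g0 mf mg; rewrite /econv.
rewrite (fubini_tonelli (fun z : measurableTypeR R * measurableTypeR R =>
  f (z.1 - z.2)%R * g z.2))/=; last 2 first.
- exact: mfun2.
- by move=> x; rewrite mule_ge0.
rewrite -ge0_integralZl//; last exact: integral_ge0.
apply: eq_integral => x _; rewrite ge0_integralZr//; last exact: mshift.
congr (_ * _); rewrite -[RHS](ge0_integral_affine (- x) ltr01 mf f0) mul1e.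
by apply: eq_integral => t _; rewrite mul1r.
Qed.

Lemma le_econv f g g' t : (forall x, 0 <= f x) -> (forall x, 0 <= g x) ->
  (forall x, g x <= g' x) -> econv f g t <= econv f g' t.
Proof.
move=> f0 g0 gg; apply: ge0_le_integral_nonmeas => x _; first by rewrite mule_ge0.
by rewrite lee_wpmul2l.
Qed.

Lemma econvDr f g h t : (forall x, 0 <= f x) -> (forall x, 0 <= g x) ->
  (forall x, 0 <= h x) -> mfun f -> mfun g -> mfun h ->
  econv f (g \+ h) t = econv f g t + econv f h t.
Proof.
move=> f0 g0 h0 mf mg mh; rewrite /econv -ge0_integralD//.
- by apply: eq_integral => x _; rewrite ge0_muleDr.
- by move=> x _; rewrite mule_ge0.
- by apply: emeasurable_funM => //; exact: mreflect.
- by move=> x _; rewrite mule_ge0.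
- by apply: emeasurable_funM => //; exact: mreflect.
Qed.

Lemma econvZr f g (c : R) t : (0 <= c)%R -> (forall x, 0 <= f x) -> (forall x, 0 <= g x) ->
  mfun f -> mfun g -> econv f (fun x => c%:E * g x) t = c%:E * econv f g t.
Proof.
move=> c0 f0 g0 mf mg; rewrite /econv -ge0_integralZl//.
- by apply: eq_integral => x _; rewrite muleCA.
- by apply: emeasurable_funM => //; exact: mreflect.
- by move=> x _; rewrite mule_ge0.
Qed.

Definition causal f := forall x : R, (x <= 0)%R -> f x = 0.

(** For functions that vanish on the negative half line the convolution only
    involves the values on [(0, t)]. *)
Lemma econv_causalE f g t : causal f -> causal g ->
  econv f g t = \int[leb]_(x in `]0%R, t[) (f (t - x)%R * g x).
Proof.
move=> cf cg; rewrite [RHS]integral_mkcond; apply: eq_integral => x _.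
rewrite patchE mem_setE in_itv/=; case: ifPn => //.
rewrite negb_and -!leNgt => /orP[x0|tx]; first by rewrite (cg x) ?mule0.
by rewrite cf ?mul0e// subr_le0.
Qed.

Lemma econv_causal f g : causal f -> causal g -> causal (econv f g).
Proof.
move=> cf cg t t0; rewrite econv_causalE// integral0_eq// => x /=.
by rewrite in_itv/= => /andP[x0 xt]; have := lt_le_trans xt t0; rewrite ltNge (ltW x0).
Qed.

(** The value of a causal convolution at time [t] depends only on the past. *)
Lemma econv_local f g g' (T t : R) : causal f -> causal g -> causal g' -> (t <= T)%R ->
  (\forall x \ae leb, x \in `]0%R, T[ -> g x = g' x) -> econv f g t = econv f g' t.
Proof.
move=> cf cg cg' tT gg'; rewrite !econv_causalE//.
apply: ae_eq_integral_nonmeas => //; apply: ae_imply gg' => x gx.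
rewrite /= in_itv/= => /andP[x0 xt]; rewrite gx// in_itv/= x0.
exact: lt_le_trans xt tT.
Qed.

End nonnegative_convolution.

(** * Power kernels, Gamma and Beta *)

Section power_integrals.
Context {R : realType}.
Local Notation leb := (@lebesgue_measure R).
Local Open Scope ereal_scope.

Lemma integral_powR (p u v : R) : (0 < u)%R -> (u < v)%R -> p != 0%R ->
  \int[leb]_(x in `[u, v]) (x `^ (p - 1))%:E = ((v `^ p - u `^ p) / p)%:E.
Proof.
move=> u0 uv p0.
have dF (x : R) : (0 < x)%R -> derivable (fun x => x `^ p / p)%R x 1.
  move=> x0; apply: derivableM; last exact: derivable_cst.
  by apply: derivable_powR; rewrite in_itv/= x0.
have cF (x : R) : (0 < x)%R -> {for x, continuous (fun x => x `^ p / p)%R}.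
  by move=> x0; apply: differentiable_continuous; apply/derivable1_diffP; exact: dF.
rewrite (@continuous_FTC2 _ _ (fun x => x `^ p / p)%R)//.
- by rewrite -EFinB -mulrBl.
- apply: continuous_in_subspaceT => x; rewrite inE/= in_itv/= => /andP[ux _].
  apply: differentiable_continuous; apply/derivable1_diffP.
  by apply: derivable_powR; rewrite in_itv/= (lt_le_trans u0 ux).
- split.
  + move=> x; rewrite in_itv/= => /andP[ux _]; apply: dF; exact: lt_trans ux.
  + by apply: cvg_at_right_filter; exact: cF.
  + by apply: cvg_at_left_filter; apply: cF; exact: lt_trans uv.
- move=> x; rewrite in_itv/= => /andP[ux _].
  have x0 : (0 < x)%R by exact: lt_trans ux.
  have dp : derivable (fun x : R => x `^ p)%R x 1 by apply: derivable_powR; rewrite in_itv/= x0.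
  rewrite derive1E (deriveM dp (derivable_cst _ _ _)).
  rewrite derive_cst scaler0 add0r -derive1E powR_derive1 ?in_itv/= ?x0//.
  by rewrite [LHS]mulrC -mulrA mulrCA divff ?mulr1//.
Qed.

Let mpow (p : R) (D : set (measurableTypeR R)) : measurable_fun D (fun x : R => (x `^ p)%:E).
Proof. by apply/measurable_EFinP; apply: measurable_funTS; exact: measurable_powR. Qed.

(** Exhaust [(0, T)] by compact intervals, on which the fundamental theorem
    of calculus applies. *)
Lemma integral_powR_near0 (p T : R) : (0 < p)%R -> (0 < T)%R ->
  \int[leb]_(x in `]0%R, T[) (x `^ (p - 1))%:E <= (T `^ p / p)%:E.
Proof.
move=> p0 T0.
pose F (n : nat) : set (measurableTypeR R) := `[(T / n.+2%:R)%R, T]%classic.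
have TF n : (T / n.+2%:R < T)%R by rewrite ltr_pdivrMr// ltr_pMr// ltr1n.
have ndF : {homo F : n m / (n <= m)%N >-> (n <= m)%O}.
  move=> n m nm; apply/subsetPset => x; rewrite /F/= !in_itv/= => /andP[h ->]; rewrite andbT.
  apply: le_trans h; rewrite ler_pM2l// lef_pV2 ?posrE// ler_nat !ltnS//.
have mF n : measurable (F n) by exact: measurable_itv.
have pw0 (n : nat) (x : R) : F n x -> 0 <= (x `^ (p - 1))%:E by rewrite lee_fin powR_ge0.
have cv := @ge0_nondecreasing_set_cvg_integral _ (measurableTypeR R) R F
  (fun x => (x `^ (p - 1))%:E) leb ndF mF (fun n => @mpow (p - 1)%R (F n)) pw0.
apply: (@le_trans _ _ (\int[leb]_(x in \bigcup_i F i) (x `^ (p - 1))%:E)).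
  apply: ge0_subset_integral => //.
  - by apply: bigcupT_measurable => n; exact: measurable_itv.
  - by move=> x _; rewrite lee_fin powR_ge0.
  move=> x /=; rewrite in_itv/= => /andP[x0 xT].
  have [k kx] : exists k : nat, (k.+1%:R^-1 < x / T)%R.
    have := @cvg_harmonic R => /cvgrPdist_lt/(_ (x / T)%R).
    rewrite divr_gt0// => /(_ isT)[N _ /(_ N (leqnn _))] /=.
    by rewrite sub0r normrN ger0_norm ?harmonic_ge0//; exists N.
  exists k => //; rewrite /F/= in_itv/= (ltW xT) andbT.
  rewrite mulrC -ler_pdivlMr//; apply: le_trans (ltW kx).
  by rewrite lef_pV2 ?posrE// ler_nat.
rewrite -(cvg_lim _ cv)//; apply: lime_le; first by apply/cvg_ex; eexists; exact: cv.
apply: nearW => n; rewrite integral_powR ?divr_gt0 ?gt_eqF//.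
by rewrite lee_fin ler_pM2r ?invr_gt0// gerBl powR_ge0.
Qed.

Lemma integral_powR_nearoo (p : R) : (p < 0)%R ->
  \int[leb]_(x in `[1%R, +oo[) (x `^ (p - 1))%:E <= (- p^-1)%:E.
Proof.
move=> p0.
pose F (n : nat) : set (measurableTypeR R) := `[1%R, n.+2%:R]%classic.
have ndF : {homo F : n m / (n <= m)%N >-> (n <= m)%O}.
  move=> n m nm; apply/subsetPset => x; rewrite /F/= !in_itv/= => /andP[-> h] /=.
  by apply: le_trans h _; rewrite ler_nat !ltnS.
have mF n : measurable (F n) by exact: measurable_itv.
have pw0 (n : nat) (x : R) : F n x -> 0 <= (x `^ (p - 1))%:E by rewrite lee_fin powR_ge0.
have cv := @ge0_nondecreasing_set_cvg_integral _ (measurableTypeR R) R F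
  (fun x => (x `^ (p - 1))%:E) leb ndF mF (fun n => @mpow (p - 1)%R (F n)) pw0.
apply: (@le_trans _ _ (\int[leb]_(x in \bigcup_i F i) (x `^ (p - 1))%:E)).
  apply: ge0_subset_integral => //.
  - by apply: bigcupT_measurable => n; exact: measurable_itv.
  - by move=> x _; rewrite lee_fin powR_ge0.
  move=> x /=; rewrite in_itv/= andbT => x1.
  exists (Num.truncn x) => //; rewrite /F/= in_itv/= x1/=.
  apply: ltW; apply: lt_le_trans (truncnS_gt x) _; by rewrite ler_nat.
rewrite -(cvg_lim _ cv)//; apply: lime_le; first by apply/cvg_ex; eexists; exact: cv.
apply: nearW => n; rewrite integral_powR ?ltr1n ?lt_eqF//.
rewrite powR1 lee_fin mulrBl mul1r gerDr.
by rewrite mulr_ge0_le0 ?powR_ge0// invr_le0 ltW.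
Qed.

End power_integrals.

Section gamma_and_beta.
Context {R : realType}.
Local Notation leb := (@lebesgue_measure R).
Local Notation mfun f := (measurable_fun [set: measurableTypeR R] f).

Lemma ge0_integral_gt0 (a b : R) (D : set (measurableTypeR R)) (f : R -> \bar R) : a < b ->
  measurable D -> `]a, b[ `<=` D -> measurable_fun D f -> (forall x, D x -> 0 <= f x)%E ->
  (forall x, a < x < b -> (0 < f x)%E) -> (0 < \int[leb]_(x in D) f x)%E.
Proof.
move=> ab mD abD mf f0 fp; rewrite lt0e integral_ge0// andbT; apply/negP => /eqP i0.
have {}i0 : (\int[leb]_(x in D) `|f x| = 0)%E.
  by rewrite -[RHS]i0; apply: eq_integral => x; rewrite inE => Dx; rewrite gee0_abs// f0.
have /(ae_eq_integral_abs _ mD mf) ae := i0.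
have : leb `]a, b[%classic = 0.
  apply/negligibleP => //; apply: negligibleS ae => x /= xab /(_ (abD _ xab)).
  by apply/eqP; rewrite gt_eqF// fp//; rewrite in_itv in xab.
rewrite lebesgue_measure_itv/= lte_fin ab => -[] /eqP.
by rewrite subr_eq0 gt_eqF.
Qed.

(** The integrand is at most [x^(a-1)] near the origin and at most [2 x^-2]
    at infinity, so that the integral defining [Gamma a] is finite;
    positivity is that of the integrand. *)
Lemma Gamma_gt0 (a : R) : 0 < a -> a <= 1 -> 0 < Gamma a.
Proof.
move=> a0 a1; rewrite /Gamma /Rintegral; set f := fun t : R => (t `^ (a - 1) * expR (- t))%:E.
have mf (D : set (measurableTypeR R)) : measurable_fun D f.
  apply/measurable_EFinP; apply: measurable_funTS; apply: measurable_funM.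
    exact: measurable_powR.
  by apply: measurableT_comp => //; exact: oppr_measurable.
have f0 t : (0 <= f t)%E by rewrite lee_fin mulr_ge0 ?powR_ge0 ?expR_ge0.
apply: fine_gt0; apply/andP; split.
  apply: (ge0_integral_gt0 ltr01) => //.
    by move=> x /=; rewrite !in_itv/= andbT => /andP[].
    by move=> x _; exact: f0.
  by move=> x /andP[x0 x1]; rewrite lte_fin mulr_gt0 ?expR_gt0// powR_gt0.
have -> : `]0, +oo[%classic = `]0, 1[%classic `|` `[1, +oo[%classic :> set R.
  apply/seteqP; split => x /=; rewrite !in_itv/= !andbT.
    by move=> ->; have [x1|x1] := ltP x 1; [left|right].
  by case=> [/andP[]//|]; exact: lt_le_trans.
rewrite ge0_integral_setU//; last 2 first.
- by move=> x _; exact: f0.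
- apply/disj_setPS => x [] /=; rewrite !in_itv/= andbT => /andP[_ x1].
  by rewrite leNgt x1.
apply: lte_add_pinfty.
  apply: (@le_lt_trans _ _ (\int[leb]_(x in `]0%R, 1%R[) (x `^ (a - 1))%:E)%E).
    apply: ge0_le_integral_nonmeas => [x _|x /=]; first exact: f0.
    rewrite in_itv/= => /andP[x0 x1].
    by rewrite lee_fin ler_piMr ?powR_ge0// expR_le1 oppr_le0 ltW.
  by apply: le_lt_trans (integral_powR_near0 a0 ltr01) _; exact: ltry.
apply: (@le_lt_trans _ _ (\int[leb]_(x in `[1%R, +oo[) (2%:E * (x `^ (- 1 - 1))%:E))%E).
  apply: ge0_le_integral_nonmeas => [x _|x /=]; first exact: f0.
  rewrite in_itv/= andbT => x1.
  have x0 : 0 < x by exact: lt_le_trans x1.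
  rewrite -EFinM lee_fin.
  have xa : x `^ (a - 1) <= 1 by rewrite -[leRHS](powRr0 x) ler_powR// subr_le0.
  apply: (@le_trans _ _ (expR (- x))); first by rewrite ler_piMl// expR_ge0.
  rewrite -opprD powRN -[1 + 1]/(2%:R) powR_mulrn ?(ltW x0)//.
  rewrite expRN ler_pdivlMr ?exprn_gt0// mulrC ler_pdivrMr ?expR_gt0//.
  have := @expR_ge1Dxn R x 1 (ltW x0); rewrite -[2`!%:R]/(2%:R : R).
  by move: (expR x) (x ^+ 2) => E X; lra.
rewrite ge0_integralZl//; last 2 first.
- apply/measurable_EFinP; apply: measurable_funTS; exact: measurable_powR.
- by move=> x _; rewrite lee_fin powR_ge0.
rewrite lte_mul_pinfty//.
by apply: le_lt_trans (integral_powR_nearoo _) _; rewrite ?oppr_lt0 ?ltry.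
Qed.

(** The kernel of the Riemann-Liouville integral of order [a], up to the
    factor [1 / Gamma a]. *)
Definition power_kernel (a : R) (r : R) : \bar R :=
  if 0 < r then (r `^ (a - 1))%:E else 0%E.

Lemma power_kernel_ge0 a r : (0 <= power_kernel a r)%E.
Proof. by rewrite /power_kernel; case: ifPn => // _; rewrite lee_fin powR_ge0. Qed.

Lemma power_kernel_causal a : causal (power_kernel a).
Proof. by move=> x x0; rewrite /power_kernel ltNge x0. Qed.

Lemma measurable_power_kernel a : mfun (power_kernel a).
Proof.
apply: measurable_fun_ifT; first exact: measurable_fun_ltr.
  by apply/measurable_EFinP; exact: measurable_powR.
exact: measurable_cst.
Qed.

Lemma power_kernel1 r : power_kernel 1 r = if 0 < r then 1%E else 0%E.
Proof. by rewrite /power_kernel subrr powRr0. Qed.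

Definition truncate (T : R) (f : R -> \bar R) : R -> \bar R := f \_ `]0, T[.

Lemma truncateE T f x : truncate T f x = if x \in `]0, T[ then f x else 0%E.
Proof. by rewrite /truncate patchE mem_setE. Qed.

Lemma truncate_ge0 T f x : (forall x, (0 <= f x)%E) -> (0 <= truncate T f x)%E.
Proof. by move=> f0; rewrite truncateE; case: ifPn. Qed.

Lemma truncate_causal T f : causal (truncate T f).
Proof. by move=> x x0; rewrite truncateE in_itv/= ltNge x0. Qed.

Lemma measurable_truncate T (f : R -> \bar R) :
  measurable_fun (`]0, T[%classic : set (measurableTypeR R)) f -> mfun (truncate T f).
Proof. by move=> mf; apply: (measurable_restrictT _ _).1. Qed.

Lemma integral_truncate T f :
  (\int[leb]_x truncate T f x = \int[leb]_(x in `]0%R, T[) f x)%E.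
Proof. by rewrite [RHS]integral_mkcond. Qed.

Lemma econv_truncate (T t : R) (f g : R -> \bar R) : causal f -> causal g -> t <= T ->
  econv (truncate T f) (truncate T g) t = econv f g t.
Proof.
move=> cf cg tT; rewrite !econv_causalE//; try exact: truncate_causal.
apply: eq_integral => x; rewrite inE/= in_itv/= => /andP[x0 xt].
rewrite !truncateE !in_itv/= x0 (lt_le_trans xt tT)/= subr_gt0 xt/=.
by rewrite ifT// ltrBlDr (le_lt_trans tT)// ltrDl.
Qed.

Lemma integral_power_kernel_lty a T : 0 < a -> 0 < T ->
  (\int[leb]_x truncate T (power_kernel a) x < +oo)%E.
Proof.
move=> a0 T0; rewrite integral_truncate.
apply: le_lt_trans (le_lt_trans (integral_powR_near0 a0 T0) (ltry _)).
apply: ge0_le_integral_nonmeas => x _; first exact: power_kernel_ge0.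
by rewrite /power_kernel; case: ifPn => // _; rewrite lee_fin powR_ge0.
Qed.

(** The constant is the Beta function [B(a, b)]. When [a + b = 1] the
    convolution is invariant under dilations, hence constant on the half
    line; it is finite because its integral over [(0, 1)] is at most the
    product of the integrals of the two kernels over [(0, 1)]. *)
Lemma econv_power_kernel a b : 0 < a -> 0 < b -> a + b = 1 ->
  exists2 B : R, 0 < B &
    econv (power_kernel a) (power_kernel b) = (fun t => B%:E * power_kernel 1 t)%E.
Proof.
move=> a0 b0 ab.
have ka0 := power_kernel_ge0 a; have kb0 := power_kernel_ge0 b.
have mka := measurable_power_kernel a; have mkb := measurable_power_kernel b.
have cka := @power_kernel_causal a; have ckb := @power_kernel_causal b.
pose C := econv (power_kernel a) (power_kernel b) 1.
have CE t : 0 < t -> econv (power_kernel a) (power_kernel b) t = C.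
  move=> t0; rewrite /C /econv.
  rewrite -[LHS](ge0_integral_affine 0 t0); last 2 first.
  - apply: emeasurable_funM => //; apply: (measurableT_comp mka).
    exact: measurable_funB.
  - by move=> x; rewrite mule_ge0.
  rewrite -ge0_integralZl//; last 3 first.
  - apply: emeasurable_funM.
      apply: (measurableT_comp mka); apply: measurable_funB => //.
      by apply: measurable_funD => //; exact: measurable_funM.
    apply: (measurableT_comp mkb).
    by apply: measurable_funD => //; exact: measurable_funM.
  - by move=> x _; rewrite mule_ge0.
  - by rewrite lee_fin ltW.
  apply: eq_integral => x _; rewrite addr0 /power_kernel.
  rewrite -[X in X - t * x]mulr1 -mulrBr !pmulr_rgt0//.
  have [x1|x1] := ltP 0 (1 - x); last by rewrite !mul0e mule0.
  have [x0|x0] := ltP 0 x; last by rewrite !mule0.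
  rewrite -!EFinM; congr EFin.
  rewrite !powRM ?(ltW t0) ?(ltW x0) ?(ltW x1)//.
  have := powRD (x := t) (r := a - 1) (s := b - 1).
  rewrite (gt_eqF t0) implybT => /(_ isT).
  rewrite (_ : a - 1 + (b - 1) = - 1); last by lra.
  rewrite powR_inv1 ?(ltW t0)// => e.
  by rewrite mulrACA -e mulVKf ?gt_eqF//.
have C0 : (0 < C)%E.
  rewrite /C /econv; apply: (ge0_integral_gt0 ltr01) => //.
  - apply: emeasurable_funM => //; apply: (measurableT_comp mka).
    exact: measurable_funB.
  - by move=> x _; rewrite mule_ge0.
  - move=> x /andP[x0 x1]; rewrite /power_kernel subr_gt0 x0 x1 -EFinM lte_fin.
    by rewrite mulr_gt0// powR_gt0// subr_gt0.
have Coo : (C < +oo)%E.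
  apply: (@le_lt_trans _ _ (\int[leb]_t
     econv (truncate 1 (power_kernel a)) (truncate 1 (power_kernel b)) t)%E).
    apply: (@le_trans _ _ (\int[leb]_(t in `]0%R, 1%R[) cst C t)%E).
      rewrite integral_cst//= lebesgue_measure_itv/= lte_fin ltr01.
      by rewrite sube0 mule1.
    rewrite integral_mkcond; apply: ge0_le_integral_nonmeas => t _.
      by rewrite patchE; case: ifPn => // _; exact: ltW.
    rewrite patchE mem_setE; case: ifPn => [|_]; last by rewrite econv_ge0// => x; exact: truncate_ge0.
    by rewrite in_itv/= => /andP[t0 t1]; rewrite (econv_truncate cka ckb (ltW t1)) (CE _ t0).
  rewrite integral_econv.
  - rewrite lte_mul_pinfty ?integral_power_kernel_lty//.
      by apply: integral_ge0 => x _; exact: truncate_ge0.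
    rewrite ge0_fin_numE ?integral_power_kernel_lty//.
    by apply: integral_ge0 => x _; exact: truncate_ge0.
  - by move=> x; exact: truncate_ge0.
  - by move=> x; exact: truncate_ge0.
  - by apply: measurable_truncate; exact: measurable_funTS.
  - by apply: measurable_truncate; exact: measurable_funTS.
exists (fine C); first by rewrite fine_gt0// C0.
apply/funext => t; rewrite power_kernel1 fineK ?ge0_fin_numE ?(ltW C0)//.
case: ifPn => [t0|]; first by rewrite mule1 CE.
by rewrite -leNgt mule0 => /(econv_causal cka ckb).
Qed.

End gamma_and_beta.

(** * Abel's integral equation *)

Section abel_equation.
Context {R : realType}.
Local Notation leb := (@lebesgue_measure R).
Local Notation mfun f := (measurable_fun [set: measurableTypeR R] f).
Local Notation time T := (`]0, T[%classic : set (measurableTypeR R)).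

(** The Riemann-Liouville integral of order [a] of [g], up to the factor [1
    / Gamma a]. *)
Definition rconv (a : R) (g : R -> R) (t : R) : R :=
  \int[leb]_(x in `]0, t[) ((t - x) `^ (a - 1) * g x).

(** Two functions with the same integral over all the intervals [(0, t)]
    have a difference with zero integral over every interval. *)
Lemma ae_eq_of_running_integral (T : R) (P Q : R -> \bar R) :
  (forall x, 0 <= P x)%E -> (forall x, 0 <= Q x)%E ->
  measurable_fun (time T) P -> measurable_fun (time T) Q ->
  (\int[leb]_(x in `]0%R, T[) P x < +oo)%E -> (\int[leb]_(x in `]0%R, T[) Q x < +oo)%E ->
  (forall t, 0 < t -> t < T ->
    (\int[leb]_(x in `]0%R, t[) P x = \int[leb]_(x in `]0%R, t[) Q x)%E) ->
  \forall t \ae leb, t \in `]0, T[ -> P t = Q t.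
Proof.
move=> P0 Q0 mP mQ iP iQ PQ.
have mT : measurable (time T) by exact: measurable_itv.
have IP : leb.-integrable (time T) P.
  by apply/integrableP; split => //; under eq_integral do rewrite gee0_abs//.
have IQ : leb.-integrable (time T) Q.
  by apply/integrableP; split => //; under eq_integral do rewrite gee0_abs//.
have finle (x : \bar R) : (`|(fine x)%:E| <= `|x|)%E.
  by case: x => [r||]; rewrite ?leey.
have IfP : leb.-integrable (time T) (EFin \o (fine \o P)).
  apply: le_integrable IP => //.
    by apply/measurable_EFinP; exact: measurableT_comp.
  by move=> x _; exact: finle.
have IfQ : leb.-integrable (time T) (EFin \o (fine \o Q)).
  apply: le_integrable IQ => //.
    by apply/measurable_EFinP; exact: measurableT_comp.
  by move=> x _; exact: finle.
have IH : leb.-integrable (time T) (EFin \o (fun x => fine (P x) - fine (Q x))).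
  by have := integrableB mT IfP IfQ.
have finP := integrable_ae mT IP; have finQ := integrable_ae mT IQ.
have fineE (S : R -> \bar R) t : t < T -> leb.-integrable (time T) S ->
    \int[leb]_(x in `]0, t[) fine (S x) = fine (\int[leb]_(x in `]0%R, t[) S x)%E.
  move=> tT IS; rewrite /Rintegral; congr fine; apply: ae_eq_integral_nonmeas => //.
  apply: ae_imply (integrable_ae mT IS) => x Sx; rewrite /= in_itv/= => /andP[x0 xt].
  by rewrite fineK// Sx//= in_itv/= x0 (lt_trans xt tT).
have run t : 0 < t -> t < T -> \int[leb]_(x in `]0, t[) (fine (P x) - fine (Q x)) = 0.
  move=> t0 tT.
  have sub : time t `<=` time T.
    by move=> x /=; rewrite !in_itv/= => /andP[-> xt]; rewrite (lt_trans xt).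
  have mt : measurable (time t) by exact: measurable_itv.
  have i1 : leb.-integrable (time t) (EFin \o (fine \o P)) by exact: integrableS IfP.
  have i2 : leb.-integrable (time t) (EFin \o (fine \o Q)) by exact: integrableS IfQ.
  by rewrite RintegralB// !fineE// PQ// subrr.
have itv0 a b : 0 < a -> a < b -> b < T ->
    \int[leb]_(x in `]a, b[) (fine (P x) - fine (Q x)) = 0.
  move=> a0 ab bT.
  have IHs c : c < T -> leb.-integrable (time c) (EFin \o (fun x => fine (P x) - fine (Q x))).
    move=> cT; apply: integrableS IH => //.
    by move=> x /=; rewrite !in_itv/= => /andP[-> xt]; rewrite (lt_trans xt).
  have := Rintegral_itvB (IHs b bT); move=> /(_ a); rewrite !bnd_simp => <-//; last exact: ltW.
  rewrite run ?(lt_trans a0)// -Rintegral_itv_bndo_bndc; last exact/IHs/(lt_trans ab).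
  by rewrite run ?subrr// (lt_trans ab).
apply: ae_imply3 finP finQ (ae_eq0_of_integral_itv IH itv0) => t Pt Qt PQt tT.
by rewrite -(fineK (Pt tT)) -(fineK (Qt tT)); congr EFin; apply/eqP; rewrite -subr_eq0 PQt.
Qed.

(** The signed convolution [rconv] is a difference of convolutions of
    positive parts, which reduces it to the calculus of nonnegative
    convolutions. *)
Definition pospart (T : R) (g : R -> R) : R -> \bar R :=
  truncate T (fun x => (Num.max (g x) 0)%:E).

Lemma pospart_ge0 T g x : (0 <= pospart T g x)%E.
Proof. by apply: truncate_ge0 => y; rewrite lee_fin le_max lexx orbT. Qed.

Lemma measurable_pospart T g : measurable_fun (time T) g -> mfun (pospart T g).
Proof.
move=> mg; apply: measurable_truncate; apply/measurable_EFinP.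
by apply: measurable_maxr => //; exact: measurable_cst.
Qed.

Lemma integral_pospart_lty T g : leb.-integrable (time T) (EFin \o g) ->
  (\int[leb]_x pospart T g x < +oo)%E.
Proof.
move=> /integrableP[_]; rewrite integral_truncate; apply: le_lt_trans.
apply: ge0_le_integral_nonmeas => x _; first by rewrite lee_fin le_max lexx orbT.
by rewrite lee_fin ge_max ler_norm normr_ge0.
Qed.

Lemma rconvE T a g t : t <= T -> rconv a g t =
  fine (econv (power_kernel a) (pospart T g) t -
        econv (power_kernel a) (pospart T (\- g)%R) t)%E.
Proof.
move=> tT; rewrite /rconv /Rintegral; congr fine.
rewrite !econv_causalE; try exact: power_kernel_causal; try exact: truncate_causal.
rewrite integralE; congr (_ - _)%E; apply: eq_integral => x;
  rewrite inE/= in_itv/= => /andP[x0 xt];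
  rewrite /power_kernel subr_gt0 xt /pospart truncateE in_itv/= x0 (lt_le_trans xt tT)/= -EFinM.
  rewrite funeposE -EFin_max maxr_pMr ?powR_ge0// mulr0//.
rewrite funenegE -EFinN -EFin_max maxr_pMr ?powR_ge0// mulr0 mulrN//.
Qed.

Lemma ae_econv_lty T (f g : R -> \bar R) : (forall x, 0 <= f x)%E -> (forall x, 0 <= g x)%E ->
  causal f -> causal g -> mfun f -> mfun g ->
  (\int[leb]_x truncate T f x < +oo)%E -> (\int[leb]_(x in `]0%R, T[) g x < +oo)%E ->
  (\int[leb]_(t in `]0%R, T[) econv f g t < +oo)%E.
Proof.
move=> f0 g0 cf cg mf mg if_ ig.
have tf0 x : (0 <= truncate T f x)%E by exact: truncate_ge0.
have tg0 x : (0 <= truncate T g x)%E by exact: truncate_ge0.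
apply: (@le_lt_trans _ _ (\int[leb]_t econv (truncate T f) (truncate T g) t)%E).
  rewrite integral_mkcond; apply: ge0_le_integral_nonmeas => t _.
    by rewrite patchE; case: ifPn => // _; exact: econv_ge0.
  rewrite patchE mem_setE; case: ifPn => [|_]; last exact: econv_ge0.
  by rewrite in_itv/= => /andP[t0 tT]; rewrite (econv_truncate cf cg (ltW tT)).
rewrite integral_econv//; last 2 first.
- by apply: measurable_truncate; exact: measurable_funTS.
- by apply: measurable_truncate; exact: measurable_funTS.
rewrite lte_mul_pinfty//.
- exact: integral_ge0.
- by rewrite ge0_fin_numE//; exact: integral_ge0.
- by rewrite integral_truncate.
Qed.

Lemma ae_econv_fin_num T (f g : R -> \bar R) : (forall x, 0 <= f x)%E -> (forall x, 0 <= g x)%E ->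
  causal f -> causal g -> mfun f -> mfun g ->
  (\int[leb]_x truncate T f x < +oo)%E -> (\int[leb]_(x in `]0%R, T[) g x < +oo)%E ->
  \forall t \ae leb, t \in `]0, T[ -> econv f g t \is a fin_num.
Proof.
move=> f0 g0 cf cg mf mg if_ ig; apply: (@integrable_ae _ _ _ leb (time T)); first exact: measurable_itv.
apply/integrableP; split; first by apply: measurable_funTS; exact: measurable_econv.
under eq_integral do rewrite gee0_abs ?econv_ge0//.
exact: ae_econv_lty.
Qed.

(** Let [K] and [L] be the power kernels of orders [1 - gm] and [gm], so
    that [L * K = B] on the half line. Convolving the equation [K * y = Ga *
    (1 * g)] with [L] gives [B (1 * y) = Ga * (1 * (L * g))]; both members
    are running integrals, and comparing integrands yields [y = (Ga / B) (L
    * g)]. To remain within nonnegative functions, [y] and [g] are split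
    into positive and negative parts and the negative terms are moved to the
    other side. *)
Lemma abel_inversion (gm : R) : 0 < gm -> gm < 1 ->
  exists2 c : R, 0 < c & forall (T : R) (y g : R -> R), 0 < T ->
    leb.-integrable (time T) (EFin \o y) -> leb.-integrable (time T) (EFin \o g) ->
    (\forall t \ae leb, t \in `]0, T[ ->
      frac_integral (1 - gm) y t = \int[leb]_(x in `]0, t[) g x) ->
    \forall t \ae leb, t \in `]0, T[ -> y t = c * rconv gm g t.
Proof.
move=> gm0 gm1; have gm'0 : 0 < 1 - gm by rewrite subr_gt0.
have [B B0 LK] := econv_power_kernel gm0 gm'0 (subrKC _ _).
have Ga0 : 0 < Gamma (1 - gm) by rewrite Gamma_gt0// gerBl ltW.
set Ga := Gamma (1 - gm) in Ga0 *.
exists (Ga / B); first by rewrite divr_gt0.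
move=> T y g T0 iy ig yg.
have mT : measurable (time T) by exact: measurable_itv.
have my : measurable_fun (time T) y by apply/measurable_EFinP; exact: measurable_int iy.
have mg : measurable_fun (time T) g by apply/measurable_EFinP; exact: measurable_int ig.
have mNy : measurable_fun (time T) (\- y) by exact: measurable_funN.
have mNg : measurable_fun (time T) (\- g) by exact: measurable_funN.
have iNy : leb.-integrable (time T) (EFin \o (\- y)) by have := integrableN iy.
have iNg : leb.-integrable (time T) (EFin \o (\- g)) by have := integrableN ig.
set K := power_kernel (1 - gm); set L := power_kernel gm; set k1 : R -> \bar R := power_kernel 1.
have K0 := power_kernel_ge0 (1 - gm); have L0 := power_kernel_ge0 gm.
have k10 := power_kernel_ge0 (1 : R).
have mK := measurable_power_kernel (1 - gm); have mL := measurable_power_kernel gm.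
have mk1 := measurable_power_kernel (1 : R).
have cK := @power_kernel_causal R (1 - gm); have cL := @power_kernel_causal R gm.
have ck1 := @power_kernel_causal R 1.
have iK := integral_power_kernel_lty gm'0 T0.
have iL := integral_power_kernel_lty gm0 T0.
have ik1 := integral_power_kernel_lty (@ltr01 R) T0.
have pos h : measurable_fun (time T) h -> leb.-integrable (time T) (EFin \o h) ->
    [/\ forall x, (0 <= pospart T h x)%E, causal (pospart T h), mfun (pospart T h) &
       (\int[leb]_(x in `]0%R, T[) pospart T h x < +oo)%E].
  move=> mh ih; split.
  - exact: pospart_ge0.
  - exact: truncate_causal.
  - exact: measurable_pospart.
  - apply: le_lt_trans (integral_pospart_lty ih).
    by apply: ge0_subset_integral => //; [exact: measurable_pospart|move=> x _; exact: pospart_ge0].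
have [Yp0 cYp mYp iYp] := pos _ my iy; have [Ym0 cYm mYm iYm] := pos _ mNy iNy.
have [Gp0 cGp mGp iGp] := pos _ mg ig; have [Gm0 cGm mGm iGm] := pos _ mNg iNg.
set Yp := pospart T y in Yp0 cYp mYp iYp *; set Ym := pospart T (\- y) in Ym0 cYm mYm iYm *.
set Gp := pospart T g in Gp0 cGp mGp iGp *; set Gm := pospart T (\- g) in Gm0 cGm mGm iGm *.
(* The given equation, in the same rearranged form. *)
pose P1 := (econv K Yp \+ (fun t => Ga%:E * econv k1 Gm t))%E.
pose Q1 := (econv K Ym \+ (fun t => Ga%:E * econv k1 Gp t))%E.
have PQ1 : \forall t \ae leb, t \in `]0, T[ -> P1 t = Q1 t.
  have f1 := ae_econv_fin_num K0 Yp0 cK cYp mK mYp iK iYp.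
  have f2 := ae_econv_fin_num K0 Ym0 cK cYm mK mYm iK iYm.
  have f3 := ae_econv_fin_num k10 Gp0 ck1 cGp mk1 mGp ik1 iGp.
  have f4 := ae_econv_fin_num k10 Gm0 ck1 cGm mk1 mGm ik1 iGm.
  have f12 := ae_imply2 (fun t => @conj _ _) f1 f2.
  have f34 := ae_imply2 (fun t => @conj _ _) f3 f4.
  apply: ae_imply3 f12 f34 yg => t [F1 F2] [F3 F4] e tT.
  have {}F1 := F1 tT; have {}F2 := F2 tT; have {}F3 := F3 tT; have {}F4 := F4 tT.
  have tT' : t <= T by move: tT; rewrite in_itv/= => /andP[_ /ltW].
  have := e tT; rewrite /frac_integral -/Ga -/(rconv (1 - gm) y t).
  have -> : \int[leb]_(x in `]0, t[) g x = rconv 1 g t.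
    by apply: eq_Rintegral => x _; rewrite subrr powRr0 mul1r.
  rewrite (rconvE _ y tT') (rconvE _ g tT') -/K -/k1 -/Yp -/Ym -/Gp -/Gm (fineB F1 F2) (fineB F3 F4).
  have -> : P1 t = (econv K Yp t + Ga%:E * econv k1 Gm t)%E by [].
  have -> : Q1 t = (econv K Ym t + Ga%:E * econv k1 Gp t)%E by [].
  rewrite -(fineK F1) -(fineK F2) -(fineK F3) -(fineK F4) -!EFinM -!EFinD.
  set p1 := fine (econv K Yp t); set p2 := fine (econv K Ym t).
  set p3 := fine (econv k1 Gp t); set p4 := fine (econv k1 Gm t) => h.
  congr EFin; have : p1 - p2 = Ga * (p3 - p4) by rewrite -h mulVKf ?gt_eqF.
  lra.
(* The two members of the equation B y = Ga (L * g), with their negative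
   parts exchanged; they are compared through their running integrals. *)
pose P := (fun t => B%:E * Yp t + Ga%:E * econv L Gm t)%E.
pose Q := (fun t => B%:E * Ym t + Ga%:E * econv L Gp t)%E.
have mc := @measurable_econv R.
have e0 f1 f2 : (forall x, 0 <= f1 x)%E -> (forall x, 0 <= f2 x)%E -> (forall x : R, 0 <= econv f1 f2 x)%E.
  by move=> *; exact: econv_ge0.
have Gae r : (0 <= r)%E -> (0 <= Ga%:E * r)%E by move=> r0; rewrite mule_ge0// lee_fin ltW.
have Bae r : (0 <= r)%E -> (0 <= B%:E * r)%E by move=> r0; rewrite mule_ge0// lee_fin ltW.
have LE (Y G : R -> \bar R) t : (forall x, 0 <= Y x)%E -> (forall x, 0 <= G x)%E ->
    mfun Y -> mfun G ->
    econv L (econv K Y \+ (fun t => Ga%:E * econv k1 G t))%E t =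
    econv k1 (fun t => B%:E * Y t + Ga%:E * econv L G t)%E t.
  move=> Y0 G0 mY mG.
  have eK0 := e0 _ _ K0 Y0; have ek0 := e0 _ _ k10 G0; have eL0 := e0 _ _ L0 G0.
  have mKY := mc _ _ K0 Y0 mK mY; have mkG := mc _ _ k10 G0 mk1 mG.
  have mLG := mc _ _ L0 G0 mL mG.
  have h1 x : (0 <= Ga%:E * econv k1 G x)%E by exact/Gae/ek0.
  have h2 x : (0 <= B%:E * Y x)%E by exact: Bae.
  have h3 x : (0 <= Ga%:E * econv L G x)%E by exact/Gae/eL0.
  have m1 := @measurable_funeM _ _ _ setT _ Ga%:E mkG.
  have m2 := @measurable_funeM _ _ _ setT _ B%:E mY.
  have m3 := @measurable_funeM _ _ _ setT _ Ga%:E mLG.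
  rewrite (econvDr t L0 eK0 h1 mL mKY m1) (econvDr t k10 h2 h3 mk1 m2 m3).
  rewrite (econvZr t (ltW Ga0) L0 ek0 mL mkG) (econvZr t (ltW Ga0) k10 eL0 mk1 mLG).
  rewrite (econvA L0 K0 Y0 mL mK mY) LK -/k1.
  rewrite (econvA L0 k10 G0 mL mk1 mG) (econvA k10 L0 G0 mk1 mL mG) (econvC L0 k10 mL mk1).
  have b0 x : (0 <= B%:E * k1 x)%E by exact: Bae.
  rewrite (econvC b0 Y0 (@measurable_funeM _ _ _ setT _ B%:E mk1) mY).
  rewrite (econvZr t (ltW B0) Y0 k10 mY mk1) (econvZr t (ltW B0) k10 Y0 mk1 mY).
  by rewrite (econvC k10 Y0 mk1 mY).
have causalD (c1 c2 : R) f1 f2 : causal f1 -> causal f2 ->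
    causal (fun t => c1%:E * f1 t + c2%:E * f2 t)%E.
  by move=> h1 h2 x x0; rewrite h1// h2// !mule0 adde0.
have causalD' (c2 : R) f1 f2 : causal f1 -> causal f2 ->
    causal (f1 \+ (fun t => c2%:E * f2 t))%E.
  by move=> h1 h2 x x0; rewrite /= h1// h2// mule0 adde0.
have cLGm := econv_causal cL cGm; have cLGp := econv_causal cL cGp.
have cP : causal P by exact: causalD.
have cQ : causal Q by exact: causalD.
have Plty (Y G : R -> \bar R) : (forall x, 0 <= Y x)%E -> (forall x, 0 <= G x)%E ->
    mfun Y -> mfun G -> (\int[leb]_(x in `]0%R, T[) Y x < +oo)%E ->
    (\int[leb]_(x in `]0%R, T[) econv L G x < +oo)%E ->
    (\int[leb]_(t in `]0%R, T[) (B%:E * Y t + Ga%:E * econv L G t) < +oo)%E.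
  move=> Y0 G0 mY mG iY iG.
  have mY' : measurable_fun (time T) Y by exact: measurable_funTS.
  have mLG : measurable_fun (time T) (econv L G) by apply: measurable_funTS; exact: mc.
  have eL0 := e0 _ _ L0 G0.
  rewrite ge0_integralD; [|exact: mT|by move=> x _; exact: Bae|exact: measurable_funeM
    |by move=> x _; apply: Gae; exact: eL0|exact: measurable_funeM].
  rewrite ge0_integralZl; [|exact: mT|exact: mY'|by move=> x _; exact: Y0|by rewrite lee_fin ltW].
  rewrite ge0_integralZl; [|exact: mT|exact: mLG|by move=> x _; exact: eL0|by rewrite lee_fin ltW].
  by apply: lte_add_pinfty; apply: lte_mul_pinfty => //; rewrite lee_fin ltW.
have PQ : \forall t \ae leb, t \in `]0, T[ -> P t = Q t.
  apply: ae_eq_of_running_integral.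
  - by move=> x; rewrite adde_ge0//; [exact: Bae|exact/Gae/e0].
  - by move=> x; rewrite adde_ge0//; [exact: Bae|apply: Gae; exact: e0].
  - apply: measurable_funTS; apply: emeasurable_funD; apply: measurable_funeM => //; exact: mc.
  - apply: measurable_funTS; apply: emeasurable_funD; apply: measurable_funeM => //; exact: mc.
  - exact: (Plty _ _ Yp0 Gm0 mYp mGm iYp (ae_econv_lty L0 Gm0 cL cGm mL mGm iL iGm)).
  - exact: (Plty _ _ Ym0 Gp0 mYm mGp iYm (ae_econv_lty L0 Gp0 cL cGp mL mGp iL iGp)).
  - move=> t t0 tT.
    have k1E S : causal S -> econv k1 S t = (\int[leb]_(x in `]0%R, t[) S x)%E.
      move=> cS; rewrite econv_causalE//; apply: eq_integral => x.
      rewrite inE/= in_itv/= => /andP[x0 xt].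
      by rewrite /k1 power_kernel1 subr_gt0 xt mul1e.
    rewrite -(k1E _ cP) -(k1E _ cQ) /P /Q.
    rewrite -(LE Yp Gm t Yp0 Gm0 mYp mGm) -(LE Ym Gp t Ym0 Gp0 mYm mGp).
    have cP1 := causalD' Ga _ _ (econv_causal cK cYp) (econv_causal ck1 cGm).
    have cQ1 := causalD' Ga _ _ (econv_causal cK cYm) (econv_causal ck1 cGp).
    exact: (econv_local cL cP1 cQ1 (ltW tT) PQ1).
have f3 := ae_econv_fin_num L0 Gp0 cL cGp mL mGp iL iGp.
have f4 := ae_econv_fin_num L0 Gm0 cL cGm mL mGm iL iGm.
apply: ae_imply3 f3 f4 PQ => t F3 F4 e tT.
have {}F3 := F3 tT; have {}F4 := F4 tT.
have tT' : t <= T by move: tT; rewrite in_itv/= => /andP[_ /ltW].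
rewrite (rconvE _ g tT') -/L -/Gp -/Gm (fineB F3 F4).
have := e tT; rewrite /P /Q.
rewrite -(fineK F3) -(fineK F4) /Yp /Ym /pospart !truncateE tT -!EFinM -!EFinD => -[].
set p3 := fine (econv L Gp t); set p4 := fine (econv L Gm t) => h.
have yE : Num.max (y t) 0 - Num.max (- y t) 0 = y t.
  have [y0|/ltW y0] := leP 0 (y t).
    by rewrite [Num.max (- _) _]max_r ?oppr_le0// subr0.
  by rewrite max_l ?oppr_ge0// sub0r opprK.
have : B * y t = Ga * (p3 - p4) by rewrite -{1}yE; move: h; lra.
move=> h'; rewrite -[LHS](mulKf (lt0r_neq0 B0)) h'.
by rewrite mulrA (mulrC _ Ga).
Qed.

End abel_equation.

(** * Stability of Volterra equations in L^2 *)

Section volterra.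
Context {R : realType}.
Local Notation leb := (@lebesgue_measure R).
Local Notation mfun f := (measurable_fun [set: measurableTypeR R] f).
Local Notation time T := (`]0, T[%classic : set (measurableTypeR R)).

(** The Cauchy-Schwarz inequality for the measure with density [p], of total
    mass at most [M]. *)
Lemma econv_sqr_le (p q : R -> \bar R) (M t : R) : 0 < M ->
  (forall x, 0 <= p x)%E -> (forall x, 0 <= q x)%E -> mfun p -> mfun q ->
  (\int[leb]_x p x <= M%:E)%E ->
  (econv p q t * econv p q t <= M%:E * econv p (fun x => q x * q x) t)%E.
Proof.
move=> M0 p0 q0 mp mq pM; set E := econv p q t.
set S := econv p (fun x => q x * q x)%E t.
have mqq : mfun (fun x => q x * q x)%E by exact: emeasurable_funM.
have qq0 x : (0 <= q x * q x)%E by rewrite mule_ge0.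
have E0 : (0 <= E)%E by exact: econv_ge0.
have S0 : (0 <= S)%E by exact: econv_ge0.
have [->|Sfin] := eqVneq S +oo%E; first by rewrite gt0_muley ?lte_fin// leey.
have {Sfin} Sfin : S \is a fin_num by rewrite ge0_fin_numE// lt_neqAle Sfin leey.
(* AM-GM with a free parameter replaces the Cauchy-Schwarz inequality *)
have key (a : R) : 0 < a -> (E <= (2^-1 * a * M)%:E + (2^-1 * a^-1)%:E * S)%E.
  move=> a0.
  have ap := mulr_ge0 (ltW (divr_gt0 ltr01 (ltr0Sn R 1))) (ltW a0).
  apply: (@le_trans _ _ (econv p (cst (2^-1 * a)%:E \+ (fun x => (2^-1 * a^-1)%:E * (q x * q x)))%E t)).
    apply: le_econv => // x /=.
    case: (q x) (q0 x) => [r||]//=; last by rewrite !gt0_muley ?lte_fin ?mulr_gt0 ?invr_gt0// leey.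
    rewrite !lee_fin => r0.
    rewrite -subr_ge0.
    rewrite (_ : _ - _ = 2^-1 * a^-1 * (a - r) ^+ 2).
      by rewrite mulr_ge0 ?sqr_ge0// mulr_ge0 ?invr_ge0 ?ltW.
    by field; rewrite gt_eqF.
  have ia0 : 0 <= 2^-1 * a^-1 by rewrite mulr_ge0 ?invr_ge0 ?ltW.
  rewrite econvDr//; last 3 first.
  - by move=> x; rewrite lee_fin mulr_ge0 ?invr_ge0 ?ltW.
  - by move=> x; rewrite mule_ge0 ?lee_fin.
  - exact: measurable_funeM.
  rewrite econvZr//; apply: leeD => //.
  rewrite /econv ge0_integralZr//; last 2 first.
  - by apply: (measurableT_comp mp); exact: measurable_funB.
  - by rewrite lee_fin mulr_ge0 ?invr_ge0 ?ltW.
  rewrite muleC [leRHS]EFinM; apply: lee_wpmul2l; first by rewrite lee_fin mulr_ge0 ?invr_ge0 ?ltW.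
  by rewrite (ge0_integral_reflect t mp p0).
have Efin : E \is a fin_num.
  rewrite ge0_fin_numE//; apply: le_lt_trans (key 1 ltr01) _.
  by rewrite -(fineK Sfin) -EFinM -EFinD ltry.
rewrite -(fineK Efin) -(fineK Sfin) -!EFinM lee_fin.
have e0 := fine_ge0 E0; have s0 := fine_ge0 S0.
move: key; rewrite -(fineK Efin) -(fineK Sfin).
move: (fine E) (fine S) e0 s0 => e s e0 s0 key.
move: e0; rewrite le_eqVlt => /predU1P[<-|e0]; first by rewrite mul0r mulr_ge0// ltW.
have := key (e / M) (divr_gt0 e0 M0); rewrite -EFinM -EFinD lee_fin.
rewrite (_ : 2^-1 * (e / M) * M + 2^-1 * (e / M)^-1 * s = 2^-1 * e + 2^-1 * (M * s) / e).
  move=> h; have : e / 2 <= 2^-1 * (M * s) / e by move: h; lra.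
  by rewrite ler_pdivlMr//=; lra.
by field; rewrite !gt_eqF.
Qed.

(** Young's inequality for the convolution of L^1 and L^2. *)
Lemma integral_econv_sqr_le (p q : R -> \bar R) (M : R) : 0 < M ->
  (forall x, 0 <= p x)%E -> (forall x, 0 <= q x)%E -> mfun p -> mfun q ->
  (\int[leb]_x p x <= M%:E)%E ->
  (\int[leb]_t (econv p q t * econv p q t) <= (M ^+ 2)%:E * \int[leb]_x (q x * q x))%E.
Proof.
move=> M0 p0 q0 mp mq pM.
have mqq : mfun (fun x => q x * q x)%E by exact: emeasurable_funM.
have qq0 x : (0 <= q x * q x)%E by rewrite mule_ge0.
apply: (@le_trans _ _ (\int[leb]_t (M%:E * econv p (fun x => q x * q x)%E t))%E).
  apply: ge0_le_integral_nonmeas => t _; first by rewrite mule_ge0// econv_ge0.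
  exact: econv_sqr_le.
rewrite ge0_integralZl//; last 3 first.
- exact: measurable_econv.
- by move=> x _; exact: econv_ge0.
- by rewrite lee_fin ltW.
rewrite integral_econv// muleA expr2 EFinM; apply: lee_wpmul2r; first exact: integral_ge0.
by apply: lee_wpmul2l => //; rewrite lee_fin ltW.
Qed.

(** Multiplying a convolution by [exp (- sg t)] amounts to damping both the
    kernel and the function by the same exponential weight. *)
Definition damped_kernel (T a sg : R) : R -> \bar R :=
  truncate T (fun r => (r `^ (a - 1) * expR (- (sg * r)))%:E).

Let mdamp (a sg : R) (D : set (measurableTypeR R)) :
  measurable_fun D (fun r : R => (r `^ (a - 1) * expR (- (sg * r)))%:E).
Proof.
apply/measurable_EFinP; apply: measurable_funTS; apply: measurable_funM.
  exact: measurable_powR.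
by apply: measurableT_comp => //; apply: measurableT_comp.
Qed.

(** By dominated convergence the damped kernel tends to zero in L^1 as the
    damping grows. *)
Lemma damped_kernel_small (T a M : R) : 0 < T -> 0 < a -> 0 < M ->
  exists2 sg : R, 0 <= sg & (\int[leb]_x damped_kernel T a sg x <= M%:E)%E.
Proof.
move=> T0 a0 M0.
have mT : measurable (time T) by exact: measurable_itv.
have cv : (\int[leb]_(x in `]0%R, T[) (x `^ (a - 1) * expR (- (n%:R * x)))%:E)%E @[n --> \oo]
    --> (\int[leb]_(x in `]0%R, T[) (cst 0%E x : \bar R))%E.
  apply: (@dominated_cvg _ _ _ leb (time T) mT _ _ (fun x => (x `^ (a - 1))%:E)) => //.
  - move=> x; rewrite /= in_itv/= => /andP[x0 xT].
    apply/fine_cvgP; split; first by near=> n.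
    rewrite -[X in _ --> X](mulr0 (x `^ (a - 1))); apply: cvgM; first exact: cvg_cst.
    rewrite (_ : (fun n => _) = geometric 1 (expR (- x))).
      by apply: cvg_geometric; rewrite gtr0_norm ?expR_gt0// expR_lt1 oppr_lt0.
    by apply/funext => n; rewrite /geometric/= mul1r -mulrN expRM_natl.
  - apply/integrableP; split.
      by apply/measurable_EFinP; apply: measurable_funTS; exact: measurable_powR.
    under eq_integral do rewrite gee0_abs ?lee_fin ?powR_ge0//.
    by apply: le_lt_trans (integral_powR_near0 a0 T0) _; exact: ltry.
  - move=> n x; rewrite /= in_itv/= => /andP[x0 xT].
    rewrite lee_fin ger0_norm ?mulr_ge0 ?powR_ge0 ?expR_ge0//.
    by rewrite ler_piMr ?powR_ge0// expR_le1 oppr_le0 mulr_ge0// ltW.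
rewrite integral0 in cv.
have : \forall n \near \oo, (\int[leb]_(x in `]0%R, T[) (x `^ (a - 1) * expR (- (n%:R * x)))%:E < M%:E)%E.
  have /fine_cvgP[fin /(cvgr_lt _)/(_ _ M0) ltM] := cv.
  by apply: filterS2 fin ltM => n /fineK <-; rewrite lte_fin.
move=> [n _ /(_ n (leqnn _))] /= h; exists n%:R => //.
by rewrite integral_truncate ltW.
Unshelve. all: end_near. Qed.

(** In the norm of L^2 with weight [exp (- sg t)], the operator [D |-> c *
    rconv a D] has norm at most the mass of the damped kernel times [|c|].
    With [sg] large, this mass is so small that the term [lam * w] can be
    absorbed, and [w] is bounded by [D + lam * w] in the weighted norm. On a
    bounded interval the weighted and the ordinary norms are equivalent;
    this costs the factor [exp (2 sg T)]. *)
Lemma volterra_estimate (a c lam T : R) : 0 < a -> 0 < T ->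
  exists2 C : R, 0 <= C & forall w D : R -> R, L2 leb (time T) w -> L2 leb (time T) D ->
    (\forall t \ae leb, t \in `]0, T[ -> w t = c * rconv a D t) ->
    (\int[leb]_(t in `]0%R, T[) ((w t) ^+ 2)%:E <=
      C%:E * \int[leb]_(t in `]0%R, T[) ((D t + lam * w t) ^+ 2)%:E)%E.
Proof.
move=> a0 T0.
have mT : measurable (time T) by exact: measurable_itv.
(* A mass of the damped kernel for which 2 |c| M <= 1 and 2 |c| M |lam| <=
   1. *)
pose M : R := ((2 * (`|c| + 1)) * (`|lam| + 1))^-1.
have M0 : 0 < M by rewrite invr_gt0 !mulr_gt0// ltr_wpDl.
have [c0 l0] := (normr_ge0 c, normr_ge0 lam).
have den0 : 0 < 2 * (`|c| + 1) * (`|lam| + 1) by rewrite !mulr_gt0// ltr_wpDl.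
have cM : 4 * (c ^+ 2 * M ^+ 2) <= 1.
  have h : 2 * `|c| * M <= 1 by rewrite ler_pdivrMr// mul1r; nra.
  have := exprn_ile1 2 (mulr_ge0 (mulr_ge0 (ler0n R 2) c0) (ltW M0)) h.
  by rewrite !exprMn real_normK ?num_real//; apply: le_trans; rewrite -mulrA; lra.
have clM : 4 * (c ^+ 2 * M ^+ 2 * lam ^+ 2) <= 1.
  have h : 2 * `|c| * M * `|lam| <= 1.
    by rewrite mulrAC ler_pdivrMr// mul1r; nra.
  have := exprn_ile1 2 (mulr_ge0 (mulr_ge0 (mulr_ge0 (ler0n R 2) c0) (ltW M0)) l0) h.
  by rewrite !exprMn !real_normK ?num_real//; apply: le_trans; rewrite -!mulrA; lra.
have [sg sg0 Msg] := damped_kernel_small T0 a0 M0.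
exists (expR (sg * T) ^+ 2); first exact: sqr_ge0.
move=> w D Lw LD wD.
have [mw _] := Lw; have [mD _] := LD.
pose e t : R := expR (- (sg * t)).
have e0 t : 0 <= e t by exact: expR_ge0.
have me (S : set (measurableTypeR R)) : measurable_fun S e.
  apply: measurable_funTS; apply: measurableT_comp => //.
  by apply: measurableT_comp.
have e1 t : 0 < t -> e t <= 1 by move=> t0; rewrite expR_le1 oppr_le0 mulr_ge0// ltW.
have Le f : L2 leb (time T) f -> L2 leb (time T) (e * f).
  move=> [mf foo]; split; first exact: measurable_funM.
  apply: le_lt_trans foo; apply: ge0_le_integral_nonmeas => t /=; first by rewrite lee_fin sqr_ge0.
  rewrite in_itv/= => /andP[t0 _]; rewrite lee_fin exprMn ler_piMl ?sqr_ge0//.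
  by rewrite exprn_ile1// e1.
pose Z t := D t + lam * w t.
have LZ : L2 leb (time T) Z by apply: L2D => //; exact: L2Z.
pose q := truncate T (fun x => (`|D x| * e x)%:E).
have q0 x : (0 <= q x)%E by apply: truncate_ge0 => y; rewrite lee_fin mulr_ge0.
have mq : mfun q.
  apply: measurable_truncate; apply/measurable_EFinP; apply: measurable_funM => //.
  exact: measurableT_comp.
pose p := damped_kernel T a sg.
have p0 x : (0 <= p x)%E by apply: truncate_ge0 => y; rewrite lee_fin mulr_ge0 ?powR_ge0 ?expR_ge0.
have mp : mfun p by apply: measurable_truncate; exact: (@mdamp a sg (time T)).
have conv_le t : t \in `]0, T[ -> ((e t * `|rconv a D t|)%:E <= econv p q t)%E.
  rewrite in_itv/= => /andP[t0 tT].
  have mt : measurable (time t) by exact: measurable_itv.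
  have mDt : measurable_fun (time t) D.
    by apply: measurable_funS mD => // x /=; rewrite !in_itv/= => /andP[-> xt]; rewrite (lt_trans xt).
  have mf : measurable_fun (time t) (fun x => (t - x) `^ (a - 1) * D x).
    apply: measurable_funM => //; apply: measurable_funTS.
    apply: (measurableT_comp (@measurable_powR R (a - 1))).
    exact: measurable_funB.
  have finle (X : \bar R) : ((`|fine X|)%:E <= `|X|)%E.
    by case: X => [r||] /=; rewrite ?normr0 ?leey.
  apply: (@le_trans _ _ ((e t)%:E * \int[leb]_(x in `]0%R, t[) (`|(t - x) `^ (a - 1) * D x|)%:E)%E).
    rewrite EFinM; apply: lee_wpmul2l; first by rewrite lee_fin.
    apply: le_trans (finle _) _; apply: le_trans (le_abse_integral _ mt _) _ => //.
    exact/measurable_EFinP.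
  rewrite econv_causalE; try exact: truncate_causal.
  rewrite -ge0_integralZl//; last 2 first.
  - by apply/measurable_EFinP; exact: measurableT_comp.
  - by rewrite lee_fin.
  rewrite le_eqVlt; apply/orP; left; apply/eqP; apply: eq_integral => x.
  rewrite inE/= in_itv/= => /andP[x0 xt].
  rewrite /p /damped_kernel /q !truncateE !in_itv/= x0 (lt_trans xt tT) subr_gt0 xt/=.
  have -> : t - x < T by rewrite ltrBlDr (lt_trans tT)// ltrDl.
  rewrite -!EFinM; congr EFin; rewrite normrM (ger0_norm (powR_ge0 _ _)).
  have -> : e t = expR (- (sg * (t - x))) * e x by rewrite -expRD; congr expR; ring.
  by ring.
pose A := L2ip leb (time T) (e * w) (e * w).
pose BZ := L2ip leb (time T) (e * Z) (e * Z).
pose BD := L2ip leb (time T) (e * D) (e * D).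
have AD : A <= c ^+ 2 * M ^+ 2 * BD.
  rewrite -lee_fin EFinM -(L2ip_sqr mT (Le _ Lw)) -(L2ip_sqr mT (Le _ LD)).
  apply: (@le_trans _ _ (\int[leb]_(t in `]0%R, T[) ((c ^+ 2)%:E * (econv p q t * econv p q t)))%E).
    apply: ge0_ae_le_integral_nonmeas => //.
    - by move=> t _; rewrite lee_fin sqr_ge0.
    - by move=> t _; rewrite !mule_ge0 ?lee_fin ?sqr_ge0 ?econv_ge0.
    apply: ae_imply wD => t wt tT.
    rewrite -[(e * w) t]/(e t * w t) wt// mulrCA exprMn EFinM.
    apply: lee_wpmul2l; first by rewrite lee_fin sqr_ge0.
    rewrite -(real_normK (num_real (e t * _))) normrM (ger0_norm (e0 t)) expr2 EFinM.
    by apply: lee_pmul; rewrite ?lee_fin ?mulr_ge0//; exact: conv_le.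
  have mpq : mfun (fun t => econv p q t * econv p q t)%E.
    by apply: emeasurable_funM; exact: measurable_econv.
  rewrite ge0_integralZl//; last 3 first.
  - exact: measurable_funTS.
  - by move=> t _; rewrite mule_ge0 ?econv_ge0.
  - by rewrite lee_fin sqr_ge0.
  rewrite [X in (_ <= X * _)%E]EFinM -[leRHS]muleA; apply: lee_wpmul2l; first by rewrite lee_fin sqr_ge0.
  apply: (@le_trans _ _ (\int[leb]_t (econv p q t * econv p q t))%E).
    by apply: ge0_subset_integral => // t _; rewrite mule_ge0 ?econv_ge0.
  apply: le_trans (integral_econv_sqr_le M0 p0 q0 mp mq Msg) _.
  apply: lee_wpmul2l; first by rewrite lee_fin sqr_ge0.
  rewrite [leRHS]integral_mkcond le_eqVlt; apply/orP; left; apply/eqP.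
  apply: eq_integral => x _; rewrite /q truncateE patchE mem_setE.
  case: ifPn => _; last by rewrite mule0.
  by rewrite -EFinM -expr2 exprMn real_normK ?num_real// -exprMn mulrC.
have BDle : BD <= 2 * BZ + 2 * lam ^+ 2 * A.
  have LeZ := Le _ LZ; have Lew := Le _ Lw; have Llw := L2Z mT lam Lew.
  have eD : e * D = e * Z - lam *: (e * w).
    apply/funext => t; rewrite -[RHS]/(e t * (D t + lam * w t) - lam * (e t * w t)).
    by rewrite -[LHS]/(e t * D t); ring.
  rewrite /BD eD; apply: le_trans (L2ip_sqrB_le mT LeZ Llw) _.
  by rewrite L2ip_sqrZ// -mulrA.
have A0 : 0 <= A by exact: L2ip_ge0.
have BZ0 : 0 <= BZ by exact: L2ip_ge0.
have ABZ : A <= BZ.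
  have : A <= c ^+ 2 * M ^+ 2 * (2 * BZ + 2 * lam ^+ 2 * A).
    by apply: le_trans AD _; rewrite ler_wpM2l// mulr_ge0 ?sqr_ge0.
  have := ler_wpM2r A0 clM; have := ler_wpM2r BZ0 cM.
  by move: (c ^+ 2 * M ^+ 2) => X; nra.
pose E := expR (sg * T).
have Ee t : t < T -> 1 <= E * e t.
  by move=> tT; rewrite -expRD -expR0 ler_expR -mulrBr mulr_ge0// subr_ge0 ltW.
apply: (@le_trans _ _ ((E ^+ 2)%:E * A%:E)%E).
  rewrite -(L2ip_sqr mT (Le _ Lw)) -ge0_integralZl//; last 3 first.
  - by have [mew _] := Le _ Lw; apply/measurable_EFinP; exact: measurable_funX.
  - by move=> t _; rewrite lee_fin sqr_ge0.
  - by rewrite lee_fin sqr_ge0.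
  apply: ge0_le_integral_nonmeas => t /=; first by rewrite lee_fin sqr_ge0.
  rewrite in_itv/= => /andP[t0 tT]; rewrite -EFinM lee_fin -exprMn.
  rewrite -[(e * w) t]/(e t * w t) mulrA exprMn ler_peMl ?sqr_ge0//.
  by rewrite expr_ge1// ?Ee// mulr_ge0// expR_ge0.
apply: lee_wpmul2l; first by rewrite lee_fin sqr_ge0.
apply: (@le_trans _ _ BZ%:E); first by rewrite lee_fin.
rewrite -(L2ip_sqr mT (Le _ LZ)).
apply: ge0_le_integral_nonmeas => t /=; first by rewrite lee_fin sqr_ge0.
rewrite in_itv/= => /andP[t0 _]; rewrite lee_fin exprMn ler_piMl ?sqr_ge0//.
by rewrite exprn_ile1// e1.
Qed.

End volterra.

(** * Orthonormal bases *)

Section hilbert_basis.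
Context d (X : measurableType d) (R : realType).
Variable mu : {measure set X -> \bar R}.
Variable D : set X.
Hypothesis mD : measurable D.
Variable phi : nat -> X -> R.
Hypothesis Lphi : forall k, L2 mu D (phi k).
Hypothesis phi_orth : forall j k, L2ip mu D (phi j) (phi k) = (j == k)%:R.

Let proj w N := \sum_(k < N) L2ip mu D w (phi k) *: phi k.

Let Lproj w N : L2 mu D (proj w N).
Proof. by apply: L2_sum => // k _; exact: L2Z. Qed.

Let proj_dist w N : L2 mu D w ->
  L2ip mu D (w - proj w N) (w - proj w N) =
  L2ip mu D w w - \sum_(k < N) L2ip mu D w (phi k) ^+ 2.
Proof.
move=> Lw; have Lp := Lproj w N.
have LZ (k : 'I_N) : L2 mu D (L2ip mu D w (phi k) *: phi k) by exact: L2Z.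
have wp : L2ip mu D (proj w N) w = \sum_(k < N) L2ip mu D w (phi k) ^+ 2.
  rewrite /proj L2ip_suml//; apply: eq_bigr => k _.
  by rewrite (L2ipZl mD _ (Lphi k) Lw) (L2ipC _ _ (phi k)) expr2.
have pp : L2ip mu D (proj w N) (proj w N) = \sum_(k < N) L2ip mu D w (phi k) ^+ 2.
  rewrite {1}/proj L2ip_suml//; apply: eq_bigr => k _.
  rewrite (L2ipZl mD _ (Lphi k) Lp) (L2ipC _ _ (phi k)) /proj L2ip_suml//.
  rewrite (bigD1 k)//= big1 ?addr0.
    by rewrite (L2ipZl mD _ (Lphi k) (Lphi k)) phi_orth eqxx mulr1 expr2.
  move=> j jk; rewrite (L2ipZl mD _ (Lphi j) (Lphi k)) phi_orth.
  by rewrite (_ : (j == k :> nat) = false) ?mulr0//; apply/negbTE.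
by rewrite (L2ip_sqrB _ Lw Lp)// (L2ipC _ _ w) wp pp; lra.
Qed.

Lemma bessel w N : L2 mu D w ->
  \sum_(k < N) L2ip mu D w (phi k) ^+ 2 <= L2ip mu D w w.
Proof. by move=> Lw; rewrite -subr_ge0 -proj_dist// L2ip_ge0. Qed.

(** By Pythagoras the squared distance of [w] to its [N]-th projection is
    [|w|^2] minus the [N]-th partial sum. *)
Lemma parseval w : L2 mu D w ->
  (fun N => Num.sqrt (L2ip mu D (w - proj w N) (w - proj w N))) @ \oo --> (0 : R) ->
  (fun N => \sum_(k < N) L2ip mu D w (phi k) ^+ 2) @ \oo --> L2ip mu D w w.
Proof.
move=> Lw h.
have : (L2ip mu D w w - Num.sqrt (L2ip mu D (w - proj w N) (w - proj w N)) ^+ 2)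
    @[N --> \oo] --> L2ip mu D w w - 0 ^+ 2.
  by apply: cvgB; [exact: cvg_cst|rewrite !expr2; exact: (cvgM h h)].
rewrite expr0n subr0; apply: cvg_trans; apply: near_eq_cvg; near=> N.
by rewrite sqr_sqrtr ?L2ip_ge0// proj_dist// opprB addrC subrK.
Unshelve. all: end_near. Qed.

Lemma L2ip_eq0_ae w : L2 mu D w -> L2ip mu D w w = 0 ->
  \forall x \ae mu, D x -> w x = 0.
Proof.
move=> Lw w0; have [mw _] := Lw.
have : (\int[mu]_(x in D) `|((w x) ^+ 2)%:E| = 0)%E.
  under eq_integral do rewrite gee0_abs ?lee_fin ?sqr_ge0//.
  by rewrite L2ip_sqr// w0.
have mw2 : measurable_fun D (fun x => ((w x) ^+ 2)%:E).
  by apply/measurable_EFinP; exact: measurable_funX.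
move/(ae_eq_integral_abs _ mD mw2); apply: ae_imply => x /[apply] -[] /eqP.
by rewrite sqrf_eq0 => /eqP.
Qed.

End hilbert_basis.

(** * Scalar functions of Bochner functions *)

Section strong_measurability.
Context {R : realType} {V : lmodType R}.
Local Notation leb := (@lebesgue_measure R).
Local Notation time T := (`]0, T[%classic : set (measurableTypeR R)).
Variables (T : R) (X : set V) (N : V -> R) (ev : V -> R) (C : R).
Hypothesis X0 : X 0.
Hypothesis XD : forall (a : R) v w, X v -> X w -> X (a *: v + w).
Hypothesis evD : forall (a : R) v w, X v -> X w -> ev (a *: v + w) = a * ev v + ev w.
Hypothesis C0 : 0 < C.
Hypothesis evN : forall v, X v -> `|ev v| <= C * N v.

Let ev0 : ev 0 = 0.
Proof.
have := evD 1 X0 X0; rewrite scaler0 addr0 mul1r => /eqP.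
by rewrite -subr_eq subrr eq_sym => /eqP.
Qed.

Let XevB v w : X v -> X w -> X (v - w) /\ ev (v - w) = ev v - ev w.
Proof.
move=> Xv Xw; rewrite (_ : v - w = (-1) *: w + v); last by rewrite scaleN1r addrC.
by split; [exact: XD|rewrite evD// mulN1r addrC].
Qed.

Let Xev_sum (I : Type) (r : seq I) (a : I -> R) (x : I -> V) : (forall i, X (x i)) ->
  X (\sum_(i <- r) a i *: x i) /\
  ev (\sum_(i <- r) a i *: x i) = \sum_(i <- r) a i * ev (x i).
Proof.
move=> Xx; elim: r => [|i r [ih1 ih2]]; first by rewrite !big_nil.
by rewrite !big_cons; split; [exact: XD|rewrite evD// ih2].
Qed.

(** The functional [ev] maps the simple approximations of [f] to real simple
    functions that converge almost everywhere to [ev (f t)]. *)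
Lemma strongly_measurable_version (f : R -> V) : strongly_measurable T X N f ->
  exists2 y : R -> R, measurable_fun (time T) y &
    \forall t \ae leb, t \in `]0, T[ -> X (f t) /\ ev (f t) = y t.
Proof.
move=> [f_ sf fcv].
have Xf k t : X (f_ k t).
  by have [m [E [x [_ Xx ->]]]] := sf k; case: (@Xev_sum _ (index_enum 'I_m) (fun i => \1_(E i) t) x Xx).
have mf k : measurable_fun (time T) (fun t => ev (f_ k t)).
  have [m [E [x [mE Xx fE]]]] := sf k.
  rewrite (_ : (fun t => _) = (fun t => \sum_(i < m) \1_(E i) t * ev (x i))); last first.
    by apply/funext => t; rewrite fE; case: (@Xev_sum _ (index_enum 'I_m) (fun i => \1_(E i) t) x Xx).
  apply: measurable_sum => i; apply: measurable_funM => //.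
  by apply: measurable_funTS; apply: measurable_indic; exact: mE.
have [y my yl] := measurable_fun_cvg_version mf.
exists y => //; apply: ae_imply fcv => t /[apply] -[Xft cv]; split => //.
apply/esym/yl; apply/cvgrPdist_le => e e0.
move/cvgrPdist_le : cv => /(_ (e / C) (divr_gt0 e0 C0)); apply: filterS => k.
rewrite sub0r normrN => h.
have [Xd' evd'] := XevB (Xf k t) Xft.
rewrite distrC -evd'; apply: le_trans (evN Xd') _.
by rewrite mulrC -ler_pdivlMr//; apply: le_trans h; exact: ler_norm.
Qed.

Lemma bochner_L2_version (f : R -> V) : bochner_L2 T X N f ->
  exists2 y : R -> R, L2 leb (time T) y &
    \forall t \ae leb, t \in `]0, T[ -> X (f t) /\ ev (f t) = y t.
Proof.
move=> [sf foo]; have [y my yf] := strongly_measurable_version sf.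
have mT : measurable (time T) by exact: measurable_itv.
exists y => //.
have -> : y = C *: (C^-1 *: y) by rewrite scalerA divff ?gt_eqF// scale1r.
apply: L2Z => //; split; first exact: measurable_funM.
apply: le_lt_trans foo; apply: ge0_ae_le_integral_nonmeas => //.
- by move=> t _; rewrite lee_fin sqr_ge0.
- by move=> t _; rewrite lee_fin sqr_ge0.
apply: ae_imply yf => t /[apply] -[Xft yt]; rewrite lee_fin -[(_ *: y) t]/(C^-1 * y t) -yt.
rewrite -real_normK ?num_real//.
have h : `|C^-1 * ev (f t)| <= N (f t).
  by rewrite normrM gtr0_norm ?invr_gt0// mulrC ler_pdivrMr// mulrC; exact: evN.
by apply: lerXn2r => //; rewrite nnegrE//; exact: le_trans h.
Qed.

Lemma bochner_Loo_version (f : R -> V) : bochner_Loo T X N f ->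
  exists2 y : R -> R, measurable_fun (time T) y &
    (exists M, forall t, `|y t| <= M) /\
    \forall t \ae leb, t \in `]0, T[ -> X (f t) /\ ev (f t) = y t.
Proof.
move=> [sf [M fM]]; have [y my yf] := strongly_measurable_version sf.
(* clip the version at the essential bound to bound it everywhere *)
pose K := `|C * M|.
exists (fun t => Num.max (- K) (Num.min (y t) K)).
  by apply: measurable_maxr => //; exact: measurable_minr.
split.
  exists K => t; rewrite ler_norml le_max lexx/= ge_max ge_min lexx orbT andbT.
  by rewrite -subr_ge0 opprK addr_ge0 ?normr_ge0.
apply: ae_imply2 yf fM => t yt Mt tT; have [Xft ytE] := yt tT; split => //.
have h : `|y t| <= K.
  rewrite -ytE; apply: le_trans (evN Xft) _.
  by apply: le_trans (ler_norm _); rewrite ler_pM2l//; exact: Mt.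
move: h; rewrite ler_norml => /andP[h1 h2].
by rewrite ytE min_l// max_r.
Qed.

End strong_measurability.

(** * The spaces H^1_0, H^s and H^-s *)

Section omega_spaces.
Context {R : realType} {n : nat}.
Variable Omega : set 'rV[R]_n.
Hypothesis oO : open Omega.
Local Notation point := 'rV[R]_n.
Local Notation mu := (lebesgue_rV R n).
Local Notation leb := (@lebesgue_measure R).

Let mO : measurable Omega. Proof. exact: open_measurable_rV. Qed.

Lemma continuous_measurable_rV (f : point -> R) (D : set point) :
  continuous f -> measurable_fun D f.
Proof.
move=> cf; apply: measurable_funTS.
apply: (measurability _ (RGenOInfty.measurableE R)) => _ [_ [a ->] <-].
rewrite setTI; apply: open_measurable_rV.
by move/continuousP : cf; apply; exact: rray_open.
Qed.

Let nL2Z_gen (a : R) (f : point -> R) : measurable_fun Omega f ->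
  nL2 Omega (a *: f) = `|a| * nL2 Omega f.
Proof.
move=> mf; rewrite /nL2 /ip /Rintegral.
have -> : (\int[mu]_(x in Omega) ((a *: f) x * (a *: f) x)%:E =
    (a ^+ 2)%:E * \int[mu]_(x in Omega) (f x * f x)%:E)%E.
  rewrite -ge0_integralZl//.
  - apply: eq_integral => x _; rewrite -EFinM; congr EFin.
    by rewrite -[(a *: f) x]/(a * f x); ring.
  - by apply/measurable_EFinP; exact: measurable_funM.
  - by move=> x _; rewrite lee_fin -expr2 sqr_ge0.
  - by rewrite lee_fin sqr_ge0.
have I0 : (0 <= \int[mu]_(x in Omega) (f x * f x)%:E)%E.
  by apply: integral_ge0 => x _; rewrite lee_fin -expr2 sqr_ge0.
rewrite -sqrtr_sqr -sqrtrM ?sqr_ge0//; congr Num.sqrt.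
case: (\int[mu]_(x in Omega) _)%E I0 => [r _ //|_ /=|//].
have [->|a0] := eqVneq a 0; first by rewrite expr0n mul0e mul0r.
by rewrite gt0_muley ?mulr0// lte_fin exprn_even_gt0.
Qed.

Let iter_derivZ (a : R) (vs : seq point) (f : point -> R) : smooth f ->
  iter_deriv vs (a *: f) = a *: iter_deriv vs f.
Proof.
move=> sf; elim: vs => [//|v vs ih] /=; rewrite ih; apply/funext => x.
by rewrite deriveZ//; have [_] := sf vs; exact.
Qed.

Lemma smoothZ (a : R) (f : point -> R) : smooth f -> smooth (a *: f).
Proof.
move=> sf vs; rewrite iter_derivZ//; have [cf df] := sf vs; split.
  move=> x; have : (fun y => a * iter_deriv vs f y) @ x --> a * iter_deriv vs f x.
    exact: (cvgM (cvg_cst a) (cf x)).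
  exact.
by move=> x v; apply: derivableZ; exact: df.
Qed.

Lemma test_functionZ (a : R) (D : set point) (f : point -> R) :
  test_function D f -> test_function D (a *: f).
Proof.
move=> [sf cf fD].
have sub : closure [set x | (a *: f) x != 0] `<=` closure [set x | f x != 0].
  apply: closureS => x /=; apply: contraNN => /eqP fx.
  by rewrite -[(a *: f) x]/(a * f x) fx mulr0.
split; [exact: smoothZ| |exact: subset_trans fD].
by apply: subclosed_compact cf sub; exact: closed_closure.
Qed.

Lemma H10Z (a : R) w G : H10 Omega w G -> H10 Omega (a *: w) (fun i => a *: G i).
Proof.
move=> [Lw LG [psi tpsi [cw cG]]]; split; [exact: L2Z|by move=> i; apply: L2Z => //; exact: LG|].
have spsi k : smooth (psi k) by case: (tpsi k).
exists (fun k => a *: psi k); first by move=> k; exact: test_functionZ.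
have [mw _] := Lw.
split => [|i].
- rewrite (_ : (fun k => _) = (fun k => `|a| * nL2 Omega (psi k - w))).
    rewrite -[X in _ --> X](mulr0 `|a|); apply: cvgM => //; exact: cvg_cst.
  apply/funext => k; rewrite -scalerBr nL2Z_gen//.
  apply: measurable_funB => //; apply: continuous_measurable_rV.
  by have [] := spsi k [::].
- rewrite (_ : (fun k => _) = (fun k => `|a| * nL2 Omega (partial i (psi k) - G i))).
    rewrite -[X in _ --> X](mulr0 `|a|); apply: cvgM => //; exact: cvg_cst.
  apply/funext => k.
  have -> : partial i (a *: psi k) = a *: partial i (psi k).
    exact: (iter_derivZ a [:: delta_mx ord0 i] (spsi k)).
  rewrite -scalerBr nL2Z_gen//.
  have [mG _] := LG i.
  apply: measurable_funB => //; apply: continuous_measurable_rV.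
  by have [] := spsi k [:: delta_mx ord0 i].
Qed.

Lemma nL2_ge0 (f : point -> R) : 0 <= nL2 Omega f.
Proof. exact: sqrtr_ge0. Qed.

Lemma nL2_sqr (f : point -> R) : nL2 Omega f ^+ 2 = L2ip mu Omega f f.
Proof. by rewrite sqr_sqrtr//; exact: L2ip_ge0. Qed.

Lemma nL2_0 : nL2 Omega 0 = 0.
Proof.
by rewrite -(scale0r 0) nL2Z_gen ?normr0 ?mul0r//; exact: measurable_cst.
Qed.

Lemma nH1Z (a : R) w G : H10 Omega w G ->
  nH1 Omega (a *: w) (fun i => a *: G i) = `|a| * nH1 Omega w G.
Proof.
move=> [[mw _] LG _]; rewrite /nH1.
rewrite -sqrtr_sqr -sqrtrM ?sqr_ge0//; congr Num.sqrt.
rewrite nL2Z_gen// exprMn real_normK ?num_real// mulrDr mulr_sumr; congr (_ + _).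
apply: eq_bigr => i _; have [mG _] := LG i.
by rewrite nL2Z_gen// exprMn real_normK ?num_real.
Qed.

Lemma H10_0 w G : H10 Omega w G -> H10 Omega 0 (fun i => 0 *: G i).
Proof. by move=> /(H10Z 0); rewrite scale0r. Qed.

Lemma Kfun_ge0 t w : 0 <= Kfun Omega t w.
Proof.
rewrite /Kfun; set S := [set _ | _].
have [->|] := eqVneq S set0; first by rewrite inf0.
move=> /set0P S0; apply: lb_le_inf => // k [w1 [G1 [_ ->]]]; exact: sqrtr_ge0.
Qed.

Let Kfun_le t w w1 G1 : H10 Omega w1 G1 ->
  Kfun Omega t w <= Num.sqrt (nL2 Omega (w - w1) ^+ 2 + t ^+ 2 * nH1 Omega w1 G1 ^+ 2).
Proof.
move=> h; apply: ge_inf; last by exists w1, G1.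
by exists 0 => k [w2 [G2 [_ ->]]]; exact: sqrtr_ge0.
Qed.

(** The decomposition of [a w] into [0 + a w], which is efficient for small
    [t]. *)
Lemma Kfun_sqr_le1 (a t : R) w G : H10 Omega w G ->
  Kfun Omega t (a *: w) ^+ 2 <= a ^+ 2 * (t ^+ 2 * nH1 Omega w G ^+ 2).
Proof.
move=> h; have := Kfun_le t (a *: w) (H10Z a h).
rewrite subrr nL2_0 expr0n add0r nH1Z// exprMn real_normK ?num_real// => k.
rewrite -[leRHS]sqr_sqrtr; last by apply: mulr_ge0; [exact: sqr_ge0|apply: mulr_ge0; exact: sqr_ge0].
apply: lerXn2r; rewrite ?nnegrE ?Kfun_ge0 ?sqrtr_ge0//.
by rewrite mulrCA.
Qed.

(** The decomposition of [a w] into [a w + 0], which is efficient for large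
    [t]. *)
Lemma Kfun_sqr_le2 (a t : R) w G : H10 Omega w G ->
  Kfun Omega t (a *: w) ^+ 2 <= a ^+ 2 * nL2 Omega w ^+ 2.
Proof.
move=> h; have := Kfun_le t (a *: w) (H10_0 h).
have := nH1Z 0 h; rewrite scale0r normr0 mul0r => ->.
have [[mw _] _ _] := h.
rewrite expr0n mulr0 addr0 subr0 nL2Z_gen// exprMn real_normK ?num_real// => k.
rewrite -[leRHS]sqr_sqrtr; last by apply: mulr_ge0; exact: sqr_ge0.
by apply: lerXn2r; rewrite ?nnegrE ?Kfun_ge0 ?sqrtr_ge0.
Qed.

(** The K-functional of [a w] is at most [|a| t |w|_(H^1)] and at most [|a|
    |w|_(L^2)]; the first bound makes the integral converge at the origin
    since [s < 1], the second one at infinity since [0 < s]. The dependence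
    on [a] is made explicit because the scaled functions serve to normalize
    [w] in [Hms_bound]. *)
Lemma nHs2_scale_le (s : R) w G : 0 < s -> s < 1 -> H10 Omega w G ->
  exists2 C : R, 0 <= C & forall a : R, (nHs2 Omega s (a *: w) <= (a ^+ 2 * C)%:E)%E.
Proof.
move=> s0 s1 h.
pose p1 := 2 - 2 * s; pose p2 := - (2 * s).
have p10 : 0 < p1 by rewrite /p1; lra.
have p20 : p2 < 0 by rewrite /p2; lra.
pose N1 := nH1 Omega w G ^+ 2; pose N2 := nL2 Omega w ^+ 2.
have N10 : 0 <= N1 by exact: sqr_ge0.
have N20 : 0 <= N2 by exact: sqr_ge0.
(* 1 / p1 and - 1 / p2 are the integrals of t^(p1 - 1) over (0, 1) and of
   t^(p2 - 1) over (1, oo). *)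
exists (N1 * p1^-1 + N2 * (- p2^-1)).
  apply: addr_ge0; apply: mulr_ge0 => //; first by rewrite invr_ge0 ltW.
  by rewrite oppr_ge0 invr_le0 ltW.
move=> a; rewrite /nHs2.
have a2 := sqr_ge0 a.
pose g1 (t : R) : \bar R := ((a ^+ 2 * N1)%:E * (t `^ (p1 - 1))%:E)%E.
pose g2 (t : R) : \bar R := ((a ^+ 2 * N2)%:E * (t `^ (p2 - 1))%:E)%E.
pose g t := if t < 1 then g1 t else g2 t.
have g10 t : (0 <= g1 t)%E.
  by apply: mule_ge0; rewrite lee_fin; [exact: mulr_ge0|exact: powR_ge0].
have g20 t : (0 <= g2 t)%E.
  by apply: mule_ge0; rewrite lee_fin; [exact: mulr_ge0|exact: powR_ge0].
have mp (p : R) (D : set (measurableTypeR R)) : measurable_fun D (fun t : R => (t `^ p)%:E).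
  by apply/measurable_EFinP; apply: measurable_funTS; exact: measurable_powR.
have mg (D : set (measurableTypeR R)) : measurable_fun D g.
  apply: measurable_funTS; apply: measurable_fun_ifT.
  - exact: measurable_fun_ltr.
  - by apply: measurable_funeM; exact: (@mp (p1 - 1) setT).
  - by apply: measurable_funeM; exact: (@mp (p2 - 1) setT).
apply: (@le_trans _ _ (\int[leb]_(t in `]0%R, +oo[) g t)%E).
  apply: ge0_le_integral_nonmeas => t /=; rewrite in_itv/= andbT => t0.
    by rewrite lee_fin divr_ge0 ?sqr_ge0// ltW.
  have pw (p : R) : (t `^ (- s)) ^+ 2 / t * t `^ p = t `^ (p + p2 - 1).
    rewrite expr2 -powRD; last by rewrite (gt_eqF t0) implybT.
    rewrite -[t^-1](powR_inv1 (ltW t0)) -!powRD ?(gt_eqF t0) ?implybT//.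
    by congr powR; rewrite /p2; ring.
  have t2E : t ^+ 2 = t `^ 2 by rewrite -powR_mulrn ?ltW.
  rewrite /g /g1 /g2; case: ifPn => _; rewrite -EFinM lee_fin exprMn.
    apply: (@le_trans _ _ ((t `^ (- s)) ^+ 2 * (a ^+ 2 * (t ^+ 2 * N1)) / t)).
      rewrite ler_pM2r ?invr_gt0// ler_wpM2l ?sqr_ge0//; exact: Kfun_sqr_le1.
    rewrite (_ : p1 - 1 = 2 + p2 - 1) -?pw ?t2E; last by rewrite /p1 /p2; ring.
    by rewrite le_eqVlt; apply/orP; left; apply/eqP; ring.
  apply: (@le_trans _ _ ((t `^ (- s)) ^+ 2 * (a ^+ 2 * N2) / t)).
    rewrite ler_pM2r ?invr_gt0// ler_wpM2l ?sqr_ge0//.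
    exact: (Kfun_sqr_le2 a t h).
  rewrite (_ : p2 - 1 = 0 + p2 - 1) -?pw ?powRr0; last by rewrite add0r.
  by rewrite le_eqVlt; apply/orP; left; apply/eqP; ring.
have -> : `]0, +oo[%classic = `]0, 1[%classic `|` `[1, +oo[%classic :> set (measurableTypeR R).
  apply/seteqP; split => x /=; rewrite !in_itv/= !andbT.
    by move=> ->; have [x1|x1] := ltP x 1; [left|right].
  by case=> [/andP[]//|]; exact: lt_le_trans.
have g0 t : (0 <= g t)%E by rewrite /g; case: ifPn.
rewrite ge0_integral_setU//; last 1 first.
  apply/disj_setPS => x [] /=; rewrite !in_itv/= andbT => /andP[_ x1].
  by rewrite leNgt x1.
rewrite mulrDr EFinD; apply: leeD.
  have -> : (\int[leb]_(x in `]0%R, 1%R[) g x = \int[leb]_(x in `]0%R, 1%R[) g1 x)%E.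
    by apply: eq_integral => x; rewrite inE/= in_itv/= /g => /andP[_ ->].
  rewrite ge0_integralZl//; last 2 first.
  - by move=> x _; rewrite lee_fin powR_ge0.
  - by rewrite lee_fin mulr_ge0.
  rewrite mulrA [leRHS]EFinM; apply: lee_wpmul2l; first by rewrite lee_fin mulr_ge0.
  by apply: le_trans (integral_powR_near0 p10 ltr01) _; rewrite powR1 mul1r.
have -> : (\int[leb]_(x in `[1%R, +oo[) g x = \int[leb]_(x in `[1%R, +oo[) g2 x)%E.
  by apply: eq_integral => x; rewrite inE/= in_itv/= andbT /g ltNge => ->.
rewrite ge0_integralZl//; last 2 first.
- by move=> x _; rewrite lee_fin powR_ge0.
- by rewrite lee_fin mulr_ge0.
rewrite mulrA [leRHS]EFinM; apply: lee_wpmul2l; first by rewrite lee_fin mulr_ge0.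
exact: integral_powR_nearoo.
Qed.

Lemma nHs2_ge0 s w : (0 <= nHs2 Omega s w)%E.
Proof.
apply: integral_ge0 => t /=; rewrite in_itv/= andbT => t0.
by rewrite lee_fin divr_ge0 ?sqr_ge0// ltW.
Qed.

Lemma H10_Hs s w G : 0 < s -> s < 1 -> H10 Omega w G -> Hs Omega s w.
Proof.
move=> s0 s1 h; split; first by case: h.
have [C _ /(_ 1)] := nHs2_scale_le s0 s1 h; rewrite scale1r => hC.
by apply: le_lt_trans hC _; exact: ltry.
Qed.

(** The dual norm is a supremum over the unit ball of H^s, so it controls
    the value at [w] after [w] has been scaled into that ball; the supremum
    is finite because [l] is bounded. The scaling factor [(1 + C)^-1] also
    covers the case in which [w] has norm zero. *)
Lemma Hms_bound s w G : 0 < s -> s < 1 -> H10 Omega w G ->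
  exists2 C : R, 0 < C & forall l, Hms Omega s l -> `|l w| <= C * nHms Omega s l.
Proof.
move=> s0 s1 h; have [C C0 hC] := nHs2_scale_le s0 s1 h.
exists (1 + C); first by rewrite ltr_pwDl.
move=> l [lin [K lK]].
pose a := (1 + C)^-1.
have a0 : 0 < a by rewrite invr_gt0 ltr_pwDl.
have Hs0 : Hs Omega s 0 by exact: H10_Hs (H10_0 h).
have Hsa : Hs Omega s (a *: w) by exact: H10_Hs (H10Z a h).
have l0 : l 0 = 0.
  have := lin 1 0 0 Hs0 Hs0; rewrite scaler0 addr0 mul1r => /eqP.
  by rewrite -subr_eq subrr eq_sym => /eqP.
have la : l (a *: w) = a * l w.
  have := lin a w 0 (H10_Hs s0 s1 h) Hs0.
  by rewrite l0 !addr0.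
have aC : a ^+ 2 * C <= 1.
  rewrite /a exprVn mulrC ler_pdivrMr ?mul1r ?exprn_gt0 ?ltr_pwDl//.
  by nra.
have na : nHs Omega s (a *: w) <= 1.
  rewrite -[leRHS]sqrtr1 /nHs ler_sqrt//.
  have ha := hC a.
  have f1 : nHs2 Omega s (a *: w) \is a fin_num.
    by rewrite ge0_fin_numE ?nHs2_ge0//; case: Hsa.
  by rewrite -lee_fin fineK//; apply: le_trans ha _; rewrite lee_fin.
have : `|l (a *: w)| <= nHms Omega s l.
  apply: ub_le_sup; last by exists (a *: w).
  exists `|K| => _ [v [Hv nv] <-].
  apply: le_trans (lK v Hv) _; apply: le_trans (ler_norm _) _.
  by rewrite normrM ler_piMr// ger0_norm ?sqrtr_ge0.
rewrite la normrM gtr0_norm// /a mulrC ler_pdivrMr ?ltr_pwDl//.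
by rewrite mulrC.
Qed.

Lemma Hms0 s : Hms Omega s 0.
Proof.
split; first by move=> a v w _ _; rewrite /= mulr0 addr0.
by exists 0 => v _; rewrite mul0r normr0.
Qed.

Lemma HmsD s (a : R) l1 l2 : Hms Omega s l1 -> Hms Omega s l2 -> Hms Omega s (a *: l1 + l2).
Proof.
move=> [lin1 [K1 h1]] [lin2 [K2 h2]].
have E v : (a *: l1 + l2) v = a * l1 v + l2 v by [].
split.
  by move=> b v w Hv Hw; rewrite !E lin1// lin2//; ring.
exists (`|a| * K1 + K2) => v Hv; rewrite E mulrDl -mulrA.
apply: le_trans (ler_normD _ _) _; apply: lerD; last exact: h2.
by rewrite normrM ler_wpM2l//; exact: h1.
Qed.

End omega_spaces.

(** * From the Caputo derivative to a Volterra equation *)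

Section scalar_caputo.
Context {R : realType}.
Local Notation leb := (@lebesgue_measure R).
Local Notation mfun f := (measurable_fun [set: measurableTypeR R] f).
Local Notation time T := (`]0, T[%classic : set (measurableTypeR R)).

Lemma ae_itv_exists (d : R) (P : R -> Prop) : 0 < d ->
  (\forall t \ae leb, P t) -> exists2 t, 0 < t < d & P t.
Proof.
move=> d0 aeP; apply: contrapT => nP.
have : leb (`]0, d[%classic) = 0.
  apply/negligibleP; first exact: measurable_itv.
  apply: negligibleS aeP => t /=; rewrite in_itv/= => td Pt.
  by apply: nP; exists t.
by rewrite lebesgue_measure_itv/= lte_fin d0 sube0 => -[] /eqP; rewrite gt_eqF.
Qed.

(** Essential limit at [0] from the right. Functions of time are only
    determined up to null sets, so that an initial value can only be
    prescribed in this sense. *)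
Definition ess_lim0 (T : R) (h : R -> R) (l : R) : Prop :=
  forall e : R, 0 < e -> exists2 d : R, 0 < d &
    \forall t \ae leb, t \in `]0, Num.min d T[ -> `|h t - l| <= e.

Lemma ess_lim0_unique T h l l' : 0 < T -> ess_lim0 T h l -> ess_lim0 T h l' -> l = l'.
Proof.
move=> T0 hl hl'; apply/eqP; rewrite -subr_eq0 -normr_le0; apply/ler_addgt0Pl => e e0.
have e2 : 0 < e / 2 by rewrite divr_gt0.
have [d d0 hd] := hl _ e2; have [d' d'0 hd'] := hl' _ e2.
have m0 : 0 < Num.min (Num.min d d') T by rewrite !lt_min d0 d'0 T0.
have := ae_imply2 (fun t => @conj _ _) hd hd' => /(ae_itv_exists m0)[t].
rewrite !lt_min => /andP[t0 /andP[/andP[td td'] tT]] [h1 h2].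
have {}h1 := h1 _; have {}h2 := h2 _.
have k1 : `|h t - l| <= e / 2 by apply: h1; rewrite in_itv/= t0 lt_min td tT.
have k2 : `|h t - l'| <= e / 2 by apply: h2; rewrite in_itv/= t0 lt_min td' tT.
rewrite addr0 (_ : l - l' = (h t - l') - (h t - l)); last by ring.
by apply: le_trans (ler_normB _ _) _; rewrite [leRHS]splitr lerD.
Qed.

Lemma ess_lim0_ae_eq T h h' l : (\forall t \ae leb, t \in `]0, T[ -> h t = h' t) ->
  ess_lim0 T h l -> ess_lim0 T h' l.
Proof.
move=> hh hl e /hl[d d0 hd]; exists d => //.
apply: ae_imply2 hh hd => t ht hd; rewrite in_itv/= lt_min => /and3P[t0 td tT].
by rewrite -ht ?hd// in_itv/= t0 ?lt_min ?td.
Qed.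

Lemma ess_lim0_powR (T K p l : R) h : 0 < p -> 0 <= K ->
  (forall t, 0 < t < T -> `|h t - l| <= K * t `^ p) -> ess_lim0 T h l.
Proof.
move=> p0 K0 hK e e0; pose d := (e / (K + 1)) `^ p^-1.
have K1 : 0 < K + 1 by rewrite ltr_wpDl.
exists d; first by rewrite powR_gt0// divr_gt0.
apply: aeW => t; rewrite in_itv/= lt_min => /and3P[t0 td tT].
apply: le_trans (hK t _) _; first by rewrite t0.
have tp : t `^ p <= e / (K + 1).
  have -> : e / (K + 1) = d `^ p.
    by rewrite /d -powRrM mulVf ?gt_eqF// powRr1// ltW// divr_gt0.
  apply: ge0_ler_powR; rewrite ?nnegrE ?ltW//.
  exact: lt_trans td.
apply: le_trans (ler_wpM2l K0 tp) _.
by rewrite mulrA ler_pdivrMr// mulrC ler_wpM2l ?(ltW e0)// lerDl ler01.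
Qed.

Lemma L2_cst (T c : R) : L2 leb (time T) (cst c).
Proof.
split; first exact: measurable_cst.
rewrite /= (_ : (fun x => _) = cst (c ^+ 2)%:E)// integral_cst//=.
apply: lte_mul_pinfty; rewrite ?lee_fin ?sqr_ge0//.
by rewrite lebesgue_measure_itv/=; case: ifPn => // _; rewrite sube0 ltry.
Qed.

Lemma L2_L1 (T : R) (g : R -> R) : L2 leb (time T) g -> leb.-integrable (time T) (EFin \o g).
Proof.
move=> Lg; have := L2_integrableM (measurable_itv _ : measurable (time T)) Lg (L2_cst T 1).
by apply: eq_integrable => // x _ /=; rewrite mulr1.
Qed.

Lemma bounded_L2 (T M : R) (g : R -> R) : measurable_fun (time T) g ->
  (forall t, 0 < t < T -> `|g t| <= M) -> L2 leb (time T) g.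
Proof.
move=> mg gM; split => //; apply: le_lt_trans (L2_cst T M).2.
apply: ge0_le_integral_nonmeas => t; first by rewrite lee_fin sqr_ge0.
rewrite /= in_itv/= => /gM gt; rewrite lee_fin -real_normK ?num_real//.
by apply: lerXn2r => //; rewrite nnegrE// (le_trans _ gt).
Qed.

(** By the Cauchy-Schwarz inequality the running integral of [g] is
    O(t^(1/2)). *)
Lemma ess_lim0_running_integral (T c : R) (g : R -> R) : 0 < T -> L2 leb (time T) g ->
  ess_lim0 T (fun t => c + \int[leb]_(x in `]0, t[) g x) c.
Proof.
move=> T0 Lg; have mT : measurable (time T) by exact: measurable_itv.
pose K := L2ip leb (time T) g g.
have K0 : 0 <= K by exact: L2ip_ge0.
apply: (@ess_lim0_powR T (Num.sqrt K) 2^-1); rewrite ?sqrtr_ge0 ?invr_gt0//.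
move=> t /andP[t0 tT]; rewrite addrC addKr.
have mt : measurable (time t) by exact: measurable_itv.
have sub : time t `<=` time T.
  by move=> x /=; rewrite !in_itv/= => /andP[-> xt]; rewrite (lt_trans xt).
have Lgt : L2 leb (time t) g.
  have [mg goo] := Lg; split; first exact: measurable_funS mg.
  apply: le_lt_trans goo; apply: ge0_subset_integral => //.
  - by apply/measurable_EFinP; exact: measurable_funX.
  - by move=> x _; rewrite lee_fin sqr_ge0.
have := L2_cauchy_schwarz mt Lgt (L2_cst t 1).
have -> : L2ip leb (time t) g (cst 1) = \int[leb]_(x in `]0, t[) g x.
  by apply: eq_Rintegral => x _; rewrite mulr1.
have -> : L2ip leb (time t) (cst 1) (cst 1) = t.
  rewrite /L2ip (_ : (fun x => _) = cst (1 * 1))// Rintegral_cst// mulr1 mul1r.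
  have lt : leb `]0, t[%classic = t%:E by rewrite lebesgue_measure_itv/= lte_fin t0 sube0.
  by transitivity (fine (t%:E)) => //; congr fine; exact: lt.
have gK : L2ip leb (time t) g g <= K.
  rewrite -lee_fin -(L2ip_sqr mt Lgt) -(L2ip_sqr mT Lg).
  apply: ge0_subset_integral => //.
  - by have [mg _] := Lg; apply/measurable_EFinP; exact: measurable_funX.
  - by move=> x _; rewrite lee_fin sqr_ge0.
have sqrt_le (I t' : R) : 0 <= t' -> I ^+ 2 <= K * t' -> `|I| <= Num.sqrt K * t' `^ 2^-1.
  by move=> t'0 IK; rewrite powR12_sqrt// -sqrtrM// -sqrtr_sqr; apply: ler_wsqrtr.
move=> cs; apply: sqrt_le; first exact: ltW.
by apply: le_trans cs _; rewrite ler_wpM2r// ltW.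
Qed.

Lemma rconv_bound (a M t : R) (Y : R -> R) : 0 < a -> 0 < t ->
  measurable_fun (time t) Y -> (forall x, `|Y x| <= M) ->
  `|rconv a Y t| <= M * (t `^ a / a).
Proof.
move=> a0 t0 mY YM.
have mt : measurable (time t) by exact: measurable_itv.
have mf : measurable_fun (time t) (fun x => (t - x) `^ (a - 1) * Y x).
  apply: measurable_funM => //; apply: measurable_funTS.
  apply: (measurableT_comp (@measurable_powR R (a - 1))).
  exact: measurable_funB.
have M0 : 0 <= M by exact: le_trans (YM 0).
have ka0 := power_kernel_ge0 a; have k10 := power_kernel_ge0 (1 : R).
have mka := measurable_power_kernel a; have mk1 := measurable_power_kernel (1 : R).
have cka := @power_kernel_causal R a; have ck1 := @power_kernel_causal R 1.
rewrite -lee_fin.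
have finle (X : \bar R) : ((`|fine X|)%:E <= `|X|)%E.
  by case: X => [r||] /=; rewrite ?normr0 ?leey.
apply: le_trans (finle _) _; apply: le_trans (le_abse_integral _ mt _) _.
  exact/measurable_EFinP.
apply: (@le_trans _ _ (M%:E * econv (power_kernel a) (power_kernel 1) t)%E).
  rewrite econv_causalE// -ge0_integralZl//; last first.
  - by move=> x _; rewrite mule_ge0.
  - apply: measurable_funTS; apply: emeasurable_funM => //.
    by apply: (measurableT_comp mka); exact: measurable_funB.
  apply: ge0_le_integral_nonmeas => // x; rewrite /= in_itv/= => /andP[x0 xt].
  rewrite power_kernel1 x0 mule1 /power_kernel subr_gt0 xt -EFinM lee_fin.
  by rewrite normrM (ger0_norm (powR_ge0 _ _)) mulrC; apply: ler_wpM2r; rewrite ?powR_ge0.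
rewrite EFinM; apply: lee_wpmul2l; first by rewrite lee_fin.
rewrite econvC// econv_causalE//.
apply: le_trans (integral_powR_near0 a0 t0).
apply: ge0_le_integral_nonmeas => x; first by rewrite mule_ge0.
rewrite /= in_itv/= => /andP[x0 xt].
by rewrite power_kernel1 subr_gt0 xt mul1e /power_kernel x0.
Qed.

(** The convolution of the integrable kernel with the integrable function
    [|g|] is finite almost everywhere. *)
Lemma ae_integrable_rconv (a T : R) (g : R -> R) : 0 < a -> 0 < T ->
  L2 leb (time T) g -> \forall t \ae leb, t \in `]0, T[ ->
    leb.-integrable (time t) (EFin \o (fun x => (t - x) `^ (a - 1) * g x)).
Proof.
move=> a0 T0 Lg; have [mg _] := Lg.
pose G := truncate T (fun x => `|g x|%:E).
have G0 x : (0 <= G x)%E by apply: truncate_ge0 => y; rewrite lee_fin.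
have cG : causal G by exact: truncate_causal.
have mG : mfun G.
  by apply: measurable_truncate; apply/measurable_EFinP; exact: measurableT_comp.
have iG : (\int[leb]_(x in `]0%R, T[) G x < +oo)%E.
  have /integrableP[_] := L2_L1 Lg; apply: le_lt_trans.
  apply: ge0_le_integral_nonmeas => x //; rewrite /= => xT.
  by rewrite /G truncateE xT.
have ka0 := power_kernel_ge0 a.
have mka := measurable_power_kernel a.
have cka := @power_kernel_causal R a.
have := ae_econv_fin_num ka0 G0 cka cG mka mG (integral_power_kernel_lty a0 T0) iG.
apply: ae_imply => t H tT; have {H} := H tT => H.
move: tT; rewrite in_itv/= => /andP[t0 tT].
have mt : measurable (time t) by exact: measurable_itv.
have sub : time t `<=` time T.
  by move=> x /=; rewrite !in_itv/= => /andP[-> xt]; rewrite (lt_trans xt).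
apply/integrableP; split.
  apply/measurable_EFinP; apply: measurable_funM; last exact: measurable_funS mg.
  apply: measurable_funTS.
  apply: (measurableT_comp (@measurable_powR R (a - 1))).
  exact: measurable_funB.
have e0 := econv_ge0 t ka0 G0.
move: H; rewrite ge0_fin_numE// econv_causalE//; apply: le_lt_trans.
apply: ge0_le_integral_nonmeas => // x; rewrite /= in_itv/= => /andP[x0 xt].
rewrite /power_kernel subr_gt0 xt /G truncateE in_itv/= x0 (lt_trans xt tT)/=.
by rewrite -EFinM lee_fin normrM ger0_norm ?powR_ge0.
Qed.

Lemma ae_rconv_linear (a T c d : R) (g h : R -> R) : 0 < a -> 0 < T ->
  L2 leb (time T) g -> L2 leb (time T) h -> \forall t \ae leb, t \in `]0, T[ ->
    rconv a (c *: g + d *: h) t = c * rconv a g t + d * rconv a h t.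
Proof.
move=> a0 T0 Lg Lh.
apply: ae_imply2 (ae_integrable_rconv a0 T0 Lg) (ae_integrable_rconv a0 T0 Lh) => t ig ih tT.
have {}ig := ig tT; have {}ih := ih tT.
have mt : measurable (time t) by exact: measurable_itv.
rewrite /rconv -RintegralZl// -RintegralZl// -RintegralD//.
- by apply: eq_Rintegral => x _; rewrite [X in _ * X](_ : _ = c * g x + d * h x)// mulrDr (mulrCA _ c) (mulrCA _ d).
- by have := integrableZl mt c ig.
- by have := integrableZl mt d ih.
Qed.

(** For order one the du Bois-Reymond lemma gives [y] as a running integral,
    and the initial value identifies the constant. For order [gm < 1] it is
    applied to the fractional integral of [y - y0]: this function is
    O(t^(1-gm)) because [y] is bounded, so that the constant is zero, and
    Abel's equation is then inverted. *)
Lemma scalar_caputo_rep (gm : R) : 0 < gm -> gm <= 1 ->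
  exists c : R, forall (T : R) (y g : R -> R) (y0 : R), 0 < T ->
    measurable_fun (time T) y -> (exists M, forall t, `|y t| <= M) ->
    L2 leb (time T) g -> ess_lim0 T y y0 ->
    (if gm == 1 then weak_derivative T y g
     else weak_derivative T (frac_integral (1 - gm) (fun t => y t - y0)) g) ->
    \forall t \ae leb, t \in `]0, T[ -> y t = y0 + c * rconv gm g t.
Proof.
move=> gm0 gm1; have [-> | gm_neq1] := eqVneq gm 1.
  exists 1 => T y g y0 T0 my [M yM] Lg yy0 wd.
  have Ly : L2 leb (time T) y by apply: (@bounded_L2 T M) => // t _.
  have [c hc] := du_Bois_Reymond T0 (L2_L1 Ly) (L2_L1 Lg) wd.
  have cy0 := ess_lim0_unique T0 (ess_lim0_ae_eq hc yy0) (ess_lim0_running_integral c T0 Lg).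
  apply: ae_imply hc => t yt tT; rewrite (yt tT) cy0 mul1r; congr (_ + _).
  by apply: eq_Rintegral => x _; rewrite subrr powRr0 mul1r.
have {}gm1 : gm < 1 by rewrite lt_neqAle gm_neq1.
have gm'0 : 0 < 1 - gm by rewrite subr_gt0.
have [c _ inv] := abel_inversion gm0 gm1.
exists c => T y g y0 T0 my [M yM] Lg yy0 wd.
have mT : measurable (time T) by exact: measurable_itv.
pose Y t := y t - y0.
have mY : measurable_fun (time T) Y by apply: measurable_funB => //; exact: measurable_cst.
have YM x : `|Y x| <= M + `|y0| by rewrite (le_trans (ler_normB _ _))// lerD2r.
have M0 : 0 <= M + `|y0| by exact: le_trans (YM 0).
have LY : L2 leb (time T) Y by apply: (@bounded_L2 T (M + `|y0|)) => // t _.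
set h := frac_integral _ _ in wd.
have Ga0 : 0 < Gamma (1 - gm) by rewrite Gamma_gt0// gerBl ltW.
pose K := (Gamma (1 - gm))^-1 * ((M + `|y0|) / (1 - gm)).
have K0 : 0 <= K by rewrite mulr_ge0// ?invr_ge0 ?divr_ge0// ltW.
have hK t : 0 < t < T -> `|h t| <= K * t `^ (1 - gm).
  move=> /andP[t0 tT]; rewrite /h /frac_integral -/(rconv (1 - gm) Y t).
  have mYt : measurable_fun (time t) Y.
    apply: measurable_funS mY => // x /=; rewrite !in_itv/= => /andP[-> xt].
    by rewrite (lt_trans xt).
  rewrite normrM ger0_norm ?invr_ge0 ?(ltW Ga0)// /K -mulrA.
  apply: ler_wpM2l; first by rewrite invr_ge0 ltW.
  by apply: le_trans (rconv_bound gm'0 t0 mYt YM) _; rewrite mulrAC mulrA.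
have mh : measurable_fun (time T) h.
  apply: (@eq_measurable_fun _ _ _ _ _ (fun t => (Gamma (1 - gm))^-1 *
    fine (econv (power_kernel (1 - gm)) (pospart T Y) t -
        econv (power_kernel (1 - gm)) (pospart T (\- Y)%R) t)%E)).
    move=> t; rewrite inE/= in_itv/= => /andP[t0 tT].
    by rewrite -rconvE// ltW.
  apply: measurable_funM; first exact: measurable_cst.
  apply: measurableT_comp => //; apply: measurable_funTS.
  have mYp := measurable_pospart mY.
  have mYm : mfun (pospart T (\- Y)) by apply: measurable_pospart; exact: measurable_funN.
  have k0 := power_kernel_ge0 (1 - gm); have mk := measurable_power_kernel (1 - gm).
  apply: emeasurable_funB; apply: measurable_econv => //; exact: pospart_ge0.
have Lh : L2 leb (time T) h.
  apply: (@bounded_L2 T (K * T `^ (1 - gm))) => // t tT.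
  apply: le_trans (hK t tT) _; rewrite ler_wpM2l//.
  move: tT => /andP[t0 tT]; apply: ge0_ler_powR; rewrite ?nnegrE ?ltW//.
have h0 : ess_lim0 T h 0.
  by apply: (@ess_lim0_powR T K (1 - gm)) => // t tT; rewrite subr0 hK.
have [c' hc] := du_Bois_Reymond T0 (L2_L1 Lh) (L2_L1 Lg) wd.
have c'0 := ess_lim0_unique T0 (ess_lim0_ae_eq hc h0) (ess_lim0_running_integral c' T0 Lg).
have {}hc : \forall t \ae leb, t \in `]0, T[ ->
    frac_integral (1 - gm) Y t = \int[leb]_(x in `]0, t[) g x.
  by apply: ae_imply hc => t H tT; rewrite -/h (H tT) -c'0 add0r.
apply: ae_imply (inv T Y g T0 (L2_L1 LY) (L2_L1 Lg) hc) => t H tT.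
by rewrite -(H tT) addrC subrK.
Qed.

End scalar_caputo.

(** * The scalar equation of a mode *)

Section modes.
Context {R : realType}.
Local Notation leb := (@lebesgue_measure R).
Local Notation time T := (`]0, T[%classic : set (measurableTypeR R)).

Lemma weak_derivative_ae_eq (T : R) (h h' g g' : R -> R) :
  (\forall t \ae leb, t \in `]0, T[ -> h t = h' t) ->
  (\forall t \ae leb, t \in `]0, T[ -> g t = g' t) ->
  weak_derivative T h g -> weak_derivative T h' g'.
Proof.
move=> hh gg wd psi psiT; have := wd psi psiT.
have mT : measurable (time T) by exact: measurable_itv.
have congr_ae k k' e : (\forall t \ae leb, t \in `]0, T[ -> k t = k' t) ->
    \int[leb]_(t in `]0, T[) (k t * e t) = \int[leb]_(t in `]0, T[) (k' t * e t).
  move=> kk; rewrite /Rintegral; congr fine; apply: ae_eq_integral_nonmeas => //.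
  by apply: ae_imply kk => t kt tT; rewrite kt.
by rewrite (congr_ae _ _ _ hh) (congr_ae _ _ _ gg).
Qed.

Variables (gm lam c T y0 : R) (F : R -> R).
Hypotheses (gm0 : 0 < gm) (T0 : 0 < T).

(** [y] solves the fractional equation [D^gm y + lam y = F + zeta], [y(0) =
    y0], in its Volterra form: [g] stands for the derivative of [y]. The
    functions [F] and [zeta] are arbitrary since they only enter through the
    sum [g + lam * y]. *)
Definition mode_solution (y zeta : R -> R) : Prop :=
  L2 leb (time T) y /\
  exists g : R -> R, [/\ L2 leb (time T) g,
    \forall t \ae leb, t \in `]0, T[ -> y t = y0 + c * rconv gm g t &
    \forall t \ae leb, t \in `]0, T[ -> g t + lam * y t = F t + zeta t].

(** In the difference of two solutions both [y0] and [F] cancel. *)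
Lemma mode_solution_estimate : exists2 C : R, 0 <= C &
  forall y y' zeta zeta', mode_solution y zeta -> mode_solution y' zeta' ->
    (\int[leb]_(t in `]0%R, T[) ((y t - y' t) ^+ 2)%:E <=
     C%:E * \int[leb]_(t in `]0%R, T[) ((zeta t - zeta' t) ^+ 2)%:E)%E.
Proof.
have mT : measurable (time T) by exact: measurable_itv.
have [C C0 HC] := volterra_estimate c lam gm0 T0; exists C => //.
move=> y y' zeta zeta' [Ly [g [Lg yg gz]]] [Ly' [g' [Lg' yg' gz']]].
have rep : \forall t \ae leb, t \in `]0, T[ ->
    (y - y') t = c * rconv gm (1 *: g + (-1) *: g') t.
  apply: ae_imply3 yg yg' (ae_rconv_linear 1 (-1) gm0 T0 Lg Lg') => t h1 h2 h3 tT.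
  have -> : (y - y') t = y t - y' t by [].
  by rewrite h1// h2// h3//; ring.
have LD : L2 leb (time T) (1 *: g + (-1) *: g').
  by apply: L2D => //; [exact: (L2Z mT 1 Lg)|exact: (L2Z mT (-1) Lg')].
have := HC _ _ (L2B mT Ly Ly') LD rep; set I1 := (\int[_]_(_ in _) _)%E; set I2 := (\int[_]_(_ in _) _)%E.
suff -> : I2 = (\int[leb]_(t in `]0%R, T[) ((zeta t - zeta' t) ^+ 2)%:E)%E by [].
apply: ae_eq_integral_nonmeas => //; apply: ae_imply2 gz gz' => t h1 h2 tT.
have -> : (1 *: g + (-1) *: g') t + lam * (y - y') t =
    (g t + lam * y t) - (g' t + lam * y' t).
  have -> : (y - y') t = y t - y' t by [].
  have -> : (1 *: g + (-1) *: g') t = 1 * g t + (-1) * g' t by [].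
  by ring.
by rewrite h1// h2//; congr (_ ^+ 2)%:E; ring.
Qed.

Lemma mode_solution_mid y y' zeta zeta' : mode_solution y zeta -> mode_solution y' zeta' ->
  mode_solution (2^-1 *: y + 2^-1 *: y') (fun t => 2^-1 * zeta t + 2^-1 * zeta' t).
Proof.
have mT : measurable (time T) by exact: measurable_itv.
move=> [Ly [g [Lg yg gz]]] [Ly' [g' [Lg' yg' gz']]]; split.
  by apply: L2D => //; [exact: (L2Z mT _ Ly)|exact: (L2Z mT _ Ly')].
exists (2^-1 *: g + 2^-1 *: g'); split.
- by apply: L2D => //; [exact: (L2Z mT _ Lg)|exact: (L2Z mT _ Lg')].
- apply: ae_imply3 yg yg' (ae_rconv_linear 2^-1 2^-1 gm0 T0 Lg Lg') => t h1 h2 h3 tT.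
  have -> : (2^-1 *: y + 2^-1 *: y') t = 2^-1 * y t + 2^-1 * y' t by [].
  by rewrite h1// h2// h3//; field.
- apply: ae_imply2 gz gz' => t h1 h2 tT.
  have -> : (2^-1 *: y + 2^-1 *: y') t = 2^-1 * y t + 2^-1 * y' t by [].
  have -> : (2^-1 *: g + 2^-1 *: g') t = 2^-1 * g t + 2^-1 * g' t by [].
  transitivity (2^-1 * (g t + lam * y t) + 2^-1 * (g' t + lam * y' t)); first by ring.
  by rewrite h1// h2//; field.
Qed.

(** Equality of the controls in L^2 is expressed by the vanishing of an
    integral of a possibly nonmeasurable function. *)
Lemma mode_solution_unique y y' zeta zeta' : mode_solution y zeta -> mode_solution y' zeta' ->
  (\int[leb]_(t in `]0%R, T[) ((zeta t - zeta' t) ^+ 2)%:E <= 0)%E ->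
  \forall t \ae leb, t \in `]0, T[ -> y t = y' t.
Proof.
have mT : measurable (time T) by exact: measurable_itv.
have [C C0 HC] := mode_solution_estimate.
move=> sy sy' z0; have [[Ly _] [Ly' _]] := (sy, sy').
have Lw := L2B mT Ly Ly'.
have z00 : (\int[leb]_(t in `]0%R, T[) ((zeta t - zeta' t) ^+ 2)%:E = 0)%E.
  by apply/eqP; rewrite eq_le z0 integral_ge0// => x _; rewrite lee_fin sqr_ge0.
have := HC _ _ _ _ sy sy'; rewrite z00 mule0.
have -> : (\int[leb]_(t in `]0%R, T[) ((y t - y' t) ^+ 2)%:E = (L2ip leb (time T) (y - y') (y - y'))%:E)%E.
  by rewrite -(L2ip_sqr mT Lw).
rewrite lee_fin => w0.
have := L2ip_eq0_ae mT Lw; move=> /(_ _)/ae_imply; apply.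
  by move=> t H tT; apply/eqP; rewrite -subr_eq0; apply/eqP; exact: H.
by apply/eqP; rewrite eq_le w0 L2ip_ge0.
Qed.

End modes.

(** * The modes of a state *)

Section state_modes.
Context {R : realType} {n : nat}.
Variable Omega : set 'rV[R]_n.
Hypothesis oO : open Omega.
Local Notation point := 'rV[R]_n.
Local Notation mu := (lebesgue_rV R n).
Local Notation leb := (@lebesgue_measure R).
Local Notation time T := (`]0, T[%classic : set (measurableTypeR R)).

Let mO : measurable Omega. Proof. exact: open_measurable_rV. Qed.

Lemma ip_le_nL2 (v w : point -> R) : L2O Omega v -> L2O Omega w ->
  `|ip Omega v w| <= nL2 Omega v * nL2 Omega w.
Proof.
move=> Lv Lw; rewrite /nL2 -sqrtrM ?L2ip_ge0// -sqrtr_sqr.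
by apply: ler_wsqrtr; exact: L2_cauchy_schwarz.
Qed.

Variables (T s gamma : R) (lambda : nat -> R) (phi : nat -> point -> R).
Hypotheses (T0 : 0 < T) (s0 : 0 < s) (s1 : s < 1).
Hypothesis gamma0 : 0 < gamma.
Hypothesis phi_H10 : forall k, exists G, H10 Omega (phi k) G.
Hypothesis phi_orth : forall j k, ip Omega (phi j) (phi k) = (j == k)%:R.

Lemma eigenfunction_L2 k : L2O Omega (phi k).
Proof. by have [G []] := phi_H10 k. Qed.

Lemma eigenfunction_Hs k : Hs Omega s (phi k).
Proof. by have [G HG] := phi_H10 k; exact: H10_Hs HG. Qed.

(** All terms of the series but the [j]-th vanish by orthogonality. *)
Lemma frac_op_eigenfunction (w : point -> R) j :
  frac_op Omega lambda phi s w (phi j) = lambda j `^ s * ip Omega w (phi j).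
Proof.
rewrite /frac_op; apply: cvg_lim => //; apply: cvg_near_cst.
exists j.+1 => // N /= jN; rewrite /series/=.
rewrite (bigD1_seq j)/= ?mem_index_iota ?iota_uniq//= phi_orth eqxx mulr1.
by rewrite big1 ?addr0// => i ij; rewrite phi_orth eq_sym (negbTE ij) mulr0.
Qed.

Lemma ip_eigenfunction_le v j : L2O Omega v -> `|ip Omega v (phi j)| <= 1 * nL2 Omega v.
Proof.
move=> Lv; apply: le_trans (ip_le_nL2 Lv (eigenfunction_L2 j)) _.
by rewrite /nL2 phi_orth eqxx sqrtr1 mulr1 mul1r.
Qed.

Lemma initial_value_mode (u : R -> point -> R) (w0 : point -> R) (y : R -> R) j :
  (\forall t \ae leb, t \in `]0, T[ -> L2O Omega (u t) /\ ip Omega (u t) (phi j) = y t) ->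
  initial_value Omega T u w0 -> ess_lim0 T y (ip Omega w0 (phi j)).
Proof.
move=> uy [Lw0 ini] e /ini[d d0 hd]; exists d => //.
apply: ae_imply2 uy hd => t ut hd tdT.
have tT : t \in `]0, T[.
  by move: tdT; rewrite !in_itv/= lt_min => /and3P[-> _ ->].
have [Lu <-] := ut tT; apply: le_trans (hd tdT).
have Lphi := eigenfunction_L2 j.
have -> : ip Omega (u t) (phi j) - ip Omega w0 (phi j) = ip Omega (u t - w0) (phi j).
  by apply/esym; exact: (L2ipBl mO Lu Lw0 Lphi).
have := ip_eigenfunction_le j (L2B mO Lu Lw0).
by rewrite mul1r.
Qed.

Lemma frac_integral_mode (u : R -> point -> R) (w0 : point -> R) (y : R -> R) a j t :
  L2O Omega w0 ->
  (\forall t \ae leb, t \in `]0, T[ -> L2O Omega (u t) /\ ip Omega (u t) (phi j) = y t) ->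
  t \in `]0, T[ ->
  frac_integral a (fun t => ip Omega (u t - w0) (phi j)) t =
  frac_integral a (fun t => y t - ip Omega w0 (phi j)) t.
Proof.
move=> Lw0 uy; rewrite in_itv/= => /andP[t0 tT]; rewrite /frac_integral; congr (_ * _).
have mt : measurable (time t) by exact: measurable_itv.
rewrite /Rintegral; congr fine; apply: ae_eq_integral_nonmeas => //.
apply: ae_imply uy => x ux; rewrite /= in_itv/= => /andP[x0 xt].
have [|Lu <-] := ux; first by rewrite in_itv/= x0 (lt_trans xt).
congr (_ * _)%:E; exact: (L2ipBl mO Lu Lw0 (eigenfunction_L2 j)).
Qed.

Lemma bochner_Loo_mode (u : R -> point -> R) j : bochner_Loo T (L2O Omega) (nL2 Omega) u ->
  exists2 y : R -> R, measurable_fun (time T) y &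
    (exists M, forall t, `|y t| <= M) /\
    \forall t \ae leb, t \in `]0, T[ -> L2O Omega (u t) /\ ip Omega (u t) (phi j) = y t.
Proof.
move=> bu; apply: (@bochner_Loo_version R (point -> R) T (L2O Omega) (nL2 Omega) (fun v => ip Omega v (phi j)) 1) => //.
- exact: L2_0.
- by move=> a v w Lv Lw; apply: L2D => //; exact: L2Z.
- move=> a v w Lv Lw; have Lp := eigenfunction_L2 j.
  transitivity (ip Omega (a *: v) (phi j) + ip Omega w (phi j)).
    exact: (L2ipDl mO (L2Z mO a Lv) Lw Lp).
  by congr (_ + _); exact: (L2ipZl mO a Lv Lp).
- by move=> v Lv; exact: ip_eigenfunction_le.
Qed.

Lemma L2_Hms_mode (g : R -> (point -> R) -> R) j : L2_Hms Omega T s g ->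
  exists2 y : R -> R, L2 leb (time T) y &
    \forall t \ae leb, t \in `]0, T[ -> g t (phi j) = y t.
Proof.
move=> bg; have [G HG] := phi_H10 j; have [C C0 HC] := Hms_bound oO s0 s1 HG.
have X0 : Hms Omega s 0 by exact: Hms0.
have XD a (v w : (point -> R) -> R) : Hms Omega s v -> Hms Omega s w -> Hms Omega s (a *: v + w).
  exact: HmsD.
have [y Ly Hy] := @bochner_L2_version R ((point -> R) -> R) T (Hms Omega s) (nHms Omega s)
  (fun l => l (phi j)) C X0 XD (fun _ _ _ _ _ => erefl) C0 HC g bg.
by exists y => //; apply: ae_imply Hy => t Ht /Ht[].
Qed.

(** The state equation tested with the eigenfunction [phi j]. Three facts
    make this legitimate: [phi j] belongs to H^s, evaluation at [phi j] is
    continuous on H^-s, so that [t |-> g t (phi j)] is square integrable,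
    and the initial value used in the Caputo derivative agrees with [u0] by
    uniqueness of essential limits. *)
Lemma state_modes : gamma <= 1 -> exists c : R,
  forall (f : R -> (point -> R) -> R) (u0 : point -> R) (u z : R -> point -> R),
    bochner_Loo T (L2O Omega) (nL2 Omega) u ->
    state_equation Omega T s gamma lambda phi f u0 u z ->
    forall j, exists2 y : R -> R,
      mode_solution gamma (lambda j `^ s) c T (ip Omega u0 (phi j))
        (fun t => f t (phi j)) y (fun t => ip Omega (z t) (phi j)) &
      \forall t \ae leb, t \in `]0, T[ -> L2O Omega (u t) /\ ip Omega (u t) (phi j) = y t.
Proof.
move=> gamma1; have [c Hc] := scalar_caputo_rep gamma0 gamma1.
exists c => f u0 u z bu [ini [g0 [Lg0 cap eq]]] j.
have [y my [[M yM] uy]] := bochner_Loo_mode j bu.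
have [g Lg gg] := L2_Hms_mode j Lg0.
have Hphi := eigenfunction_Hs j.
have yini := initial_value_mode uy ini.
exists y => //; split; first by apply: (@bounded_L2 R T M) => // t _.
exists g; split => //.
  apply: (Hc T y g _ T0 my) => //; first by exists M.
  move: cap; rewrite /caputo; case: ifPn => _.
    move=> wd; apply: weak_derivative_ae_eq gg (wd _ Hphi).
    by apply: ae_imply uy => t H /H[].
  move=> [w0 w0ini wd].
  have Lw0 : L2O Omega w0 by case: w0ini.
  rewrite -(ess_lim0_unique T0 (initial_value_mode uy w0ini) yini).
  apply: weak_derivative_ae_eq gg (wd _ Hphi).
  by apply: ae_imply (uy) => t _ tT; exact: (frac_integral_mode (1 - gamma) Lw0 uy tT).
apply: ae_imply3 eq gg uy => t h1 h2 h3 tT.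
by have [_ <-] := h3 tT; rewrite -(h2 tT) -frac_op_eigenfunction; exact: h1.
Qed.

End state_modes.

(** * Time slices of functions on the cylinder *)

Section slices.
Context {R : realType} {n : nat}.
Variable Omega : set 'rV[R]_n.
Hypothesis oO : open Omega.
Variable T : R.
Local Notation point := 'rV[R]_n.
Local Notation mu := (lebesgue_rV R n).
Local Notation leb := (@lebesgue_measure R).
Local Notation nu := (leb \x mu)%E.
Local Notation time T := (`]0, T[%classic : set (measurableTypeR R)).
Local Notation Q := (cylinder Omega T).

Let mO : measurable Omega. Proof. exact: open_measurable_rV. Qed.
Let mT : measurable (time T). Proof. exact: measurable_itv. Qed.

Lemma measurable_cylinder : measurable Q.
Proof. exact: measurableX. Qed.

Lemma measurable_slice d' (Y : measurableType d') (z : R -> point -> Y) t : t \in `]0, T[ ->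
  measurable_fun Q (fun p => z p.1 p.2) -> measurable_fun Omega (z t).
Proof.
move=> tT mz; have mp : measurable_fun Omega (fun x : point => (t : measurableTypeR R, x)).
  by apply: measurable_funTS; exact: pair1_measurable.
apply: (measurable_comp measurable_cylinder _ mz mp).
by move=> _ [x Ox <-].
Qed.

(** Tonelli's theorem for the extension by zero of [G]. *)
Lemma tonelli_cylinder (G : R -> point -> \bar R) :
  measurable_fun Q (fun p => G p.1 p.2) -> (forall t x, 0 <= G t x)%E ->
  measurable_fun (time T) (fun t => \int[mu]_(x in Omega) G t x)%E /\
  (\int[nu]_(p in Q) G p.1 p.2 = \int[leb]_(t in `]0%R, T[) \int[mu]_(x in Omega) G t x)%E.
Proof.
move=> mG G0; pose H := (fun p : measurableTypeR R * point => G p.1 p.2) \_ Q.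
have mH : measurable_fun setT H.
  by move: mG => /(measurable_restrictT _ measurable_cylinder).
have H0 p : (0 <= H p)%E by rewrite /H patchE; case: ifP.
have HE t : (\int[mu]_x H (t, x) = ((fun t => \int[mu]_(x in Omega) G t x)%E \_ (time T)) t)%E.
  rewrite [RHS]patchE; case: ifPn => tT.
    rewrite [RHS]integral_mkcond; apply: eq_integral => x _.
    rewrite /H !patchE (_ : ((t, x) \in Q) = (x \in Omega))//.
    by apply/idP/idP; rewrite !inE; [case|split=> //; move: tT; rewrite inE].
  rewrite integral0_eq// => x _; rewrite /H patchE ifF//.
  by apply/negbTE; apply: contra tT; rewrite !inE => -[].
have mF := measurable_fun_fubini_tonelli_F (m2 := mu) H mH H0.
split.
  have : measurable_fun [set: measurableTypeR R]
      ((fun t => \int[mu]_(x in Omega) G t x)%E \_ (time T)).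
    by rewrite (_ : _ \_ _ = fubini_F mu H)//; apply/funext => t; exact/esym/HE.
  by move=> /(measurable_restrictT _ mT).
rewrite integral_mkcond -/H (fubini_tonelli1 H mH H0) [RHS]integral_mkcond.
by apply: eq_integral => t _; exact: HE.
Qed.

(** The integral over a slice is the difference of the integrals of the
    positive and negative parts, each of which is measurable in time by
    Tonelli's theorem. *)
Lemma measurable_ip_slice (z w : R -> point -> R) :
  measurable_fun Q (fun p => z p.1 p.2) -> measurable_fun Q (fun p => w p.1 p.2) ->
  measurable_fun (time T) (fun t => ip Omega (z t) (w t)).
Proof.
move=> mz mw; have mzw := measurable_funM mz mw.
have mpos : measurable_fun Q (fun p => (Num.max (z p.1 p.2 * w p.1 p.2) 0)%:E).
  by apply/measurable_EFinP; apply: measurable_maxr => //; exact: measurable_cst.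
have mneg : measurable_fun Q (fun p => (Num.max (- (z p.1 p.2 * w p.1 p.2)) 0)%:E).
  apply/measurable_EFinP; apply: measurable_maxr; last exact: measurable_cst.
  exact: measurable_funN.
have h0 (r : R) : (0 <= (Num.max r 0)%:E)%E by rewrite lee_fin le_max lexx orbT.
have [m1 _] := tonelli_cylinder mpos (fun t x => h0 (z t x * w t x)).
have [m2 _] := tonelli_cylinder mneg (fun t x => h0 (- (z t x * w t x))).
apply: (@eq_measurable_fun _ _ _ _ _ (fine \o (fun t =>
   (\int[mu]_(x in Omega) (Num.max (z t x * w t x) 0)%:E) -
   (\int[mu]_(x in Omega) (Num.max (- (z t x * w t x)) 0)%:E))%E)); last first.
  by apply: measurableT_comp => //; exact: emeasurable_funB.
move=> t _; rewrite /ip /Rintegral /=; congr fine; rewrite [RHS]integralE.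
by congr (_ - _)%E; apply: eq_integral => x _; rewrite ?funeposE ?funenegE -?EFinN -EFin_max.
Qed.

Definition L2Qip (z w : R -> point -> R) : R :=
  L2ip nu Q (fun p => z p.1 p.2) (fun p => w p.1 p.2).

Lemma L2Q_sqr z : L2Q Omega T z ->
  (\int[nu]_(p in Q) ((z p.1 p.2) ^+ 2)%:E = (L2Qip z z)%:E)%E.
Proof. by move=> Lz; exact: (L2ip_sqr measurable_cylinder Lz). Qed.

Lemma L2Q_slice z : L2Q Omega T z ->
  \forall t \ae leb, t \in `]0, T[ -> L2O Omega (z t).
Proof.
move=> [mz zoo].
have msq : measurable_fun Q (fun p => ((z p.1 p.2) ^+ 2)%:E).
  by apply/measurable_EFinP; exact: measurable_funX.
have h0 t x : (0 <= ((z t x) ^+ 2)%:E)%E by rewrite lee_fin sqr_ge0.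
have [mF FE] := tonelli_cylinder msq h0.
have : leb.-integrable (time T) (fun t => \int[mu]_(x in Omega) ((z t x) ^+ 2)%:E)%E.
  apply/integrableP; split => //.
  have -> : (\int[leb]_(t in `]0%R, T[) `| \int[mu]_(x in Omega) ((z t x) ^+ 2)%:E | =
     \int[nu]_(p in Q) ((z p.1 p.2) ^+ 2)%:E)%E.
    by rewrite FE; apply: eq_integral => t _; rewrite gee0_abs// integral_ge0.
  exact: zoo.
move=> /(integrable_ae mT); apply: ae_imply => t H tT; split; first exact: measurable_slice mz.
by have := H tT; rewrite ge0_fin_numE// integral_ge0.
Qed.

Lemma L2Q_integral z : L2Q Omega T z ->
  (\int[leb]_(t in `]0%R, T[) (ip Omega (z t) (z t))%:E = (L2Qip z z)%:E)%E.
Proof.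
move=> Lz; rewrite -(L2Q_sqr Lz); have [mz zoo] := Lz.
have msq : measurable_fun Q (fun p => ((z p.1 p.2) ^+ 2)%:E).
  by apply/measurable_EFinP; exact: measurable_funX.
have h0 t x : (0 <= ((z t x) ^+ 2)%:E)%E by rewrite lee_fin sqr_ge0.
have [mF ->] := tonelli_cylinder msq h0.
apply: ae_eq_integral_nonmeas => //; apply: ae_imply (L2Q_slice Lz) => t H tT.
by rewrite (L2ip_sqr mO (H tT)).
Qed.

Lemma L2QB z w : L2Q Omega T z -> L2Q Omega T w -> L2Q Omega T (z - w).
Proof. by move=> Lz Lw; have := L2B measurable_cylinder Lz Lw. Qed.

End slices.

(** * The misfit as a supremum over modes *)

Section misfit.
Context {R : realType} {n : nat}.
Variable Omega : set 'rV[R]_n.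
Hypothesis oO : open Omega.
Variable T : R.
Local Notation point := 'rV[R]_n.
Local Notation mu := (lebesgue_rV R n).
Local Notation leb := (@lebesgue_measure R).
Local Notation nu := (leb \x mu)%E.
Local Notation time T := (`]0, T[%classic : set (measurableTypeR R)).
Local Notation Q := (cylinder Omega T).

Let mO : measurable Omega. Proof. exact: open_measurable_rV. Qed.
Let mT : measurable (time T). Proof. exact: measurable_itv. Qed.

Variable phi : nat -> point -> R.
Hypothesis Lphi : forall k, L2O Omega (phi k).
Hypothesis phi_orth : forall j k, ip Omega (phi j) (phi k) = (j == k)%:R.
Hypothesis phi_basis : forall w, L2O Omega w ->
  (fun N => nL2 Omega (w - \sum_(k < N) ip Omega w (phi k) *: phi k)) @ \oo --> (0 : R).

Variable ud : R -> point -> R.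
Hypothesis Lud : L2Q Omega T ud.

Definition has_modes (u : R -> point -> R) (y : nat -> R -> R) : Prop :=
  (forall j, measurable_fun (time T) (y j)) /\
  forall j, \forall t \ae leb, t \in `]0, T[ -> L2O Omega (u t) /\ ip Omega (u t) (phi j) = y j t.

Definition misfit (u : R -> point -> R) : \bar R :=
  (\int[leb]_(t in `]0%R, T[) (nL2 Omega (u t - ud t)%R ^+ 2)%:E)%E.

Definition modal_misfit (y : nat -> R -> R) (N : nat) (t : R) : R :=
  \sum_(k < N) (y k t - ip Omega (ud t) (phi k)) ^+ 2.

Lemma modal_misfit_ge0 y N t : 0 <= modal_misfit y N t.
Proof. by apply: sumr_ge0 => k _; exact: sqr_ge0. Qed.

Lemma measurable_modal_misfit y N : (forall j, measurable_fun (time T) (y j)) ->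
  measurable_fun (time T) (modal_misfit y N).
Proof.
move=> my; apply: measurable_sum => k; apply: measurable_funX; apply: measurable_funB => //.
apply: measurable_ip_slice => //; first by case: Lud.
have mp : measurable_fun Q (fun p : measurableTypeR R * point => p.2).
  by apply: measurable_funTS; exact: measurable_snd.
apply: (measurable_comp mO _ (Lphi k).1 mp).
by move=> _ [p [_ Op] <-].
Qed.

Lemma modal_misfit_nd y t : nondecreasing_seq (fun N => (modal_misfit y N t)%:E).
Proof.
apply/nondecreasing_seqP => N; rewrite lee_fin /modal_misfit big_ord_recr/=.
by rewrite lerDl sqr_ge0.
Qed.

Lemma ae_modes u y : has_modes u y -> \forall t \ae leb, t \in `]0, T[ ->
  [/\ L2O Omega (u t), forall j, ip Omega (u t) (phi j) = y j t & L2O Omega (ud t)].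
Proof.
move=> [_ uy]; have := ae_imply2 (fun t => @conj _ _) (ae_foralln uy) (L2Q_slice oO Lud).
apply: ae_imply => t [H1 H2] tT; split; [|by move=> j; have [] := H1 j tT|exact: H2].
by have [] := H1 0%N tT.
Qed.

(** Parseval's identity for [u t - ud t] at almost every time. *)
Lemma modal_misfit_cvg u y : has_modes u y -> \forall t \ae leb, t \in `]0, T[ ->
  (fun N => modal_misfit y N t) @ \oo --> nL2 Omega (u t - ud t) ^+ 2 /\
  forall N, modal_misfit y N t <= nL2 Omega (u t - ud t) ^+ 2.
Proof.
move=> /ae_modes; apply: ae_imply => t H tT; have [Lu uy Ld] := H tT.
have Lw := L2B mO Lu Ld.
have E N : modal_misfit y N t = \sum_(k < N) L2ip mu Omega (u t - ud t) (phi k) ^+ 2.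
  apply: eq_bigr => k _; congr (_ ^+ 2); rewrite -uy.
  by apply/esym; exact: (L2ipBl mO Lu Ld (Lphi k)).
rewrite nL2_sqr; split; last by move=> N; rewrite E; exact: bessel.
rewrite (_ : (fun N => _) = (fun N => \sum_(k < N) L2ip mu Omega (u t - ud t) (phi k) ^+ 2)); last first.
  by apply/funext => N; exact: E.
apply: (parseval mO Lphi phi_orth Lw).
exact: (phi_basis Lw).
Qed.

Let lim_misfit (y : nat -> R -> R) t : \bar R := limn (fun N => (modal_misfit y N t)%:E).

Let lim_misfit_cvg y t : (fun N => (modal_misfit y N t)%:E) @ \oo --> lim_misfit y t.
Proof. exact/ereal_nondecreasing_is_cvgn/modal_misfit_nd. Qed.

Let lim_misfit_ge0 y t : (0 <= lim_misfit y t)%E.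
Proof.
apply: lime_ge; first exact/ereal_nondecreasing_is_cvgn/modal_misfit_nd.
by apply: nearW => N; rewrite lee_fin modal_misfit_ge0.
Qed.

Let measurable_lim_misfit y : (forall j, measurable_fun (time T) (y j)) ->
  measurable_fun (time T) (lim_misfit y).
Proof.
move=> my; apply: (emeasurable_fun_cvg (fun N t => (modal_misfit y N t)%:E)).
  by move=> N; apply/measurable_EFinP; exact: measurable_modal_misfit.
by move=> t _; exact: lim_misfit_cvg.
Qed.

Let lim_misfitE u y : has_modes u y -> \forall t \ae leb, t \in `]0, T[ ->
  (nL2 Omega (u t - ud t)%R ^+ 2)%:E = lim_misfit y t.
Proof.
move=> /modal_misfit_cvg; apply: ae_imply => t H tT; have [c _] := H tT.
by apply/esym/cvg_lim => //; apply: cvg_EFin => //; apply: nearW.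
Qed.

Lemma modal_misfit_le u y N : has_modes u y ->
  (\int[leb]_(t in `]0%R, T[) (modal_misfit y N t)%:E <= misfit u)%E.
Proof.
move=> uy; apply: ge0_ae_le_integral_nonmeas => //.
- by move=> t _; rewrite lee_fin modal_misfit_ge0.
- by move=> t _; rewrite lee_fin sqr_ge0.
- by apply: ae_imply (modal_misfit_cvg uy) => t H tT; rewrite lee_fin; have [_] := H tT; apply.
Qed.

(** By Parseval's identity and monotone convergence the misfit is the
    supremum of the integrals of the partial sums. This turns mode-by-mode
    convergence of states into lower semicontinuity of the misfit. *)
Lemma misfit_le u y (K : \bar R) : has_modes u y ->
  (forall N, \int[leb]_(t in `]0%R, T[) (modal_misfit y N t)%:E <= K)%E ->
  (misfit u <= K)%E.
Proof.
move=> uy HK; rewrite /misfit (_ : (\int[leb]_(t in _) _ = \int[leb]_(t in `]0%R, T[) lim_misfit y t)%E); last first.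
  by apply: ae_eq_integral_nonmeas => //; exact: lim_misfitE.
rewrite (@monotone_convergence _ _ _ leb (time T) mT (fun N t => (modal_misfit y N t)%:E)); last 3 first.
- by move=> N; apply/measurable_EFinP; apply: measurable_modal_misfit; case: uy.
- by move=> N t _; rewrite lee_fin modal_misfit_ge0.
- by move=> t _; exact: modal_misfit_nd.
apply: lime_le; last by apply: nearW => N; exact: HK.
apply: ereal_nondecreasing_is_cvgn => N N' NN'.
apply: ge0_le_integral_nonmeas => t _; first by rewrite lee_fin modal_misfit_ge0.
exact: modal_misfit_nd.
Qed.

Lemma misfit_ge0 u : (0 <= misfit u)%E.
Proof. by apply: integral_ge0 => t _; rewrite lee_fin sqr_ge0. Qed.

Lemma misfit_lty u y : has_modes u y -> bochner_Loo T (L2O Omega) (nL2 Omega) u ->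
  (misfit u < +oo)%E.
Proof.
move=> uy [_ [M uM]].
pose B t := ip Omega (ud t) (ud t).
have mB : measurable_fun (time T) B by apply: measurable_ip_slice => //; case: Lud.
have B0 t : 0 <= B t by exact: L2ip_ge0.
apply: (@le_lt_trans _ _ (\int[leb]_(t in `]0%R, T[) ((2 * M ^+ 2)%:E + 2%:E * (B t)%:E))%E).
  apply: ge0_ae_le_integral_nonmeas => //.
  - by move=> t _; rewrite lee_fin sqr_ge0.
  - by move=> t _; rewrite -EFinM -EFinD lee_fin addr_ge0// mulr_ge0// sqr_ge0.
  - apply: ae_imply2 uM (ae_modes uy) => t H1 H2 tT; have [Lu _ Ld] := H2 tT.
    rewrite -EFinM -EFinD lee_fin nL2_sqr.
    apply: le_trans (L2ip_sqrB_le mO Lu Ld) _; rewrite lerD2r ler_wpM2l// -nL2_sqr.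
    apply: lerXn2r; rewrite ?nnegrE ?nL2_ge0//; last exact: H1.
    by apply: le_trans (H1 tT); exact: nL2_ge0.
rewrite ge0_integralD//; last 3 first.
- by move=> t _; rewrite lee_fin mulr_ge0// sqr_ge0.
- by move=> t _; rewrite -EFinM lee_fin mulr_ge0.
- by apply: measurable_funeM; exact/measurable_EFinP.
rewrite integral_cst// ge0_integralZl//; last 2 first.
- exact/measurable_EFinP.
- by move=> t _; rewrite lee_fin.
rewrite (L2Q_integral oO Lud) -EFinM lte_add_pinfty ?ltry//.
apply: lte_mul_pinfty; rewrite ?lee_fin//; first by apply: mulr_ge0 => //; exact: sqr_ge0.
have lT : (leb `]0%R, T[%classic < +oo)%E by rewrite lebesgue_measure_itv/=; case: ifPn => // _; rewrite sube0 ltry.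
exact: lT.
Qed.

(** The misfit integrand is almost everywhere a limit of Borel functions,
    which is what additivity of the integral requires. *)
Lemma costE m u y z : 0 <= m -> has_modes u y -> L2Q Omega T z ->
  cost Omega T m ud u z = ((2^-1)%:E * (misfit u + (m * L2Qip Omega T z z)%:E))%E.
Proof.
move=> m0 uy Lz; rewrite /cost; congr (_ * _)%E.
pose B t := ip Omega (z t) (z t).
have mB : measurable_fun (time T) B by apply: measurable_ip_slice => //; case: Lz.
have B0 t : 0 <= B t by exact: L2ip_ge0.
transitivity (\int[leb]_(t in `]0%R, T[) (lim_misfit y t + m%:E * (B t)%:E))%E.
  apply: ae_eq_integral_nonmeas => //; apply: ae_imply (lim_misfitE uy) => t H tT.
  have -> : nL2 Omega (z t) ^+ 2 = B t by rewrite nL2_sqr.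
  exact: (congr1 (fun r => (r + (m * B t)%:E)%E) (H tT)).
rewrite ge0_integralD//; last 3 first.
- by apply: measurable_lim_misfit; case: uy.
- by move=> t _; rewrite -EFinM lee_fin mulr_ge0.
- by apply: measurable_funeM; exact/measurable_EFinP.
rewrite ge0_integralZl//; last 2 first.
- exact/measurable_EFinP.
- by move=> t _; rewrite lee_fin.
rewrite (L2Q_integral oO Lz) -EFinM; congr (_ + _)%E.
by apply/esym; apply: ae_eq_integral_nonmeas => //; exact: lim_misfitE.
Qed.

End misfit.

(** * Minimization of the strictly convex cost *)

Section L2_identities.
Context d (X : measurableType d) (R : realType).
Variable mu : {measure set X -> \bar R}.
Variable D : set X.
Hypothesis mD : measurable D.
Local Notation L2ip := (L2ip mu D).

Lemma L2ip_midpoint f g : L2 mu D f -> L2 mu D g ->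
  L2ip (2^-1 *: f + 2^-1 *: g) (2^-1 *: f + 2^-1 *: g) =
  2^-1 * (L2ip f f + L2ip g g) - 4^-1 * L2ip (f - g) (f - g).
Proof.
move=> Lf Lg; have Lf2 := L2Z mD 2^-1 Lf; have Lg2 := L2Z mD 2^-1 Lg.
have Lm := L2D mD Lf2 Lg2.
rewrite (L2ipDl mD Lf2 Lg2 Lm) (L2ipZl mD 2^-1 Lf Lm) (L2ipZl mD 2^-1 Lg Lm).
rewrite !(L2ipC mu D _ (_ + _)) !(L2ipDl mD Lf2 Lg2)//.
rewrite (L2ipZl mD _ Lf Lf) (L2ipZl mD _ Lg Lf) (L2ipZl mD _ Lf Lg) (L2ipZl mD _ Lg Lg).
by rewrite (L2ip_sqrB mD Lf Lg) (L2ipC mu D g f); field.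
Qed.

(** The difference of the two members is [e^-1 |f - (1 + e) g|^2]. *)
Lemma L2ip_young (e : R) f g : 0 < e -> L2 mu D f -> L2 mu D g ->
  L2ip f f <= (1 + e) * L2ip g g + (1 + e^-1) * L2ip (f - g) (f - g).
Proof.
move=> e0 Lf Lg; have Lg2 := L2Z mD (1 + e) Lg.
have := L2ip_ge0 mu D (f - (1 + e) *: g).
rewrite (L2ip_sqrB mD Lf Lg2) (L2ip_sqrZ mD _ Lg) (L2ipC mu D f) (L2ipZl mD _ Lg Lf).
rewrite (L2ip_sqrB mD Lf Lg) (L2ipC mu D f g) => H.
rewrite -subr_ge0.
have -> : (1 + e) * L2ip g g + (1 + e^-1) * (L2ip f f - 2 * L2ip g f + L2ip g g) - L2ip f f =
  e^-1 * (L2ip f f - 2 * ((1 + e) * L2ip g f) + (1 + e) ^+ 2 * L2ip g g).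
  by field; rewrite gt_eqF.
by rewrite mulr_ge0// invr_ge0 ltW.
Qed.

End L2_identities.

Section minimization.
Context {R : realType} {n : nat}.
Variable Omega : set 'rV[R]_n.
Hypothesis oO : open Omega.
Variable T : R.
Hypothesis T0 : 0 < T.
Local Notation point := 'rV[R]_n.
Local Notation mu := (lebesgue_rV R n).
Local Notation leb := (@lebesgue_measure R).
Local Notation nu := (leb \x mu)%E.
Local Notation time T := (`]0, T[%classic : set (measurableTypeR R)).
Local Notation Q := (cylinder Omega T).
Local Notation traj := (R -> point -> R).

Let mO : measurable Omega. Proof. exact: open_measurable_rV. Qed.
Let mT : measurable (time T). Proof. exact: measurable_itv. Qed.
Let mQ : measurable Q. Proof. exact: measurable_cylinder. Qed.

Variable phi : nat -> point -> R.
Hypothesis Lphi : forall k, L2O Omega (phi k).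
Hypothesis phi_orth : forall j k, ip Omega (phi j) (phi k) = (j == k)%:R.
Hypothesis phi_basis : forall w, L2O Omega w ->
  (fun N => nL2 Omega (w - \sum_(k < N) ip Omega w (phi k) *: phi k)) @ \oo --> (0 : R).

Variables (ud a b : traj) (m : R).
Hypothesis Lud : L2Q Omega T ud.
Hypothesis m0 : 0 < m.
Variables (gm c : R) (lam y0 : nat -> R) (F : nat -> R -> R).
Hypothesis gm0 : 0 < gm.

Local Notation solves j := (mode_solution gm (lam j) c T (y0 j) (F j)).

Variable feas : traj -> traj -> Prop.
Hypothesis feas_Zad : forall u z, feas u z -> Zad Omega T a b z.
Hypothesis feas_Loo : forall u z, feas u z -> bochner_Loo T (L2O Omega) (nL2 Omega) u.
Hypothesis feas_state : forall z, Zad Omega T a b z -> exists u, feas u z.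
Hypothesis feas_modes : forall u z, feas u z -> forall j, exists2 y : R -> R,
  solves j y (fun t => ip Omega (z t) (phi j)) &
  \forall t \ae leb, t \in `]0, T[ -> L2O Omega (u t) /\ ip Omega (u t) (phi j) = y t.

Let feas_L2 u z : feas u z -> L2Q Omega T z.
Proof. by move=> /feas_Zad[]. Qed.

Lemma feasible_modes u z : feas u z -> exists2 y : nat -> R -> R, has_modes Omega T phi u y &
  forall j, solves j (y j) (fun t => ip Omega (z t) (phi j)).
Proof.
move=> /feas_modes H; have /choice[y Hy] : forall j, exists y : R -> R,
    solves j y (fun t => ip Omega (z t) (phi j)) /\
    \forall t \ae leb, t \in `]0, T[ -> L2O Omega (u t) /\ ip Omega (u t) (phi j) = y t.
  by move=> j; have [y ? ?] := H j; exists y.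
exists y; last by move=> j; have [] := Hy j.
by split=> j; have [[[my _] _] uy] := Hy j.
Qed.

Definition dist2 (z z' : traj) : R := L2Qip Omega T (z - z') (z - z').

Lemma dist2_ge0 z z' : 0 <= dist2 z z'. Proof. exact: L2ip_ge0. Qed.

Lemma control_mode_dist z z' j : L2Q Omega T z -> L2Q Omega T z' ->
  (\int[leb]_(t in `]0%R, T[) ((ip Omega (z t) (phi j) - ip Omega (z' t) (phi j)) ^+ 2)%:E <=
   (dist2 z z')%:E)%E.
Proof.
move=> Lz Lz'; rewrite -(L2Q_integral oO (L2QB oO Lz Lz')).
apply: ge0_ae_le_integral_nonmeas => //.
- by move=> t _; rewrite lee_fin sqr_ge0.
- by move=> t _; rewrite lee_fin L2ip_ge0.
apply: ae_imply2 (L2Q_slice oO Lz) (L2Q_slice oO Lz') => t H H' tT.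
have {}H := H tT; have {}H' := H' tT.
have -> : ip Omega (z t) (phi j) - ip Omega (z' t) (phi j) = ip Omega (z t - z' t) (phi j).
  by apply/esym; exact: (L2ipBl mO H H' (Lphi j)).
rewrite lee_fin; have := L2_cauchy_schwarz mO (L2B mO H H') (Lphi j).
have -> : L2ip mu Omega (phi j) (phi j) = 1 by have := phi_orth j j; rewrite eqxx.
by rewrite mulr1.
Qed.

(** The constant may depend on [j] because modes are summed over finite
    ranges before passing to the supremum. *)
Lemma mode_dist j : exists2 C : R, 0 <= C & forall z z' y y',
  L2Q Omega T z -> L2Q Omega T z' ->
  solves j y (fun t => ip Omega (z t) (phi j)) ->
  solves j y' (fun t => ip Omega (z' t) (phi j)) ->
  (\int[leb]_(t in `]0%R, T[) ((y t - y' t) ^+ 2)%:E <= (C * dist2 z z')%:E)%E.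
Proof.
have [C C0 HC] := mode_solution_estimate (lam j) c (y0 j) (F j) gm0 T0.
exists C => // z z' y y' Lz Lz' sy sy'; apply: le_trans (HC _ _ _ _ sy sy') _.
by rewrite EFinM lee_wpmul2l ?lee_fin//; exact: control_mode_dist.
Qed.

(** The cost of a feasible pair, as a real number. *)
Definition cost_value (u z : traj) : R :=
  2^-1 * (fine (misfit Omega T ud u) + m * L2Qip Omega T z z).

Let misfit_fin u z : feas u z -> misfit Omega T ud u = (fine (misfit Omega T ud u))%:E.
Proof.
move=> uz; have [y uy _] := feasible_modes uz; rewrite fineK// ge0_fin_numE ?misfit_ge0//.
exact: (misfit_lty oO Lud uy (feas_Loo uz)).
Qed.

Lemma cost_valueE u z : feas u z -> cost Omega T m ud u z = (cost_value u z)%:E.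
Proof.
move=> uz; have [y uy _] := feasible_modes uz.
rewrite (costE oO Lphi phi_orth phi_basis Lud (ltW m0) uy (feas_L2 uz)).
by rewrite (misfit_fin uz) -EFinD -EFinM.
Qed.

Lemma cost_value_ge0 u z : 0 <= cost_value u z.
Proof.
rewrite mulr_ge0 ?invr_ge0// addr_ge0// ?fine_ge0 ?misfit_ge0//.
by rewrite mulr_ge0 ?L2ip_ge0// ltW.
Qed.

Definition midpoint (z z' : traj) : traj := fun t => 2^-1 *: z t + 2^-1 *: z' t.

Lemma Zad_midpoint z z' : Zad Omega T a b z -> Zad Omega T a b z' ->
  Zad Omega T a b (midpoint z z').
Proof.
move=> [Lz az] [Lz' az']; split.
  exact: (L2D mQ (L2Z mQ 2^-1 Lz) (L2Z mQ 2^-1 Lz')).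
apply: ae_imply2 az az' => p H H' Qp; have {}H := H Qp; have {}H' := H' Qp.
have -> : midpoint z z' p.1 p.2 = 2^-1 * z p.1 p.2 + 2^-1 * z' p.1 p.2 by [].
by lra.
Qed.

(** Each mode is affine in the control, by uniqueness for the scalar
    equation, so the misfit is convex by Parseval's identity; the control
    term contributes the parallelogram identity. *)
Lemma cost_value_midpoint u z u' z' : feas u z -> feas u' z' -> exists u'' z'', feas u'' z'' /\
  cost_value u'' z'' <= 2^-1 * (cost_value u z + cost_value u' z') - m / 8 * dist2 z z'.
Proof.
move=> uz uz'; have Zm := Zad_midpoint (feas_Zad uz) (feas_Zad uz').
have [u'' uz''] := feas_state Zm; exists u'', (midpoint z z'); split=> //.
have Lz := feas_L2 uz; have Lz' := feas_L2 uz'.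
have [y uy sy] := feasible_modes uz; have [y' uy' sy'] := feasible_modes uz'.
have [y'' uy'' sy''] := feasible_modes uz''.
have ymid j : \forall t \ae leb, t \in `]0, T[ -> y'' j t = 2^-1 * y j t + 2^-1 * y' j t.
  have smid := mode_solution_mid gm0 T0 (sy j) (sy' j).
  apply: (mode_solution_unique gm0 T0 (sy'' j) smid).
  set I := (\int[_]_(_ in _) _)%E; suff -> : I = (\int[leb]_(t in `]0%R, T[) 0)%E by rewrite integral0.
  apply: ae_eq_integral_nonmeas => //.
  apply: ae_imply2 (L2Q_slice oO Lz) (L2Q_slice oO Lz') => t H H' tT.
  have {}H := H tT; have {}H' := H' tT.
  rewrite (_ : ip Omega (midpoint z z' t) (phi j) = 2^-1 * ip Omega (z t) (phi j) + 2^-1 * ip Omega (z' t) (phi j)).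
    by rewrite subrr expr0n.
  transitivity (ip Omega (2^-1 *: z t) (phi j) + ip Omega (2^-1 *: z' t) (phi j)).
    exact: (L2ipDl mO (L2Z mO 2^-1 H) (L2Z mO 2^-1 H') (Lphi j)).
  by congr (_ + _); [exact: (L2ipZl mO 2^-1 H (Lphi j))|exact: (L2ipZl mO 2^-1 H' (Lphi j))].
have mis : (misfit Omega T ud u'' <=
    (2^-1)%:E * misfit Omega T ud u + (2^-1)%:E * misfit Omega T ud u')%E.
  apply: (misfit_le oO Lphi phi_orth phi_basis Lud uy'') => N.
  have mmy := measurable_modal_misfit oO Lphi Lud N uy.1.
  have mmy' := measurable_modal_misfit oO Lphi Lud N uy'.1.
  apply: (@le_trans _ _ (\int[leb]_(t in `]0%R, T[)
     ((2^-1)%:E * (modal_misfit Omega phi ud y N t)%:E +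
      (2^-1)%:E * (modal_misfit Omega phi ud y' N t)%:E))%E).
    apply: ge0_ae_le_integral_nonmeas => //.
    - by move=> t _; rewrite lee_fin modal_misfit_ge0.
    - by move=> t _; rewrite -!EFinM -EFinD lee_fin addr_ge0// mulr_ge0// ?invr_ge0// modal_misfit_ge0.
    apply: ae_imply (ae_foralln ymid) => t H tT.
    rewrite -!EFinM -EFinD lee_fin /modal_misfit !mulr_sumr -big_split/=.
    apply: ler_sum => k _; rewrite H//; set p := y k t; set q := y' k t; set d := ip _ _ _.
    rewrite -subr_ge0.
    have -> : 2^-1 * (p - d) ^+ 2 + 2^-1 * (q - d) ^+ 2 - (2^-1 * p + 2^-1 * q - d) ^+ 2 =
        4^-1 * (p - q) ^+ 2 by field.
    by apply: mulr_ge0; rewrite ?invr_ge0 ?sqr_ge0.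
  rewrite ge0_integralD//; last 4 first.
  - by move=> t _; rewrite -EFinM lee_fin mulr_ge0// ?invr_ge0// modal_misfit_ge0.
  - by apply: measurable_funeM; exact/measurable_EFinP.
  - by move=> t _; rewrite -EFinM lee_fin mulr_ge0// ?invr_ge0// modal_misfit_ge0.
  - by apply: measurable_funeM; exact/measurable_EFinP.
  have Z (v : nat -> R -> R) : measurable_fun (time T) (modal_misfit Omega phi ud v N) ->
      (\int[leb]_(t in `]0%R, T[) ((2^-1)%:E * (modal_misfit Omega phi ud v N t)%:E) =
       (2^-1)%:E * \int[leb]_(t in `]0%R, T[) (modal_misfit Omega phi ud v N t)%:E)%E.
    move=> mv; rewrite ge0_integralZl//; first exact/measurable_EFinP.
    by move=> t _; rewrite lee_fin modal_misfit_ge0.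
  rewrite (Z _ mmy) (Z _ mmy').
  apply: leeD; (apply: lee_wpmul2l; first by rewrite lee_fin invr_ge0).
    exact: modal_misfit_le uy.
  exact: modal_misfit_le uy'.
have mid : L2Qip Omega T (midpoint z z') (midpoint z z') =
    2^-1 * (L2Qip Omega T z z + L2Qip Omega T z' z') - 4^-1 * dist2 z z'.
  exact: (L2ip_midpoint mQ Lz Lz').
have alg (A B C : \bar R) (A' B' C' P P' D : R) : A = A'%:E -> B = B'%:E -> C = C'%:E ->
    (A <= (2^-1)%:E * B + (2^-1)%:E * C)%E ->
    2^-1 * (A' + m * (2^-1 * (P + P') - 4^-1 * D)) <=
    2^-1 * (2^-1 * (B' + m * P) + 2^-1 * (C' + m * P')) - m / 8 * D.
  move=> -> -> ->; rewrite -!EFinM -EFinD lee_fin => h.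
  rewrite -subr_ge0 (_ : _ - _ = 2^-1 * (2^-1 * B' + 2^-1 * C' - A')); last by field.
  by apply: mulr_ge0; rewrite ?invr_ge0 ?subr_ge0.
rewrite /cost_value mid.
exact: (alg _ _ _ _ _ _ _ _ _ (misfit_fin uz'') (misfit_fin uz) (misfit_fin uz') mis).
Qed.

Definition cost_values : set R := [set r | exists u z, feas u z /\ r = cost_value u z].

Hypothesis feas_ex : exists u z, feas u z.

Let has_inf_cost_values : has_inf cost_values.
Proof.
split; first by have [u [z uz]] := feas_ex; exists (cost_value u z), u, z.
by exists 0 => _ [u [z [_ ->]]]; exact: cost_value_ge0.
Qed.

Lemma inf_cost_value_le u z : feas u z -> inf cost_values <= cost_value u z.
Proof. by move=> uz; apply: ge_inf; [have [] := has_inf_cost_values|exists u, z]. Qed.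

(** The cost of the midpoint is at least the infimum. *)
Lemma near_optimal_close (e e' : R) u z u' z' : feas u z -> feas u' z' ->
  cost_value u z <= inf cost_values + m / 8 * e -> cost_value u' z' <= inf cost_values + m / 8 * e' ->
  dist2 z z' <= 2^-1 * (e + e').
Proof.
move=> uz uz' Je Je'; have [u'' [z'' [uz'' mid]]] := cost_value_midpoint uz uz'.
have := le_trans (inf_cost_value_le uz'') mid => h.
have m8 : 0 < m / 8 by rewrite divr_gt0.
by rewrite -(ler_pM2l m8); lra.
Qed.

(** The constraints are pointwise inequalities, hence pass to almost
    everywhere limits. *)
Lemma Zad_cvg (zk : nat -> traj) (w : measurableTypeR R * point -> R) :
  (forall k, Zad Omega T a b (zk k)) -> L2 nu Q w ->
  (\forall p \ae nu, Q p -> (fun k => zk k p.1 p.2) @ \oo --> w p) ->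
  Zad Omega T a b (fun t x => w (t, x)).
Proof.
move=> zk_ad Lw cw; split.
  have E : (fun p : measurableTypeR R * point => w (p.1, p.2)) = w.
    by apply/funext => -[].
  by move: Lw; rewrite -[X in L2 nu Q X -> _]E.
apply: ae_imply2 cw (ae_foralln (fun k => (zk_ad k).2)) => -[t x] cp H Qp.
have {}cp := cp Qp; have {}H k := H k Qp.
have cvp : cvgn (fun k => zk k t x) by apply/cvg_ex; exists (w (t, x)).
have wE : w (t, x) = limn (fun k => zk k t x) by apply/esym/cvg_lim.
rewrite /= wE; apply/andP; split.
- by apply: limr_ge => //; apply: nearW => k; have /andP[] := H k.
- by apply: limr_le => //; apply: nearW => k; have /andP[] := H k.
Qed.

Lemma modal_misfit_young (y y' : nat -> R -> R) (e : R) N t : 0 < e ->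
  modal_misfit Omega phi ud y N t <=
  (1 + e) * modal_misfit Omega phi ud y' N t + (1 + e^-1) * \sum_(j < N) (y j t - y' j t) ^+ 2.
Proof.
move=> e0; rewrite /modal_misfit !mulr_sumr -big_split/=; apply: ler_sum => j _.
set p := y j t; set q := y' j t; set d := ip _ _ _.
rewrite -subr_ge0.
have -> : (1 + e) * (q - d) ^+ 2 + (1 + e^-1) * (p - q) ^+ 2 - (p - d) ^+ 2 =
    e^-1 * (p - q - e * (q - d)) ^+ 2 by field; rewrite gt_eqF.
by apply: mulr_ge0; rewrite ?invr_ge0 ?sqr_ge0// ltW.
Qed.

(** Young's inequality with parameter [e] keeps the constant in front of the
    misfit of [u'] close to one; the price [1 + e^-1] only concerns the
    distance of the controls. *)
Lemma modal_misfit_dist (N : nat) : exists2 C : R, 0 <= C & forall u z y u' z' (e : R), 0 < e ->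
  feas u z -> feas u' z' -> has_modes Omega T phi u y ->
  (forall j, solves j (y j) (fun t => ip Omega (z t) (phi j))) ->
  (\int[leb]_(t in `]0%R, T[) (modal_misfit Omega phi ud y N t)%:E <=
   (1 + e)%:E * misfit Omega T ud u' + ((1 + e^-1) * (C * dist2 z z'))%:E)%E.
Proof.
have /choice[C HC] : forall j, exists C : R, 0 <= C /\ forall z z' y y',
    L2Q Omega T z -> L2Q Omega T z' ->
    solves j y (fun t => ip Omega (z t) (phi j)) ->
    solves j y' (fun t => ip Omega (z' t) (phi j)) ->
    (\int[leb]_(t in `]0%R, T[) ((y t - y' t) ^+ 2)%:E <= (C * dist2 z z')%:E)%E.
  by move=> j; have [C ? ?] := mode_dist j; exists C.
exists (\sum_(j < N) C j); first by apply: sumr_ge0 => j _; have [] := HC j.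
move=> u z y u' z' e e0 uz uz' uy sy.
have Lz := feas_L2 uz; have Lz' := feas_L2 uz'.
have [y' uy' sy'] := feasible_modes uz'.
have mmy' := measurable_modal_misfit oO Lphi Lud N uy'.1.
have e10 : 0 <= 1 + e by rewrite addr_ge0// ltW.
have e20 : 0 <= 1 + e^-1 by rewrite addr_ge0// invr_ge0 ltW.
have mdj (j : nat) : measurable_fun (time T) (fun t => (y j t - y' j t) ^+ 2).
  apply: measurable_funX; apply: measurable_funB; [exact: uy.1|exact: uy'.1].
have md : measurable_fun (time T) (fun t => \sum_(j < N) (y j t - y' j t) ^+ 2).
  by apply: measurable_sum => j; exact: mdj.
have d0 t : 0 <= \sum_(j < N) (y j t - y' j t) ^+ 2.
  by apply: sumr_ge0 => j _; exact: sqr_ge0.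
have mm0 t := modal_misfit_ge0 Omega phi ud y' N t.
apply: (@le_trans _ _ (\int[leb]_(t in `]0%R, T[)
   ((1 + e)%:E * (modal_misfit Omega phi ud y' N t)%:E +
    (1 + e^-1)%:E * (\sum_(j < N) (y j t - y' j t) ^+ 2)%:E))%E).
  apply: ge0_le_integral_nonmeas => t _; first by rewrite lee_fin modal_misfit_ge0.
  by rewrite -!EFinM -EFinD lee_fin; exact: modal_misfit_young.
rewrite ge0_integralD; [|exact: mT|..]; last 4 first.
- by move=> t _; rewrite -EFinM lee_fin mulr_ge0.
- by apply: measurable_funeM; exact/measurable_EFinP.
- by move=> t _; rewrite -EFinM lee_fin mulr_ge0.
- by apply: measurable_funeM; exact/measurable_EFinP.
rewrite ge0_integralZl; [|exact: mT|exact/measurable_EFinP|by move=> t _; rewrite lee_fin|by []].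
rewrite ge0_integralZl; [|exact: mT|exact/measurable_EFinP|by move=> t _; rewrite lee_fin|by []].
apply: leeD.
  by apply: lee_wpmul2l; [rewrite lee_fin|exact: modal_misfit_le uy'].
rewrite EFinM; apply: lee_wpmul2l; first by rewrite lee_fin.
rewrite mulr_suml -sumEFin.
under eq_integral do rewrite -sumEFin.
rewrite ge0_integral_sum//; last 2 first.
- by move=> j; exact/measurable_EFinP.
- by move=> j t _; rewrite lee_fin sqr_ge0.
by apply: lee_sum => j _; have [_] := HC j; apply.
Qed.

(** A minimizing sequence with excess O(16^-k) is rapidly Cauchy in L^2(Q)
    and converges to an admissible control. Comparing the limit with the
    [k]-th term through Young's inequality with parameter [e = 4^-k], the
    error [(1 + e^-1) 16^-k] still tends to zero, for every fixed number of
    modes. *)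
Lemma minimizer_exists : exists u z, feas u z /\ cost_value u z <= inf cost_values.
Proof.
pose e k : R := (4^-1) ^+ k.
have e0 k : 0 < e k by rewrite exprn_gt0.
have e2 k : e k ^+ 2 = (16 ^+ k)^-1.
  by rewrite /e -exprM mulnC exprM -exprVn; congr (_ ^+ k); field.
have m8 : 0 < m / 8 by rewrite divr_gt0.
have /choice[uz Huz] : forall k, exists uz : traj * traj, feas uz.1 uz.2 /\
    cost_value uz.1 uz.2 <= inf cost_values + m / 8 * e k ^+ 2.
  move=> k; have ek : 0 < m / 8 * e k ^+ 2 by rewrite mulr_gt0// exprn_gt0.
  have [_ [u [z [fuz ->]]] /ltW H] := inf_adherent ek has_inf_cost_values.
  by exists (u, z).
have fk k := (Huz k).1; have Jk k := (Huz k).2.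
have Lk k := feas_L2 (fk k).
have e_anti k l : (k <= l)%N -> e l ^+ 2 <= e k ^+ 2.
  move=> kl; rewrite !e2 lef_pV2 ?posrE ?exprn_gt0//.
  by rewrite ler_weXn2l// ler1n.
have close k l : (k <= l)%N -> dist2 (uz l).2 (uz k).2 <= (16 ^+ k)^-1.
  move=> kl; apply: le_trans (near_optimal_close (fk l) (fk k) (Jk l) (Jk k)) _.
  by have := e_anti _ _ kl; rewrite -e2; lra.
have closeE k l : (k <= l)%N ->
    (\int[nu]_(p in Q) (((uz l).2 p.1 p.2 - (uz k).2 p.1 p.2) ^+ 2)%:E <= ((16 ^+ k)^-1)%:E)%E.
  move=> /close; rewrite -lee_fin; apply: le_trans.
  by rewrite -(L2Q_sqr oO (L2QB oO (Lk l) (Lk k))).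
have [w [Lw cw dw]] := @L2_fast_cauchy_limit _ _ R nu Q (fun k p => (uz k).2 p.1 p.2) mQ Lk closeE.
pose z : traj := fun t x => w (t, x).
have z_ad : Zad Omega T a b z := Zad_cvg (fun k => feas_Zad (fk k)) Lw cw.
have [u uz'] := feas_state z_ad.
have Lz := feas_L2 uz'.
have dz k : dist2 z (uz k).2 <= e k ^+ 2.
  rewrite e2 -lee_fin -(L2Q_sqr oO (L2QB oO Lz (Lk k))).
  apply: le_trans (dw k); apply: ge0_le_integral_nonmeas => -[t x] _//=.
  by rewrite lee_fin sqr_ge0.
exists u, z; split => //.
have [y uy sy] := feasible_modes uz'.
have bound N : (\int[leb]_(t in `]0%R, T[) (modal_misfit Omega phi ud y N t)%:E <=
    (2 * inf cost_values - m * L2Qip Omega T z z)%:E)%E.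
  have [C C0 HC] := modal_misfit_dist N.
  pose K := 2 * inf cost_values + m / 2 + 2 * (C + m).
    (* Twice the cost of the k-th pair is at most 2 inf + (m / 4) (e k)^2,
     and e k <= 1. *)
have step k : (\int[leb]_(t in `]0%R, T[) (modal_misfit Omega phi ud y N t)%:E <=
      (2 * inf cost_values - m * L2Qip Omega T z z + e k * K)%:E)%E.
    apply: le_trans (HC _ _ _ _ _ _ (e0 k) uz' (fk k) uy sy) _.
    rewrite (misfit_fin (fk k)) -EFinM -EFinD lee_fin.
    have : L2Qip Omega T z z <= (1 + e k) * L2Qip Omega T (uz k).2 (uz k).2 +
        (1 + (e k)^-1) * dist2 z (uz k).2 := L2ip_young mQ (e0 k) Lz (Lk k).
    have := Jk k; rewrite /cost_value; have := dz k; have := dist2_ge0 z (uz k).2.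
    set A := fine _; set P := L2Qip _ _ z z; set P' := L2Qip _ _ _ _; set D := dist2 _ _.
    have ek0 := e0 k; have ek1 : e k <= 1 by rewrite exprn_ile1// invf_le1// ler1n.
    set x := e k in ek0 ek1 *.
    move=> D0 Dx HJ Hy.
    have xV0 : 0 < x^-1 by rewrite invr_gt0.
    have Dx' : (1 + x^-1) * D <= 2 * x.
      apply: (@le_trans _ _ ((1 + x^-1) * x ^+ 2)).
        by apply: ler_wpM2l => //; rewrite addr_ge0// ltW.
      rewrite mulrDl mul1r expr2 mulKf ?gt_eqF//.
      have : x * x <= x * 1 by rewrite ler_wpM2l// ltW.
      lra.
    have CD : (1 + x^-1) * (C * D) <= C * (2 * x) by rewrite mulrCA ler_wpM2l.
    have mP : m * P <= m * ((1 + x) * P' + 2 * x).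
      by apply: ler_wpM2l; [exact: ltW|lra].
    have HJ' : (1 + x) * (A + m * P') <= (1 + x) * (2 * inf cost_values + m / 4 * x ^+ 2).
      by apply: ler_wpM2l; [lra|move: HJ; lra].
    have x2 : (1 + x) * (m / 4 * x ^+ 2) <= m / 2 * x.
      have mx : (1 + x) * x ^+ 2 <= 2 * x.
        rewrite expr2 mulrA; apply: ler_wpM2r; first exact: ltW.
        have : x * x <= x * 1 by rewrite ler_wpM2l// ltW.
        lra.
      have : m / 4 * ((1 + x) * x ^+ 2) <= m / 4 * (2 * x).
        by apply: ler_wpM2l => //; rewrite divr_ge0// ltW.
      lra.
    by rewrite /K; move: CD mP HJ' x2; lra.
  apply/lee_addgt0Pr => r r0; rewrite -EFinD.
  have [k ek] : exists k, e k * K <= r.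
    have : (fun k => e k * K) @ \oo --> (0 * K : R).
      apply: cvgM; last exact: cvg_cst.
      by apply: cvg_expr; rewrite gtr0_norm ?invr_gt0// invf_lt1// ltr1n.
    rewrite mul0r => /cvgrPdist_le/(_ r r0)[k _ Hk]; exists k.
    by have := Hk k (leqnn k); rewrite sub0r normrN; apply: le_trans; exact: ler_norm.
  by apply: le_trans (step k) _; rewrite lee_fin lerD2l.
have := misfit_le oO Lphi phi_orth phi_basis Lud uy bound.
rewrite (misfit_fin uz') lee_fin /cost_value => h.
by move: h; set A := fine _; set P := L2Qip _ _ _ _; lra.
Qed.

(** Two minimizers have controls at distance zero; their states then have
    the same modes, and a function all of whose coefficients vanish is null. *)
Lemma minimizer_unique u z u' z' : feas u z -> feas u' z' ->
  cost_value u z <= inf cost_values -> cost_value u' z' <= inf cost_values -> eqW Omega T u' u /\ eqQ Omega T z' z.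
Proof.
move=> uz uz' Ju Ju'.
have Lz := feas_L2 uz; have Lz' := feas_L2 uz'.
have d0 : dist2 z' z = 0.
  apply/eqP; rewrite eq_le dist2_ge0 andbT.
  have := @near_optimal_close 0 0 _ _ _ _ uz' uz.
  by rewrite !mulr0 !addr0 mulr0; apply.
have LB := L2QB oO Lz' Lz.
split; last first.
  apply: ae_imply (L2ip_eq0_ae mQ LB d0) => p H Qp.
  by apply/eqP; rewrite -subr_eq0; apply/eqP; exact: H.
have [y uy sy] := feasible_modes uz; have [y' uy' sy'] := feasible_modes uz'.
have yy' j : \forall t \ae leb, t \in `]0, T[ -> y' j t = y j t.
  apply: (mode_solution_unique gm0 T0 (sy' j) (sy j)).
  by apply: le_trans (control_mode_dist j Lz' Lz) _; rewrite d0.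
apply: ae_imply3 (ae_foralln yy') (ae_modes oO Lud uy) (ae_modes oO Lud uy') => t H H1 H2 tT.
have [Lu uE _] := H1 tT; have [Lu' uE' _] := H2 tT.
have LD := L2B mO Lu' Lu.
have D0 : L2ip mu Omega (u' t - u t) (u' t - u t) = 0.
  have := parseval mO Lphi phi_orth LD (phi_basis LD).
  rewrite (_ : (fun N => _) = cst 0).
    by move=> h; rewrite -(cvg_lim _ h)//; apply: cvg_lim => //; exact: cvg_cst.
  apply/funext => N; apply: big1 => k _.
  have -> : L2ip mu Omega (u' t - u t) (phi k) = ip Omega (u' t) (phi k) - ip Omega (u t) (phi k).
    exact: (L2ipBl mO Lu' Lu (Lphi k)).
  by rewrite uE uE' H// subrr expr0n.
apply: ae_imply (L2ip_eq0_ae mO LD D0) => x Hx Ox.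
by apply/eqP; rewrite -subr_eq0; apply/eqP; exact: Hx.
Qed.

Lemma unique_minimizer : exists u z,
  (feas u z /\ forall u' z', feas u' z' ->
    (cost Omega T m ud u z <= cost Omega T m ud u' z')%E) /\
  forall u' z', feas u' z' /\ (forall u'' z'', feas u'' z'' ->
    (cost Omega T m ud u' z' <= cost Omega T m ud u'' z'')%E) ->
    eqW Omega T u' u /\ eqQ Omega T z' z.
Proof.
have le_costE u z u' z' : feas u z -> feas u' z' ->
    (cost Omega T m ud u z <= cost Omega T m ud u' z')%E = (cost_value u z <= cost_value u' z').
  move=> uz uz'; rewrite -lee_fin.
  exact: (congr2 (fun x y : \bar R => (x <= y)%E) (cost_valueE uz) (cost_valueE uz')).
have [u [z [uz zmin]]] := minimizer_exists; exists u, z; split.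
  split; [exact: uz|move=> u' z' uz'; rewrite (le_costE _ _ _ _ uz uz')].
  exact: le_trans zmin (inf_cost_value_le uz').
move=> u' z' [uz' opt]; apply: minimizer_unique => //.
have := opt _ _ uz; rewrite (le_costE _ _ _ _ uz' uz) => h.
exact: le_trans h zmin.
Qed.

End minimization.

(** * The optimal control problem *)

Theorem theorem3p3 (R : realType) (n : nat) (hn : (1 <= n)%N)
  (Omega : set 'rV[R]_n)
  (Omega_open : open Omega) (Omega_bounded : bounded_set Omega)
  (Omega_connected : connected Omega)
  (Omega_polyhedral : polyhedral_boundary Omega)
  (T : R) (T_gt0 : 0 < T)
  (A : 'rV[R]_n -> 'M[R]_n) (c : 'rV[R]_n -> R)
  (Ac_admissible : admissible_coefficients Omega A c)
  (lambda : nat -> R) (phi : nat -> 'rV[R]_n -> R)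
  (eigen : eigenbasis Omega A c lambda phi)
  (s : R) (s_gt0 : 0 < s) (s_lt1 : s < 1)
  (gamma : R) (gamma_gt0 : 0 < gamma) (gamma_le1 : gamma <= 1)
  (m : R) (m_gt0 : 0 < m)
  (f : R -> ('rV[R]_n -> R) -> R) (f_L2 : L2_Hms Omega T s f)
  (u0 : 'rV[R]_n -> R) (u0_L2 : L2O Omega u0)
  (ud : R -> 'rV[R]_n -> R) (ud_L2 : L2Q Omega T ud)
  (a b : R -> 'rV[R]_n -> R) (a_L2 : L2Q Omega T a) (b_L2 : L2Q Omega T b)
  (le_ab : \forall p \ae (@lebesgue_measure R \x lebesgue_rV R n)%E,
     cylinder Omega T p -> a p.1 p.2 <= b p.1 p.2)
  (* existence part of the well-posedness of the state equation, needed only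
     for the admissible controls *)
  (state_exists : forall z, Zad Omega T a b z ->
     exists2 u, spaceW Omega T s gamma u &
       state_equation Omega T s gamma lambda phi f u0 u z) :
  exists u z,
    optimal Omega T s gamma lambda phi m ud f u0 a b u z /\
    forall u' z',
      optimal Omega T s gamma lambda phi m ud f u0 a b u' z' ->
      eqW Omega T u' u /\ eqQ Omega T z' z.
Proof.
have [eig phi_orth phi_basis] := eigen.
have phi_H10 k : exists G, H10 Omega (phi k) G by have [G HG _] := eig k; exists G.
have Lphi k := eigenfunction_L2 phi_H10 k.
have [c' modes] := state_modes Omega_open lambda T_gt0 s_gt0 s_lt1 gamma_gt0 phi_H10 phi_orth gamma_le1.
apply: (unique_minimizer Omega_open T_gt0 Lphi phi_orth phi_basis ud_L2 m_gt0 gamma_gt0 (a := a) (b := b)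
  (gm := gamma) (c := c') (lam := fun j => lambda j `^ s) (y0 := fun j => ip Omega u0 (phi j))
  (F := fun j t => f t (phi j))).
- by move=> u z [].
- by move=> u z [[]].
- move=> z Zz; have [u Wu su] := state_exists z Zz; exists u; split=> //.
- by move=> u z [[bu _ _] _ su] j; exact: modes su j.
- have a_ad : Zad Omega T a b a.
    by split=> //; apply: ae_imply le_ab => p H Qp; rewrite lexx H.
  by have [u Wu su] := state_exists a a_ad; exists u, a; split.
Qed.
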